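(* Let $X_1,X_2,\ldots$ be the age-ordered limit frequencies of an exchangeable Gibbs partition EGP$(\alpha,V)$ with $\alpha<1$ and record indices $i_1<i_2<\cdots$, and for every $k$ let $W_k=\sum_{i=1}^kX_i$. Let $k\ge2$ and $i\ge0$ be integers. (i) Conditional on $W_k=w$ ($w>0$) and on $i_k=k+i$ (when $\mathbb{P}(i_k=k+i)>0$), the law of the vector $(X_1,\ldots,X_k)$ is $$d\mu_{\alpha,V}(x_1,\ldots,x_k\mid w,k+i)=\frac{1}{\mathbb{P}(i_k=k+i)}\,\frac{V_{k+i,k}}{V_{k+i-1,k-1}}\,w^{-(k-1)}\sum_{\mathbf{m}\in\mathbb{N}^{k-1}:|\mathbf{m}|=k+i-1}\bar\mu_{\alpha,V}(\mathbf{m})\,\mathcal{D}_{(\mathbf{m}-\alpha)}\Big(\frac{x_1}{w},\ldots,\frac{x_k}{w}\Big)\,dx_1\cdots dx_{k-1}$$ on $\{x_1,\ldots,x_k\ge0,\ x_1+\cdots+x_k=w\}$, where $\mathcal{D}_{(\mathbf{m}-\alpha)}$ is the Dirichlet density with parameters $(m_1-\alpha,\ldots,m_{k-1}-\alpha,1-\alpha)$ and $$\bar\mu_{\alpha,V}(\mathbf{m})=\left(\frac{(k+i-1)!}{\prod_{j=1}^{k-1}(m_j-1)!\,\big(k+i-1-\sum_{l=1}^{j-1}m_l\big)}\right)V_{k+i-1,k-1}\prod_{j=1}^{k-1}(1-\alpha)_{(m_j-1)}$$ is the age-ordered sampling formula of the EGP$(\alpha,V)$, i.e. the probability that $\Pi_{k+i-1}$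 has exactly $k-1$ classes with age-ordered frequencies $\mathbf{m}$. (ii) The marginal distribution of $i_k$ is $$\mathbb{P}(i_k=k+i)=V_{k+i,k}\,\alpha^{-(k-1)}\sum_{j=0}^{k-1}\frac{(-1)^{j+k+i-1}}{j!\,(k-j-1)!}\,(\alpha j)_{[k+i-1]},$$ where $a_{[n]}=a(a-1)\cdots(a-n+1)$; for $\alpha=0$ the factor multiplying $V_{k+i,k}$ is read as its limit as $\alpha\to0$.
   Context: Notation: $a_{(x)}=\Gamma(a+x)/\Gamma(a)$; $\mathbb{N}=\{1,2,\ldots\}$; $|\mathbf{m}|=\sum_jm_j$. The Dirichlet density with parameters $(a_1,\ldots,a_k)$ is taken with respect to Lebesgue measure in the first $k-1$ coordinates of the simplex $\{y_1+\cdots+y_k=1,\ y_j\ge0\}$. A random partition of $[n]=\{1,\ldots,n\}$ is written $\Pi_n=(\Pi_{n1},\ldots,\Pi_{nk})$ with classes ordered by their least elements; its age-ordered frequencies are $(|\Pi_{n1}|,\ldots,|\Pi_{nk}|)$. For a consistent family $\Pi=(\Pi_n)$ (a random partition of $\mathbb{N}$), the record indices $1=i_1<i_2<\cdots$ are the least elements of its classes ($i_j=\infty$ if there are fewer than $j$ classes), and the limit age-ordered frequencies are $X_j=\lim_{n\to\infty}|\Pi_{nj}|/n$. Let $\alpha\in(-\infty,1]$ and let $V=(V_{n,k}:1\le k\le n)$ be nonnegative coefficients with $V_{1,1}=1$ and $V_{n,k}=(n-\alpha k)V_{n+1,k}+V_{n+1,k+1}$. The exchangeable Gibbs partition EGP$(\alpha,V)$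 is the random partition $\Pi=(\Pi_n)$ of $\mathbb{N}$ generated by: $\Pi_1=(\{1\})$; for $n\ge1$, given $\Pi_n=(\pi_{n1},\ldots,\pi_{nk})$ with class sizes $n_j=|\pi_{nj}|$, the element $n+1$ starts a new class with probability $V_{n+1,k+1}/V_{n,k}$, and joins the class $\pi_{nj}$ with probability $\frac{n_j-\alpha}{n-\alpha k}\left(1-\frac{V_{n+1,k+1}}{V_{n,k}}\right)$, $j=1,\ldots,k$. *)

(* Defs.v *)
From HB Require Import structures.
From mathcomp Require Import all_boot all_order all_algebra finmap.
From mathcomp Require Import all_classical all_reals all_analysis.
From mathcomp Require Import measurable_realfun.

Set Implicit Arguments.
Unset Strict Implicit.
Unset Printing Implicit Defensive.

Import Order.TTheory GRing.Theory Num.Theory.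
Import numFieldNormedType.Exports.

Local Open Scope classical_set_scope.
Local Open Scope ring_scope.

(* A partition of [n] = {1, ..., n} is the sequence of its classes, listed by
   increasing least element: [least_lt A B] says min A < min B. *)
Definition least_lt (A B : {fset nat}) : bool :=
  has (fun a => all (fun b => (a < b)%N) B) A.

Record partition_of (n : nat) (p : seq {fset nat}) : Prop := PartitionOf {
  class_neq0 : forall A, A \in p -> A != fset0;
  class_disjoint : pairwise (fun A B : {fset nat} => [disjoint A & B]%fset) p;
  class_cover : forall x : nat, (exists2 A, A \in p & x \in A) <-> (1 <= x <= n)%N;
  class_sorted : pairwise least_lt p
}.

(* The j-th class, j = 1, 2, ...; empty when there are fewer than j classes. *)
Definition class_at (p : seq {fset nat}) (j : nat) : {fset nat} :=
  nth fset0 p j.-1.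

Definition age_freq (p : seq {fset nat}) : seq nat := [seq #|` A| | A <- p].

(* The partition of [n] induced by a partition of [n+1]. *)
Definition restriction (n : nat) (p : seq {fset nat}) : seq {fset nat} :=
  [seq A <- [seq (A `\ n.+1)%fset | A <- p] | A != fset0].

Definition add_class (n : nat) (p : seq {fset nat}) : seq {fset nat} :=
  rcons p [fset n.+1]%fset.

Definition join_class (n : nat) (p : seq {fset nat}) (j : nat) :
    seq {fset nat} :=
  set_nth fset0 p j.-1 (n.+1 |` class_at p j)%fset.

Section random_partitions.
Context d (T : measurableType d) (R : realType).

(* A random partition of {1, 2, ...}, given by its restrictions to [n]
   (the restriction to the empty set [0] is the empty sequence). *)
Record random_partition (Pi : nat -> T -> seq {fset nat}) : Prop :=
  RandomPartition {
    rp_partition : forall n omega, partition_of n (Pi n omega);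
    rp_consistent :
      forall n omega, restriction n (Pi n.+1 omega) = Pi n omega;
    rp_measurable : forall n p, measurable [set omega | Pi n omega = p]
  }.

(* Least element of the j-th class of the partition of {1, 2, ...}; the
   infimum of the empty set being +oo. *)
Definition record_index (Pi : nat -> T -> seq {fset nat}) (j : nat)
    (omega : T) : \bar R :=
  ereal_inf [set (x%:R)%:E |
    x in \bigcup_n [set x : nat | x \in class_at (Pi n omega) j]].

Definition limit_freq (Pi : nat -> T -> seq {fset nat}) (j : nat)
    (omega : T) : R :=
  limn (fun n : nat => #|` class_at (Pi n omega) j|%:R / n%:R : R).

Definition limit_freq_vector (Pi : nat -> T -> seq {fset nat}) (k : nat)
    (omega : T) : k.-tuple R :=
  [tuple limit_freq Pi j.+1 omega | j < k].

Definition limit_freq_sum (Pi : nat -> T -> seq {fset nat}) (k : nat)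
    (omega : T) : R :=
  \sum_(1 <= j < k.+1) limit_freq Pi j omega.

Definition cond_prob (P : probability T R) (A B : set T) : R :=
  fine (P (A `&` B)) / fine (P B).

(* [kappa] is a version, for w in [D], of the regular conditional distribution
   of [Y] given the event [E] and [W = w]. *)
Record conditional_law (P : probability T R) (E : set T) (W : T -> R)
    d' (T' : measurableType d') (Y : T -> T') (D : set R)
    (kappa : R -> set T' -> \bar R) : Prop := ConditionalLaw {
  cl_event : measurable E;
  cl_given : measurable_fun setT W;
  cl_variable : measurable_fun setT Y;
  cl_probability : forall w, D w ->
    exists Q : probability T' R, forall A, measurable A -> kappa w A = Q A;
  cl_measurable : forall A, measurable A -> measurable_fun D (kappa ^~ A);
  cl_disintegration : forall A B, measurable A -> measurable B -> B `<=` D ->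
    P (E `&` W @^-1` B `&` Y @^-1` A) =
    (\int[P]_(omega in E `&` W @^-1` B) kappa (W omega) A)%E
}.

End random_partitions.

Section gibbs.
Context (R : realType).

Record gibbs_coefficients (alpha : R) (V : nat -> nat -> R) : Prop :=
  GibbsCoefficients {
    gibbs_ge0 : forall n k, (1 <= k <= n)%N -> 0 <= V n k;
    gibbs_11 : V 1%N 1%N = 1;
    gibbs_rec : forall n k, (1 <= k <= n)%N ->
      V n k = (n%:R - alpha * k%:R) * V n.+1 k + V n.+1 k.+1
  }.

Record exchangeable_gibbs_partition d (T : measurableType d)
    (P : probability T R) (alpha : R) (V : nat -> nat -> R)
    (Pi : nat -> T -> seq {fset nat}) : Prop := ExchangeableGibbsPartition {
  egp_random_partition : random_partition Pi;
  egp_1 : forall omega, Pi 1%N omega = [:: [fset 1%N]%fset];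
  egp_new : forall n p, (0 < n)%N -> P [set omega | Pi n omega = p] != 0%E ->
    let k := size p in
    cond_prob P [set omega | Pi n.+1 omega = add_class n p]
                [set omega | Pi n omega = p] =
    V n.+1 k.+1 / V n k;
  egp_join : forall n p j, (0 < n)%N ->
    P [set omega | Pi n omega = p] != 0%E -> (1 <= j <= size p)%N ->
    let k := size p in
    cond_prob P [set omega | Pi n.+1 omega = join_class n p j]
                [set omega | Pi n omega = p] =
    (#|` class_at p j|%:R - alpha) / (n%:R - alpha * k%:R) *
    (1 - V n.+1 k.+1 / V n k)
}.

Definition Gamma (a : R) : R :=
  \int[@lebesgue_measure R]_(t in `]0, +oo[) (t `^ (a - 1) * expR (- t)).

Definition pochhammer (a x : R) : R := Gamma (a + x) / Gamma a.

Definition falling (a : R) (n : nat) : R := \prod_(0 <= l < n) (a - l%:R).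

(* Lebesgue integral over R^n, as an iterated integral; by Tonelli this is the
   integral against Lebesgue measure for nonnegative measurable integrands. *)
Fixpoint lebesgue_integral_tuple (n : nat) :
    (n.-tuple R -> \bar R) -> \bar R :=
  match n with
  | 0 => fun f => f [tuple]
  | n'.+1 => fun f =>
      (\int[@lebesgue_measure R]_x
         lebesgue_integral_tuple (fun t : n'.-tuple R => f (cons_tuple x t)))%E
  end.

(* Meaningful for [y] in the simplex only: the domain is enforced where the
   density is integrated. *)
Definition dirichlet_pdf (a y : seq R) : R :=
  Gamma (\sum_(b <- a) b) / (\prod_(b <- a) Gamma b) *
  \prod_(j < size a) (y`_j `^ (a`_j - 1)).

(* Age-ordered sampling formula, for [m] with positive entries; here
   [sumn (take j m)] is the sum of the j first entries and j starts at 0. *)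
Definition sampling_formula (alpha : R) (V : nat -> nat -> R) (m : seq nat) :
    R :=
  let n := sumn m in
  n`!%:R / (\prod_(j < size m)
              ((nth 0%N m j).-1`!%:R * (n - sumn (take j m))%:R)) *
  V n (size m) *
  \prod_(b <- m) pochhammer (1 - alpha) b.-1%:R.

(* Density at [x] (of length k, summing to w), [pr] standing for the
   probability that i_k = k + i. The entries of a composition of k + i - 1
   into k - 1 positive parts are all less than k + i, whence the index type. *)
Definition cond_density (alpha : R) (V : nat -> nat -> R) (k i : nat)
    (pr w : R) (x : seq R) : R :=
  pr^-1 * (V (k + i)%N k / V (k + i).-1 k.-1) * w ^- k.-1 *
  \sum_(m : (k.-1).-tuple 'I_(k + i) |
          all (fun b : 'I_(k + i) => (0 < b)%N) m &&
          (sumn [seq val b | b <- m] == (k + i).-1))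
    (sampling_formula alpha V [seq val b | b <- m] *
     dirichlet_pdf (rcons [seq (val b)%:R - alpha | b <- m] (1 - alpha))
                   [seq xj / w | xj <- x]).

(* The law with this density with respect to dx_1 ... dx_(k-1), where
   x_k = w - (x_1 + ... + x_(k-1)). *)
Definition cond_measure (alpha : R) (V : nat -> nat -> R) (k i : nat)
    (pr w : R) (A : set (k.-tuple R)) : \bar R :=
  lebesgue_integral_tuple (fun t : (k.-1).-tuple R =>
    let s := rcons t (w - \sum_(b <- t) b) in
    let x : k.-tuple R := [tuple s`_j | j < k] in
    if all (fun b => 0 <= b) x && (x \in A)
    then (cond_density alpha V k i pr w x)%:E else 0%E).

(* The factor multiplying V_(k+i,k) in the marginal law of i_k. *)
Definition record_factor (k i : nat) (a : R) : R :=
  a ^- k.-1 *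
  \sum_(0 <= j < k)
    ((-1) ^+ (j + k + i).-1 / (j`!%:R * (k - j.+1)`!%:R) *
     falling (a * j%:R) (k + i).-1).

End gibbs.

Arguments cond_measure {R} alpha V k i pr w A.

(* Main.v *)
(* For a partition p of [n] with k classes of sizes n_1, ..., n_k, the Gibbs
   law is P(Pi_n = p) = V n k * prod_j (1 - alpha)_(n_j - 1). With
   Phi_r(n, p) := prod_(j <= k) (n_j - alpha)_(r_j) * V (n + |r|) (size p), the
   process Phi_r(n, Pi_n) / V n (size Pi_n) is a martingale. For |r| <= 2 this
   bounds E[(n_j/n - n'_j/n')^2] by a constant times |1/n - 1/n'|, hence n_j/n
   converges almost surely, along n = ((l + 1)(l + 2))^2 first and then by
   monotonicity of n_j. For general r, in the limit, it gives the moments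
   E[G(Pi_n) X^r] = E[G(Pi_n) Phi_r(n, Pi_n) / V n (size Pi_n)], the function
   G vanishing on partitions with fewer than k classes; summation over r gives
   E[1_E X^r W^s] on the event E = {i_k = k + i}, which is a condition on
   Pi_(k+i).
   The Dirichlet moments show that the image measures under X of 1_E dP and of
   1_E kappa(W, .) dP have the same moments, where kappa(w, .) is the law of w
   times a point with the mixture of Dirichlet distributions as density; both
   are carried by a cube, hence they are equal. This holds on every set
   A :&: {sum of coordinates in B}, which is the disintegration. The explicit
   law of i_k comes from the recursion of the generalized Stirling numbers
   sum over p of [n] with k classes of prod_j (1 - alpha)_(n_j - 1). *)
Require Import Defs.
From HB Require Import structures.
From mathcomp Require Import all_boot all_order all_algebra finmap.
From mathcomp Require Import all_classical all_reals all_analysis.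
From mathcomp Require Import measurable_realfun.
From mathcomp Require Import ring lra zify.

Set Implicit Arguments.
Unset Strict Implicit.
Unset Printing Implicit Defensive.

Import Order.TTheory GRing.Theory Num.Theory.
Import numFieldNormedType.Exports.

Local Open Scope classical_set_scope.
Local Open Scope ring_scope.

(** * Partitions by successive insertion *)

Section partition_children.
Local Open Scope nat_scope.
Implicit Types (n : nat) (p q : seq {fset nat}).

(** The coefficients V enter the joint moment E[1_E X^r W^s] only through their value at n + |r| +
    s, so the pairs (r, 0) and (0, |r|) involve the same V. It cancels in the comparison and leaves
    E[1_E X^r] = c_r E[1_E W^|r|], with c_r a moment of the Dirichlet mixture: on E, V acts on W
    alone. This is why powers of W are computed along with monomials in X. The conditional law is
    given by an iterated integral; a Daniell argument turns it into a measure, so that moments can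
    identify it. Bounded support then lets explicit polynomials approximate indicators of orthants.
    All identities at finite n are finite sums over an explicit list of partitions, built by
    inserting one element at a time. The factor G has to vanish below k classes: only then do the k
    first classes exist at time n, so that a later element enters them by joining and never by
    opening one of them. *)

Definition children n p : seq (seq {fset nat}) :=
  add_class n p :: [seq join_class n p j.+1 | j <- iota 0 (size p)].

(** An explicit list makes every expectation of a function of Pi_n a finite sum. At n = 0 the list
    is empty by convention, whence the assumption [0 < n] in later statements. *)
Fixpoint partitions n : seq (seq {fset nat}) :=
  if n is m.+1 then
    if m is 0 then [:: [:: [fset 1]%fset]]
    else flatten [seq children m p | p <- partitions m]
  else [::].

(** Much weaker than [partition_of]: it keeps only what makes n+1 a fresh element and every class
    nonempty, so that [restriction] undoes an insertion. *)
Definition classes_below n p :=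
  all (fun A : {fset nat} => (A != fset0) && all (fun x => x <= n) A) p.

Lemma notin_below n p (A : {fset nat}) :
  classes_below n p -> A \in p -> n.+1 \notin A.
Proof.
move=> /allP h /h /andP[_ /allP hA]; apply/negP => /hA.
by rewrite ltnn.
Qed.

Lemma classes_belowP n p j : classes_below n p -> j < size p ->
  nth fset0 p j != fset0 /\ n.+1 \notin nth fset0 p j.
Proof.
move=> h jp; have hj := mem_nth fset0 jp; split; last exact: notin_below h hj.
by have /andP[] := allP h _ hj.
Qed.

Lemma set_nth_id p j (A : {fset nat}) : j < size p ->
  set_nth fset0 p j A = take j p ++ A :: drop j.+1 p.
Proof. by move=> jp; rewrite set_nthE jp. Qed.

Lemma restriction_id n p : classes_below n p -> restriction n p = p.
Proof.
rewrite /restriction; elim: p => //= A p IH /andP[/andP[A0 hA] hp].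
have -> : (A `\ n.+1)%fset = A.
  by apply: mem_fsetD1; apply/negP => /(allP hA); rewrite ltnn.
by rewrite A0 IH.
Qed.

Lemma restriction_cat n p q :
  restriction n (p ++ q) = restriction n p ++ restriction n q.
Proof. by rewrite /restriction map_cat filter_cat. Qed.

Lemma restriction_child n p q :
  classes_below n p -> q \in children n p -> restriction n q = p.
Proof.
move=> hp; rewrite inE => /orP[/eqP ->|/mapP[j]].
  rewrite /add_class -cats1 restriction_cat restriction_id// /restriction/=.
  by rewrite fsetDv eqxx cats0.
rewrite mem_iota add0n => /= jp ->.
rewrite /join_class /class_at /= set_nth_id//.
have [A0 hA] := classes_belowP hp jp.
have : classes_below n (take j p ++ nth fset0 p j :: drop j.+1 p).
  by rewrite -drop_nth// cat_take_drop.
rewrite /classes_below all_cat /= => /and3P[h1 h2 h3].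
rewrite restriction_cat restriction_id//.
rewrite -(cat1s (_ |` _)%fset) restriction_cat (restriction_id h3) {1}/restriction/=.
rewrite fsetU1K// A0 /= -cat_rcons -cats1 -catA /= -drop_nth//.
by rewrite cat_take_drop.
Qed.

Lemma classes_below_child n p q :
  classes_below n p -> q \in children n p -> classes_below n.+1 q.
Proof.
move=> hp.
have hS : classes_below n.+1 p.
  apply/allP => A /(allP hp) /andP[-> /allP hA].
  by apply/allP => x /hA /leqW.
rewrite inE => /orP[/eqP ->|/mapP[j]].
  rewrite /classes_below /add_class all_rcons; apply/andP; split => //.
  apply/andP; split.
    by apply/fset0Pn; exists n.+1; rewrite inE.
  by apply/allP => x; rewrite inE => /eqP ->.
rewrite mem_iota add0n => /= jp ->.
rewrite /join_class /class_at /= set_nth_id//.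
have : classes_below n.+1 (take j p ++ nth fset0 p j :: drop j.+1 p).
  by rewrite -drop_nth// cat_take_drop.
rewrite /classes_below !all_cat /= => /and3P[-> /andP[h1 h2] ->].
rewrite andbT /=; apply/andP; split.
  by apply/fset0Pn; exists n.+1; rewrite !inE eqxx.
by apply/allP => x; rewrite !inE => /orP[/eqP ->//|/(allP h2)].
Qed.

Lemma classes_below_partitions n p :
  p \in partitions n -> classes_below n p.
Proof.
elim: n p => // -[_ p|n IH p].
  rewrite inE => /eqP -> /=; rewrite andbT; apply/andP; split.
    by apply/fset0Pn; exists 1; rewrite inE.
  by apply/allP => x; rewrite inE => /eqP ->.
by move=> /flatten_mapP[q /IH hq]; exact: classes_below_child.
Qed.

Lemma age_freq_add n p : age_freq (add_class n p) = rcons (age_freq p) 1.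
Proof. by rewrite /age_freq /add_class map_rcons cardfs1. Qed.

Lemma nth_age_freq p j : nth 0 (age_freq p) j = #|` nth fset0 p j|.
Proof.
have [jp|jp] := ltnP j (size p); first by rewrite (nth_map fset0).
by rewrite !nth_default ?cardfs0// size_map.
Qed.

Lemma size_age_freq p : size (age_freq p) = size p.
Proof. exact: size_map. Qed.

Lemma age_freq_join n p j : classes_below n p -> j < size p ->
  age_freq (join_class n p j.+1) = incr_nth (age_freq p) j.
Proof.
move=> hp jp; have [A0 hA] := classes_belowP hp jp.
have sz : size (join_class n p j.+1) = size p.
  by rewrite /join_class size_set_nth /= (maxn_idPr _).
apply: (@eq_from_nth _ 0).
  by rewrite size_incr_nth !size_age_freq sz jp.
move=> i; rewrite size_age_freq sz => ip.
rewrite nth_incr_nth !nth_age_freq /join_class nth_set_nth /= /class_at /=.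
case: (eqVneq i j) => [->|//].
by rewrite cardfsU1 hA.
Qed.

Lemma size_child n p q : q \in children n p ->
  size q = (size p).+1 \/ size q = size p.
Proof.
rewrite inE => /orP[/eqP ->|/mapP[j]]; first by left; rewrite size_rcons.
rewrite mem_iota add0n => /= jp ->; right.
by rewrite /join_class size_set_nth /= (maxn_idPr _).
Qed.

Lemma uniq_children n p : classes_below n p -> uniq (children n p).
Proof.
move=> hp /=; apply/andP; split.
  apply/negP => /mapP[j]; rewrite mem_iota add0n => /= jp.
  move=> /(congr1 size); rewrite size_rcons /join_class size_set_nth /=.
  rewrite (maxn_idPr _)// => h.
  by have := ltnn (size p); rewrite -{2}h ltnS leqnn.
rewrite map_inj_in_uniq ?iota_uniq// => i j.
rewrite !mem_iota !add0n /= => ip jp; apply: contra_eq => ij.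
have [_ hA] := classes_belowP hp jp.
apply/eqP => /(congr1 (fun s => nth fset0 s j)).
rewrite /join_class !nth_set_nth /= eqxx eq_sym (negbTE ij) => h.
by move: hA; rewrite h /class_at /= !inE eqxx.
Qed.

(** A child determines its parent through [restriction], so the lists of children of distinct
    partitions are disjoint. *)
Lemma uniq_partitions n : uniq (partitions n).
Proof.
elim: n => // -[//|n] IH.
change (uniq (flatten [seq children n.+1 p | p <- partitions n.+1])).
have: {in partitions n.+1, forall p, classes_below n.+1 p}.
  by move=> p; exact: classes_below_partitions.
elim: (partitions n.+1) IH => // p s IH /andP[ps us] h.
have hp : classes_below n.+1 p by apply: h; rewrite mem_head.
rewrite map_cons -cat1s flatten_cat {1}/flatten [foldr _ _ _]cats0.
rewrite cat_uniq; apply/and3P; split.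
- exact: uniq_children.
- apply/hasPn => q /flatten_mapP[p' p's qp']; apply/negP => qp.
  have hp' : classes_below n.+1 p' by apply: h; rewrite inE p's orbT.
  have : p = p'.
    by rewrite -(restriction_child hp qp) -(restriction_child hp' qp').
  by move=> pp'; rewrite pp' p's in ps.
- by apply: IH => // p' p's; apply: h; rewrite inE p's orbT.
Qed.

(** Split [q] at the class A containing n+1. If A is a singleton, it has to be the last class and
    [q] opens a class; otherwise A without n+1 is a class of the restriction, in the same place. *)
Lemma partition_of_child n q : 0 < n -> partition_of n.+1 q ->
  q \in children n (restriction n q).
Proof.
move=> n0 [q0 qd qc qs].
have [A Aq nA] : exists2 A, A \in q & n.+1 \in A by apply/qc; rewrite leqnn.
have {Aq}[q1 [q2 qE]] : exists q1 q2, q = q1 ++ A :: q2.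
  by case/splitPr: Aq => q1 q2; exists q1, q2.
have bel : forall B, B \in q -> all (fun x => x <= n.+1) B.
  move=> B Bq; apply/allP => x xB.
  by have /andP[] : 1 <= x <= n.+1 by apply/qc; exists B.
have belD : forall B, B \in q -> n.+1 \notin B ->
    (B != fset0) && all (fun x => x <= n) B.
  move=> B Bq nB; rewrite q0//=; apply/allP => x xB.
  have := allP (bel _ Bq) _ xB; rewrite leq_eqVlt => /orP[/eqP xE|//].
  by rewrite -xE xB in nB.
move: qd qs; rewrite qE !pairwise_cat !pairwise_cons.
move=> /and3P[d1 _ /andP[d2 _]] /and3P[s1 _ /andP[s2 _]].
have h1 : classes_below n q1.
  apply/allP => B Bq1; apply: belD; first by rewrite qE mem_cat Bq1.
  move: d1 => /allrelP /(_ _ _ Bq1 (mem_head _ _)) /fdisjointP_sym.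
  exact.
have h2 : classes_below n q2.
  apply/allP => B Bq2; apply: belD.
    by rewrite qE mem_cat inE Bq2 !orbT.
  by move: d2 => /allP /(_ _ Bq2) /fdisjointP; exact.
rewrite restriction_cat restriction_id// -cat1s restriction_cat.
rewrite (restriction_id h2) /restriction /=.
have [A1|A1] := eqVneq (A `\ n.+1)%fset fset0.
  have AE : A = [fset n.+1]%fset.
    apply/fsetP => x; rewrite inE; apply/idP/eqP => [xA|->//].
    apply/eqP; apply: contraT => xn.
    have : x \in (A `\ n.+1)%fset by rewrite !inE xn.
    by rewrite A1.
  (* By the order of least elements, a class listed after {n+1} would have only elements above
     n+1. *)
  have q20 : q2 = [::].
    case: q2 qE h2 s2 {d1 d2 s1} => // B q2 qE /andP[/andP[B0 hB] _].
    move=> /andP[/hasP[a]]; rewrite AE inE => /eqP -> /allP hlt _.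
    have /fset0Pn[b bB] := B0.
    by have := hlt _ bB; rewrite ltnNge (leq_trans (allP hB _ bB)).
  by rewrite q20 /= !cats0 AE cats1 mem_head.
rewrite inE; apply/orP; right; apply/mapP; exists (size q1).
  by rewrite mem_iota /= size_cat /= addnS leq_addr.
rewrite /join_class /class_at /= set_nth_id ?size_cat/= ?addnS ?ltnS ?leq_addr//.
rewrite take_size_cat// nth_cat ltnn subnn /= fsetD1K//.
by rewrite drop_cat ltnNge leqnSn /= subSnn /= drop0.
Qed.

Lemma child_cases n p q : q \in children n p -> q = add_class n p \/
  exists2 j, j < size p & q = join_class n p j.+1.
Proof.
rewrite inE => /orP[/eqP ->|/mapP[j]]; first by left.
by rewrite mem_iota add0n => /= jp ->; right; exists j.
Qed.

Lemma mem_partitionsS n q : 0 < n ->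
  q \in partitions n.+1 <-> exists2 p, p \in partitions n & q \in children n p.
Proof. by case: n => // n _; split=> [/flatten_mapP//|/flatten_mapP]. Qed.

End partition_children.

(** * The Gibbs law and the sampling formula *)

Section age_freq_partitions.
Local Open Scope nat_scope.

Lemma sumn_incr_nth (s : seq nat) j : j < size s ->
  sumn (incr_nth s j) = (sumn s).+1.
Proof.
by elim: s j => // a s IH [|j] //= js; rewrite ?addSn// IH// addnS.
Qed.

Lemma age_freq_child n p q : classes_below n p -> q \in children n p ->
  age_freq q = rcons (age_freq p) 1 \/
  exists2 j, j < size p & age_freq q = incr_nth (age_freq p) j.
Proof.
move=> hp /child_cases[->|[j jp ->]]; first by left; exact: age_freq_add.
by right; exists j => //; exact: age_freq_join.
Qed.

Lemma sumn_age_freq n p : p \in partitions n -> sumn (age_freq p) = n.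
Proof.
elim: n p => // -[_ p|n IH p]; first by rewrite inE => /eqP -> /=; rewrite cardfs1.
move=> /mem_partitionsS[]// r rn /(age_freq_child (classes_below_partitions rn)).
case=> [->|[j jr ->]]; first by rewrite sumn_rcons IH// addn1.
by rewrite sumn_incr_nth ?size_age_freq// IH.
Qed.

Lemma age_freq_gt0 n p : p \in partitions n -> all (leq 1) (age_freq p).
Proof.
move=> /classes_below_partitions /allP h; rewrite /age_freq all_map.
by apply/(@allP _ _ p) => A /h /andP[A0 _]; rewrite /= cardfs_gt0.
Qed.

Lemma size_le_sumn (s : seq nat) : all (leq 1) s -> size s <= sumn s.
Proof. by elim: s => // a s IH /= /andP[a0 /IH]; rewrite -add1n; exact: leq_add. Qed.

Lemma size_partitions n p : p \in partitions n -> size p <= n.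
Proof.
move=> pn; rewrite -(sumn_age_freq pn) -size_age_freq size_le_sumn//.
exact: age_freq_gt0 pn.
Qed.

Lemma size_partitions_gt0 n p : 0 < n -> p \in partitions n -> 0 < size p.
Proof.
move=> n0 pn; rewrite lt0n; apply/eqP => /size0nil p0.
by move: n0; rewrite -(sumn_age_freq pn) p0.
Qed.

End age_freq_partitions.

Section weights.
Context (R : realType).
Implicit Types (a alpha : R) (F : seq {fset nat} -> R).

(** The rising factorial as a product, hence a polynomial in [a]; [pochhammer_rising] identifies it
    with the quotient of Gamma functions when [a] is positive. *)
Definition rising a (n : nat) : R := \prod_(l < n) (a + l%:R).

Lemma rising0 a : rising a 0 = 1. Proof. by rewrite /rising big_ord0. Qed.

Lemma risingS a n : rising a n.+1 = rising a n * (a + n%:R).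
Proof. by rewrite /rising big_ord_recr. Qed.

Lemma risingSl a n : rising a n.+1 = a * rising (a + 1) n.
Proof.
rewrite /rising big_ord_recl addr0; congr (_ * _).
by apply: eq_bigr => l _; rewrite lift0 -addrA -(natrD _ 1).
Qed.

Lemma rising_gt0 a n : 0 < a -> 0 < rising a n.
Proof. by move=> a0; apply: prodr_gt0 => l _; rewrite ltr_pwDl. Qed.

Definition weight alpha (s : seq nat) : R :=
  \prod_(b <- s) rising (1 - alpha) b.-1.

Lemma weight_gt0 alpha s : alpha < 1 -> 0 < weight alpha s.
Proof.
move=> a1; rewrite /weight big_seq; apply: prodr_gt0 => b _.
by rewrite rising_gt0// subr_gt0.
Qed.

Lemma weight_rcons1 alpha s : weight alpha (rcons s 1%N) = weight alpha s.
Proof. by rewrite /weight big_rcons /= rising0 mulr1. Qed.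

Lemma weight_incr alpha s j : (j < size s)%N -> all (leq 1) s ->
  weight alpha (incr_nth s j) = weight alpha s * ((nth 0%N s j)%:R - alpha).
Proof.
rewrite /weight; elim: s j => // a s IH [|j] /= js /andP[a0 s0].
  rewrite !big_cons /=.
  have aE : rising (1 - alpha) a = rising (1 - alpha) a.-1 * (a%:R - alpha).
    rewrite -{1}(prednK a0) risingS; congr (_ * _).
    by rewrite -[in RHS](prednK a0) -natr1; ring.
  by rewrite aE mulrAC.
by rewrite !big_cons IH// mulrA.
Qed.

(** The coefficients V are left inside [F]: the functional depends on [alpha] only, and E[h(Pi_n)]
    is its value at h p * V n (size p). *)
Definition partition_sum alpha n F : R :=
  \sum_(p <- partitions n) F p * weight alpha (age_freq p).

(** Opening a class leaves the weight unchanged, and joining a class of size b multiplies it by b -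
    alpha. *)
Lemma partition_sumS alpha n F : (0 < n)%N ->
  partition_sum alpha n.+1 F = partition_sum alpha n (fun p =>
    F (add_class n p) + \sum_(j < size p)
      F (join_class n p j.+1) * ((nth 0%N (age_freq p) j)%:R - alpha)).
Proof.
case: n => // n _; rewrite /partition_sum.
rewrite [LHS](@big_flatten _ _ _ _ (map (children n.+1) (partitions n.+1))).
rewrite big_map big_seq [RHS]big_seq; apply: eq_bigr => p pn.
have hp := classes_below_partitions pn.
rewrite /children big_cons age_freq_add weight_rcons1 mulrDl; congr (_ + _).
rewrite big_map -{1}[size p]subn0 -[iota _ _]/(index_iota _ _) big_mkord.
rewrite mulr_suml; apply: eq_bigr => j _.
rewrite age_freq_join// weight_incr ?size_age_freq//; last exact: age_freq_gt0 pn.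
by rewrite [X in _ * X]mulrC mulrA.
Qed.

Lemma eq_partition_sum alpha n F F' :
  {in partitions n, F =1 F'} -> partition_sum alpha n F = partition_sum alpha n F'.
Proof.
move=> h; rewrite /partition_sum big_seq [RHS]big_seq.
by apply: eq_bigr => p /h ->.
Qed.

Lemma partition_sumD alpha n F F' :
  partition_sum alpha n (fun p => F p + F' p) =
  partition_sum alpha n F + partition_sum alpha n F'.
Proof. by rewrite -big_split; apply: eq_bigr => p _; rewrite mulrDl. Qed.

Lemma partition_sumZ alpha n c F :
  partition_sum alpha n (fun p => c * F p) = c * partition_sum alpha n F.
Proof. by rewrite /partition_sum mulr_sumr; apply: eq_bigr => p _; rewrite mulrA. Qed.

End weights.

Section gibbs_coefficients.
Context (R : realType) (alpha : R) (V : nat -> nat -> R).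
Hypotheses (alpha1 : alpha < 1) (hV : gibbs_coefficients alpha V).

Lemma gibbs_denom_gt0 n k : (1 <= k <= n)%N -> 0 < n%:R - alpha * k%:R.
Proof.
move=> /andP[k0 kn]; rewrite subr_gt0 (@lt_le_trans _ _ k%:R)// ?ler_nat//.
by rewrite gtr_pMl ?ltr0n.
Qed.

(** V n k is a sum of two nonnegative terms, and n - alpha k > 0. This settles the partitions of
    probability zero, on which the prediction rules say nothing. *)
Lemma gibbs_succ_eq0 n k : (1 <= k <= n)%N -> V n k = 0 ->
  V n.+1 k = 0 /\ V n.+1 k.+1 = 0.
Proof.
move=> kn; have d0 := gibbs_denom_gt0 kn; have /andP[k0 k_n] := kn.
have v1 : 0 <= V n.+1 k by apply: (gibbs_ge0 hV); rewrite k0 leqW.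
have v2 : 0 <= V n.+1 k.+1 by apply: (gibbs_ge0 hV).
rewrite (gibbs_rec hV)// => /eqP; rewrite paddr_eq0 ?mulr_ge0// 1?ltW//.
by rewrite mulf_eq0 (gt_eqF d0) /= => /andP[/eqP -> /eqP ->].
Qed.

End gibbs_coefficients.

Section gibbs_law.
Context (R : realType) (d : measure_display) (T : measurableType d)
  (P : probability T R) (alpha : R) (V : nat -> nat -> R)
  (Pi : nat -> T -> seq {fset nat}).
Hypotheses (alpha1 : alpha < 1) (hV : gibbs_coefficients alpha V)
  (hPi : exchangeable_gibbs_partition P alpha V Pi).

Let rp := egp_random_partition hPi.

Lemma mem_partitions n omega : (0 < n)%N -> Pi n omega \in partitions n.
Proof.
elim: n => // -[_ _|n IH _]; first by rewrite (egp_1 hPi) mem_head.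
apply/mem_partitionsS => //; exists (Pi n.+1 omega); first exact: IH.
rewrite -(rp_consistent rp n.+1); apply: partition_of_child => //.
exact: (rp_partition rp).
Qed.

Lemma prob_EFin (A : set T) : measurable A -> P A = (fine (P A))%:E.
Proof. by move=> mA; rewrite fineK// fin_num_measure. Qed.

Lemma prob_partition n p : p \in partitions n -> (0 < n)%N ->
  P [set omega | Pi n omega = p] = (V n (size p) * weight alpha (age_freq p))%:E.
Proof.
elim: n p => // -[_ p|n IH q].
  rewrite inE => /eqP -> _.
  rewrite [X in P X](_ : _ = setT); last first.
    by apply/seteqP; split => // w _; exact: (egp_1 hPi).
  by rewrite probability_setT /weight/= big_seq1 cardfs1 rising0 (gibbs_11 hV) mul1r.
move=> /mem_partitionsS[]// p pn qp _.
have {}IH := IH p pn isT; have hp := classes_below_partitions pn.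
have sub : [set omega | Pi n.+2 omega = q] `<=` [set omega | Pi n.+1 omega = p].
  by move=> w /= wq; rewrite -(rp_consistent rp) wq (restriction_child hp).
have mq m r : measurable [set omega | Pi m omega = r] by exact: (rp_measurable rp).
have kn : (1 <= size p <= n.+1)%N.
  by rewrite (size_partitions_gt0 _ pn)// (size_partitions pn).
have d0 := gibbs_denom_gt0 alpha1 kn.
have w0 := weight_gt0 (age_freq p) alpha1.
(* If the parent has probability zero, conditional probabilities are useless: the child is null as a
   smaller event, and the formula gives 0 as well. *)
have [V0|V0] := eqVneq (V n.+1 (size p)) 0.
  have [V1 V2] := gibbs_succ_eq0 alpha1 hV kn V0.
  have -> : P [set omega | Pi n.+2 omega = q] = 0%E.
    apply/eqP; rewrite eq_le measure_ge0 andbT.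
    have : (P [set omega | Pi n.+2 omega = q] <=
            P [set omega | Pi n.+1 omega = p])%E.
      by apply: le_measure => //; rewrite inE.
    by rewrite IH V0 mul0r.
  by case: (size_child qp) => ->; rewrite ?V1 ?V2 mul0r.
have Pp0 : P [set omega | Pi n.+1 omega = p] != 0%E.
  by rewrite IH eqe mulf_neq0// gt_eqF.
have condE : cond_prob P [set omega | Pi n.+2 omega = q]
    [set omega | Pi n.+1 omega = p] =
    fine (P [set omega | Pi n.+2 omega = q]) /
    (V n.+1 (size p) * weight alpha (age_freq p)).
  by rewrite /cond_prob (setIidl sub) IH.
have den0 : V n.+1 (size p) * weight alpha (age_freq p) != 0.
  by rewrite mulf_neq0// gt_eqF.
rewrite prob_EFin//; congr EFin.
case: (child_cases qp) => [qE|[j jp qE]].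
  move: condE; rewrite {1}qE (egp_new hPi)// => /esym/(canRL (divfK den0)) ->.
  by rewrite qE size_rcons age_freq_add weight_rcons1 mulrA divfK.
move: condE; rewrite {1}qE (egp_join hPi)// => /esym/(canRL (divfK den0)) ->.
have -> : size q = size p.
  by rewrite qE /join_class size_set_nth /= (maxn_idPr _).
rewrite qE age_freq_join// weight_incr ?size_age_freq//; last exact: age_freq_gt0 pn.
rewrite nth_age_freq /class_at /= -[in 1 - _](divff V0) -mulrBl.
(* By the recursion of V, the probability of not opening a class brings the factor n - alpha k that
   cancels the denominator of the joining rule. *)
have -> : V n.+1 (size p) - V n.+2 (size p).+1 =
    (n.+1%:R - alpha * (size p)%:R) * V n.+2 (size p).
  by rewrite {1}(gibbs_rec hV)// addrK.
move: {d0}(lt0r_neq0 d0); set D := n.+1%:R - _ => d0.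
by field; rewrite V0 d0.
Qed.

Lemma measurable_fun_Pi (h : seq {fset nat} -> R) n : (0 < n)%N ->
  measurable_fun setT (fun omega => h (Pi n omega)).
Proof.
move=> n0; rewrite [X in measurable_fun _ X](_ : _ = fun omega =>
    \sum_(p <- partitions n) h p * \1_[set omega | Pi n omega = p] omega).
  apply: measurable_sum => p; apply: measurable_funM => //.
  by apply: measurable_indic; exact: (rp_measurable rp).
apply/funext => w; rewrite (bigD1_seq (Pi n w)) ?mem_partitions ?uniq_partitions//=.
rewrite indicE mem_set// mulr1 big1 ?addr0// => p pw.
by rewrite indicE memNset ?mulr0//= => /esym/eqP; rewrite (negbTE pw).
Qed.

Lemma expectation_partition (h : seq {fset nat} -> R) n : (0 < n)%N ->
  (\int[P]_omega (h (Pi n omega))%:E =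
  (partition_sum alpha n (fun p => h p * V n (size p)))%:E)%E.
Proof.
move=> n0; rewrite [X in integral _ _ X](_ : _ = fun omega =>
   (\sum_(p <- partitions n) (h p)%:E * (\1_[set omega | Pi n omega = p] omega)%:E)%E).
  have int p : P.-integrable setT
    (fun x => (h p)%:E * (\1_[set omega | Pi n omega = p] x)%:E)%E.
    apply: integrableZl => //; apply: integrable_indic => //.
    exact: (rp_measurable rp).
  rewrite integral_sum//.
  rewrite /partition_sum -sumEFin big_seq [RHS]big_seq; apply: eq_bigr => p pn.
  rewrite integralZl//; last first.
    by apply: integrable_indic => //; exact: (rp_measurable rp).
  rewrite integral_indic//; last exact: (rp_measurable rp).
  rewrite setIT [X in (_ * X)%E](prob_partition pn n0).
  by rewrite -EFinM mulrA.
apply/funext => w; rewrite (bigD1_seq (Pi n w)) ?mem_partitions ?uniq_partitions//=.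
rewrite indicE mem_set// mule1 big1 ?adde0// => p pw.
by rewrite indicE memNset ?mule0//= => /esym/eqP; rewrite (negbTE pw).
Qed.

End gibbs_law.

(** * Number of partitions with given age-ordered frequencies *)

Section counting.
Local Open Scope nat_scope.
Implicit Types (m s : seq nat).

(* The possible age-ordered frequencies before the last element is added. *)
Fixpoint predecessors m : seq (seq nat) :=
  if m is b :: m' then
    (if 1 < b then [:: b.-1 :: m'] else if (b == 1) && nilp m' then [:: [::]] else [::]) ++
    [seq b :: s | s <- predecessors m']
  else [::].

Lemma count_mem_map_cons b a s (t : seq (seq nat)) :
  count_mem (a :: s) [seq b :: x | x <- t] = (a == b) * count_mem s t.
Proof.
rewrite count_map; have [->|ab] := eqVneq a b.
  by rewrite mul1n; apply: eq_count => x /=; rewrite eqseq_cons eqxx.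
rewrite mul0n; apply/eqP; rewrite -leqn0 leqNgt -has_count; apply/hasPn => x _.
by rewrite /= eqseq_cons eq_sym (negbTE ab).
Qed.

(** [predecessors] inverts the two insertion moves, a new last class of size 1 or one class
    enlarged. Counting with multiplicities lets the identity be summed over all partitions. *)
Lemma count_predecessors m s : all (leq 1) s ->
  (rcons s 1 == m) + \sum_(j < size s) (incr_nth s j == m) =
  count_mem s (predecessors m).
Proof.
elim: s m => [|a s IH] [|b m].
- by rewrite big_ord0.
- rewrite big_ord0 addn0 /= count_cat => _.
  have -> : count_mem [::] [seq b :: x | x <- predecessors m] = 0.
    by apply/eqP; rewrite -leqn0 leqNgt -has_count; apply/hasPn => _ /mapP[x _ ->].
  by rewrite addn0; case: m => [|c m]; case: b => [|[|b]].
- by move=> _; rewrite big1 => [|[[|j] ?]].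
rewrite [all _ _]/= => /andP[a0 s0]; rewrite big_ord_recl /= count_cat.
have -> : \sum_(i < size s) (a :: incr_nth s i == b :: m) =
    (a == b) * \sum_(i < size s) (incr_nth s i == m).
  by rewrite big_distrr /=; apply: eq_bigr => i _; rewrite eqseq_cons mulnb.
have -> : count_mem (a :: s) (if 1 < b then [:: b.-1 :: m]
    else if (b == 1) && nilp m then [:: [::]] else [::]) = (a.+1 :: s == b :: m).
  rewrite eqseq_cons; case: ltnP => b1.
    rewrite /= addn0 eqseq_cons eq_sym [m == s]eq_sym.
    by rewrite -(eqSS a) (prednK (ltnW b1)).
  have -> : (a.+1 == b) = false by apply/eqP => ab; rewrite -ab ltnNge a0 in b1.
  by case: ifP.
by rewrite count_mem_map_cons -IH// eqseq_cons -mulnb mulnDr addnCA.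
Qed.

Lemma sumn_predecessors m s : all (leq 1) m -> s \in predecessors m ->
  (sumn s).+1 = sumn m.
Proof.
elim: m s => //= b m IH s /andP[b0 m0]; rewrite mem_cat => /orP[|].
  case: ltnP => b1.
    by rewrite inE => /eqP ->; rewrite /= -addSn prednK.
  case: ifP => // /andP[/eqP -> /nilP ->]; by rewrite inE => /eqP ->.
by move=> /mapP[x /(IH _ m0) xm ->]; rewrite /= -addnS xm.
Qed.

Lemma positive_predecessors m s : all (leq 1) m -> s \in predecessors m ->
  all (leq 1) s.
Proof.
elim: m s => //= b m IH s /andP[b0 m0]; rewrite mem_cat => /orP[|].
  case: ltnP => b1; last by case: ifP => // _; rewrite inE => /eqP ->.
  by rewrite inE => /eqP ->; rewrite /= m0 -ltnS (prednK b0) b1.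
by move=> /mapP[x /(IH _ m0) xm ->]; rewrite /= b0.
Qed.

(** Classes are filled by age: the least remaining element opens the class, and its b - 1 companions
    are chosen among the b - 1 + sumn m' elements that remain. *)
Fixpoint count_formula m : nat :=
  if m is b :: m' then 'C(b.-1 + sumn m', b.-1) * count_formula m' else 1.

(** Pascal's rule for the first binomial: one term comes from lowering the first entry, the other
    from a predecessor of the tail, whose sum drops by one. A first entry 1 cannot be lowered unless
    it is alone. *)
Lemma count_formula_predecessors m : all (leq 1) m -> m != [::] ->
  count_formula m = \sum_(s <- predecessors m) count_formula s.
Proof.
elim: m => //= b m IH /andP[b0 m0] _; rewrite big_cat big_map /=.
have [->|mn0] := eqVneq m [::].
  rewrite big_nil /= !addn0 binn.
  case: b b0 => [//|[|b]] _ /=; first by rewrite big_seq1.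
  by rewrite big_seq1 /= addn0 binn.
have sm : 0 < sumn m.
  by case: m mn0 m0 {IH} => //= a l _ /andP[a0 _]; rewrite addn_gt0 a0.
have -> : \sum_(j <- predecessors m) 'C(b.-1 + sumn j, b.-1) * count_formula j =
    'C(b.-1 + (sumn m).-1, b.-1) * count_formula m.
  rewrite IH// big_distrr /= big_seq [RHS]big_seq; apply: eq_bigr => s sm'.
  by rewrite -(sumn_predecessors m0 sm').
rewrite -{1}(prednK sm) addnS; case: ltnP => b1.
  rewrite big_seq1 /= -mulnDl; congr (_ * _).
  case: b b1 {b0} => [|[|b]] //= _.
  by rewrite binS addnC; congr ('C(_, _) + _); rewrite addSnnS prednK.
have -> : b = 1 by apply/eqP; rewrite eqn_leq b1.
by rewrite !bin0 !mul1n; case: m mn0 {IH m0 sm} => // c m _; rewrite big_nil.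
Qed.

Lemma count_age_freq n m : 0 < n -> all (leq 1) m -> sumn m = n ->
  count (fun p => age_freq p == m) (partitions n) = count_formula m.
Proof.
elim: n m => // n IH m _ m0 mn.
have mn0 : m != [::] by apply: contra_eq_neq mn => ->.
case: n IH mn => [_|n IH] mn.
  case: m m0 mn {mn0} => // b m /= /andP[b0 m0] bm.
  have -> : m = [::].
    apply: size0nil; apply/eqP; rewrite -leqn0.
    rewrite (leq_trans (size_le_sumn m0))// -(leq_add2l b) bm addn0.
    exact: b0.
  have -> : b = 1 by move: bm; case: b b0 => [|[|b]].
  by rewrite cardfs1.
rewrite (count_formula_predecessors m0 mn0).
have -> : count (fun p => age_freq p == m) (partitions n.+2) =
    \sum_(p <- partitions n.+1) count_mem (age_freq p) (predecessors m).
  rewrite -sum1_count [LHS](@big_flatten _ _ _ _ (map (children n.+1) (partitions n.+1))).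
  rewrite big_map big_seq [RHS]big_seq; apply: eq_bigr => p pn.
  have hp := classes_below_partitions pn.
  rewrite -count_predecessors; last exact: age_freq_gt0 pn.
  rewrite sum1_count /= age_freq_add; congr (_ + _).
  rewrite -sum1_count big_map -{1}[size p]subn0 -[iota _ _]/(index_iota _ _).
  rewrite big_mkord big_mkcond size_age_freq; apply: eq_bigr => j _.
  by rewrite age_freq_join//; case: eqP.
rewrite big_seq [RHS]big_seq.
under eq_bigr do rewrite -sum1_count big_mkcond big_seq.
rewrite exchange_big; apply: eq_bigr => s sm /=.
rewrite -IH//; last 2 first.
- exact: positive_predecessors sm.
- by apply: succn_inj; rewrite (sumn_predecessors m0 sm).
rewrite -sum1_count [RHS]big_mkcond big_seq.
by apply: eq_bigr => p _; rewrite eq_sym.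
Qed.

End counting.

Section sampling.
Context (R : realType).
Implicit Types alpha : R.

(** The binomials telescope: with s the sum of the tail, C(b-1+s, b-1) = (b+s)! / ((b-1)! (b+s) s!),
    and b + s counts the elements outside the older classes. *)
Lemma count_formulaE (m : seq nat) : all (leq 1) m ->
  (count_formula m)%:R =
  (sumn m)`!%:R / (\prod_(j < size m)
    ((nth 0%N m j).-1`!%:R * (sumn m - sumn (take j m))%:R)) :> R.
Proof.
elim: m => [|b m IH] /=; first by rewrite big_ord0 divr1.
move=> /andP[b0 m0]; rewrite natrM IH// big_ord_recl /= subn0.
under [X in _ / (_ * X)]eq_bigr do rewrite /= subnDl.
set D := \prod_(j < _) _.
have D0 : D != 0.
  rewrite prodf_seq_neq0; apply/allP => j _ /=.
  rewrite mulf_neq0 ?pnatr_eq0 -?lt0n ?fact_gt0// subn_gt0.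
  have := congr1 sumn (cat_take_drop j m); rewrite sumn_cat => <-.
  rewrite -[X in (X < _)%N]addn0 ltn_add2l.
  rewrite (drop_nth 0%N)//= addn_gt0 orbC; apply/orP; right.
  exact: (allP m0) _ (mem_nth _ _).
rewrite -[in (b + _)`!](prednK b0) addSn factS.
have := bin_fact (leq_addr (sumn m) b.-1); rewrite addKn => <-.
rewrite -[in X in _ = _ / (_ * X * _)](prednK b0) addSn.
rewrite !natrM; field.
by rewrite D0 -natrD -(natrD _ 1) !pnatr_eq0 -!lt0n fact_gt0.
Qed.

Lemma partition_sum_age_freq alpha n m (F : seq nat -> R) :
  (0 < n)%N -> all (leq 1) m -> sumn m = n ->
  partition_sum alpha n (fun p => (age_freq p == m)%:R * F (age_freq p)) =
  (count_formula m)%:R * F m * weight alpha m.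
Proof.
move=> n0 m0 mn; rewrite -(count_age_freq n0 m0 mn) -sum1_count natr_sum.
rewrite !mulr_suml /partition_sum [RHS]big_mkcond; apply: eq_bigr => p _.
by case: eqP => [->|]; rewrite ?mul0r.
Qed.

(** The bound [N] is an encoding: frequencies are at most n < N, so exactly one tuple of ordinals
    matches each partition with [k] classes. *)
Lemma partition_sum_tuple alpha n k (N : nat) (F : seq nat -> R) :
  (0 < n)%N -> (n < N)%N ->
  partition_sum alpha n (fun p => (size p == k)%:R * F (age_freq p)) =
  \sum_(m : k.-tuple 'I_N | all (fun b : 'I_N => (0 < b)%N) m &&
                            (sumn [seq val b | b <- m] == n))
    (count_formula [seq val b | b <- m])%:R * F [seq val b | b <- m] *
    weight alpha [seq val b | b <- m].
Proof.
move=> n0 nN.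
transitivity (\sum_(m : k.-tuple 'I_N | all (fun b : 'I_N => (0 < b)%N) m &&
                            (sumn [seq val b | b <- m] == n))
  partition_sum alpha n (fun p => (age_freq p == [seq val b | b <- m])%:R * F (age_freq p))).
  rewrite /partition_sum exchange_big /= big_seq [RHS]big_seq.
  apply: eq_bigr => p pn; rewrite -!mulr_suml; congr (_ * _ * _).
  have [pk|pk] := eqVneq (size p) k; last first.
    rewrite big1// => m _; apply/eqP; rewrite pnatr_eq0 eqb0.
    apply: contraNneq pk => /(congr1 size).
    by rewrite size_age_freq size_map size_tuple => ->.
  have ltN : all (fun b => (b < N)%N) (age_freq p).
    apply/allP => b bp; rewrite (leq_ltn_trans _ nN)//.
    rewrite -(sumn_age_freq pn); elim: (age_freq p) bp => //= a s IH.
    rewrite inE => /orP[/eqP ->|/IH h]; first exact: leq_addr.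
    by rewrite (leq_trans h) ?leq_addl.
  pose s := pmap (insub : nat -> option 'I_N) (age_freq p).
  have sE : [seq val b | b <- s] = age_freq p.
    by rewrite pmap_filter ?(all_filterP _)//; [apply/allP => b /(allP ltN) h; rewrite /= insubT|exact: insubK].
  have sz : size s == k by rewrite -(size_map val) sE size_age_freq pk.
  rewrite (bigD1 (Tuple sz))/=; last first.
    rewrite sE (sumn_age_freq pn) eqxx andbT.
    have := age_freq_gt0 pn; rewrite -sE all_map.
    by apply: sub_all.
  rewrite sE eqxx big1 ?addr0// => m /andP[_ mn].
  apply/eqP; rewrite pnatr_eq0 eqb0 -sE; apply: contra mn => /eqP h.
  by apply/eqP/val_inj/(inj_map val_inj)/esym.
apply: eq_bigr => m /andP[m0 /eqP mn]; rewrite partition_sum_age_freq//.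
by rewrite all_map; apply: sub_all m0.
Qed.

End sampling.

(** * Prediction martingales *)

Section martingale.
Context (R : realType) (alpha : R) (V : nat -> nat -> R).
Hypotheses (alpha1 : alpha < 1) (hV : gibbs_coefficients alpha V).
Implicit Types (n k : nat) (r : nat -> nat) (p q : seq {fset nat}).

Definition class_size p (j : nat) : nat := nth 0%N (age_freq p) j.

(** Makes a function of Pi_n a function of Pi_(n+L): conditioning on Pi_n becomes a factor G
    (restrict_to n L q) in a sum over partitions of n + L. *)
Fixpoint restrict_to n (L : nat) q : seq {fset nat} :=
  if L is L'.+1 then restrict_to n L' (restriction (n + L') q) else q.

Definition bump_at r (j : nat) : nat -> nat := fun l => (r l + (l == j))%N.
Arguments bump_at : simpl never.

Lemma sum_bump_at k r j : (j < k)%N ->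
  (\sum_(l < k) bump_at r j l = (\sum_(l < k) r l).+1)%N.
Proof.
move=> jk; rewrite big_split /= -addn1; congr (_ + _)%N.
rewrite (bigD1 (Ordinal jk))//= eqxx big1// => l.
by rewrite -val_eqE /= => /negbTE ->.
Qed.

(* V n (size p) times the conditional probability that, after a partition p of
   [n], the next elements fill the k first classes in a given order, r l of
   them in the class l. *)
Definition prediction k r n p : R :=
  (\prod_(l < k) rising ((class_size p l)%:R - alpha) (r l)) *
  V (n + \sum_(l < k) r l)%N (size p).

Lemma prediction0 k n p : prediction k (fun=> 0%N) n p = V n (size p).
Proof.
rewrite /prediction big1_eq addn0 big1 ?mul1r// => l _; exact: rising0.
Qed.

Lemma restrict_toD n L M q :
  restrict_to n (L + M) q = restrict_to n L (restrict_to (n + L) M q).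
Proof.
by elim: M q => [|M IH] q; rewrite ?addn0// addnS /= IH addnA.
Qed.

Lemma restrict_to_partitions n L q : (0 < n)%N -> q \in partitions (n + L) ->
  restrict_to n L q \in partitions n /\ (size (restrict_to n L q) <= size q)%N.
Proof.
move=> n0; elim: L q => [|L IH] q; first by rewrite addn0.
rewrite addnS => /mem_partitionsS[]; first by rewrite addn_gt0 n0.
move=> p pn qp /=; have hp := classes_below_partitions pn.
rewrite (restriction_child hp qp); have [h1 h2] := IH _ pn; split => //.
by rewrite (leq_trans h2)//; case: (size_child qp) => ->.
Qed.

Lemma class_size_add n p j : (j < size p)%N ->
  class_size (add_class n p) j = class_size p j.
Proof. by rewrite /class_size age_freq_add nth_rcons size_age_freq => ->. Qed.

Lemma class_size_join n p j l : classes_below n p -> (j < size p)%N ->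
  class_size (join_class n p j.+1) l = (class_size p l + (l == j))%N.
Proof.
by move=> hp jp; rewrite /class_size age_freq_join// nth_incr_nth addnC eq_sym.
Qed.

(** The identity (x+1)_r x = x_r (x+r): joining class j shifts the base of its rising factorial and
    supplies the weight x. A class of index at least [k] has no factor in the product. *)
Lemma prod_rising_bump k r (x : nat -> R) j :
  (\prod_(l < k) rising (x l + (l == j :> nat)%:R) (r l)) * x j =
  (\prod_(l < k) rising (x l) (r l)) * (x j + (if (j < k)%N then r j else 0%N)%:R).
Proof.
case: ltnP => jk; last first.
  rewrite addr0; congr (_ * _); apply: eq_bigr => l _.
  by rewrite ltn_eqF ?addr0// (leq_trans (ltn_ord l)).
rewrite (bigD1 (Ordinal jk))//= [in RHS](bigD1 (Ordinal jk))//= eqxx.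
rewrite mulrAC [_ * x j]mulrC -risingSl risingS mulrAC; congr (_ * _ * _).
apply: eq_bigr => l; rewrite -val_eqE /= => /negbTE ->; by rewrite addr0.
Qed.

(** One insertion, for a test function [U] of the past and of the size of class j. The weights of
    all joins add up to n + |r| - alpha K, so with the birth term they rebuild V by its recursion;
    the only surplus comes from joining class j, whose weight is the next rising factor. *)
Lemma prediction_step n k r j (U : seq {fset nat} -> nat -> R) :
  (0 < n)%N -> (j < k)%N ->
  (forall p x, p \in partitions n -> (size p < k)%N -> U p x = 0) ->
  partition_sum alpha n.+1 (fun q =>
    U (restriction n q) (class_size q j) * prediction k r n.+1 q) =
  partition_sum alpha n (fun p => U p (class_size p j) * prediction k r n p) +
  partition_sum alpha n (fun p =>
    (U p (class_size p j).+1 - U p (class_size p j)) *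
    prediction k (bump_at r j) n p).
Proof.
move=> n0 jk U0; rewrite partition_sumS// -partition_sumD.
apply: eq_partition_sum => p pn.
have hp := classes_below_partitions pn.
have rAdd : restriction n (add_class n p) = p.
  by apply: (restriction_child hp); rewrite mem_head.
have rJoin l : (l < size p)%N -> restriction n (join_class n p l.+1) = p.
  move=> lp; apply: (restriction_child hp); rewrite inE; apply/orP; right.
  by apply/mapP; exists l => //; rewrite mem_iota.
rewrite rAdd; have [pk|kp] := ltnP (size p) k.
  rewrite !(U0 p)// !subrr !mul0r !addr0 add0r big1// => l _.
  by rewrite rJoin// U0// !mul0r.
have jp : (j < size p)%N by exact: leq_trans jk kp.
set N := class_size p; set K := size p in kp jp *.
set s := (\sum_(l < k) r l)%N.
set x := fun l => (N l)%:R - alpha.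
set A := \prod_(l < k) rising (x l) (r l).
have xj : (\prod_(l < k) rising (x l) (bump_at r j l)) = A * (x j + (r j)%:R).
  rewrite /A (bigD1 (Ordinal jk))//= [in RHS](bigD1 (Ordinal jk))//=.
  rewrite /bump_at eqxx addn1 risingS mulrAC; congr (_ * _ * _).
  by apply: eq_bigr => l; rewrite -val_eqE /= => /negbTE ->; rewrite addn0.
have pA : prediction k r n.+1 (add_class n p) = A * V (n + s).+1 K.+1.
  rewrite /prediction addSn size_rcons; congr (_ * _).
  apply: eq_bigr => l _; rewrite class_size_add//.
  exact: leq_trans (ltn_ord l) kp.
have pJ l : (l < K)%N ->
    prediction k r n.+1 (join_class n p l.+1) * ((N l)%:R - alpha) =
    A * (x l + (if (l < k)%N then r l else 0%N)%:R) * V (n + s).+1 K.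
  move=> lK; rewrite /prediction addSn.
  rewrite (_ : size _ = K); last first.
    by rewrite /join_class size_set_nth /= (maxn_idPr _).
  rewrite mulrAC -prod_rising_bump; congr (_ * _ * _).
  by apply: eq_bigr => i _; rewrite class_size_join// /x natrD addrAC.
rewrite class_size_add// pA.
under eq_bigr => l _ do rewrite rJoin// class_size_join// -mulrA pJ//.
have kn : (1 <= K <= n + s)%N.
  rewrite (size_partitions_gt0 _ pn)//= (leq_trans (size_partitions pn))//.
  exact: leq_addr.
rewrite /prediction sum_bump_at// -/s -/A xj addnS -/K.
rewrite (gibbs_rec hV kn).
(* Only the summand l = j changes the argument of [U]. Isolating this change leaves the constant
   [U p (N j)] in front of the total weight. *)
transitivity (U p (N j) * (A * V (n + s).+1 K.+1) +
    (\sum_(l < K) U p (N j) * (A * (x l + (if (l < k)%N then r l else 0%N)%:R) *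
       V (n + s).+1 K) +
    (U p (N j).+1 - U p (N j)) * (A * (x j + (r j)%:R) * V (n + s).+1 K))).
  congr (_ + _); rewrite (bigD1 (Ordinal jp))//= [in RHS](bigD1 (Ordinal jp))//=.
  rewrite eqxx addn1 jk [RHS]addrAC -[in RHS]mulrDl [_ + (_ - _)]addrC subrK.
  congr (_ + _).
  apply: eq_bigr => l; rewrite -val_eqE /= eq_sym => /negbTE ->.
  by rewrite addn0.
rewrite -mulr_sumr -mulr_suml -mulr_sumr big_split /= sumrB sumr_const card_ord.
have -> : \sum_(l < K) (N l)%:R = n%:R :> R.
  rewrite -natr_sum; congr (_%:R); rewrite -[RHS](sumn_age_freq pn) sumnE.
  by rewrite (big_nth 0%N) size_age_freq big_mkord.
have -> : \sum_(l < K) (if (l < k)%N then r l else 0%N)%:R = s%:R :> R.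
  rewrite -natr_sum /s (big_ord_widen _ _ kp) [in RHS]big_mkcond.
  by [].
by rewrite natrD -mulr_natr; ring.
Qed.

Section moments.
Variables (n k : nat) (G : seq {fset nat} -> R).
Hypotheses (n0 : (0 < n)%N)
  (G0 : forall p, p \in partitions n -> (size p < k)%N -> G p = 0).

Let GL0 L p : p \in partitions (n + L) -> (size p < k)%N ->
  G (restrict_to n L p) = 0.
Proof.
move=> /restrict_to_partitions[]// h1 h2 pk; apply: G0 => //.
exact: leq_ltn_trans pk.
Qed.

Let nL0 L : (0 < n + L)%N. Proof. by rewrite addn_gt0 n0. Qed.

Definition increment L q j : R :=
  (class_size q j)%:R - (class_size (restrict_to n L q) j)%:R.

(** The martingale property: a test function that ignores the class size has no surplus in
    [prediction_step]. The class 0 chosen there is arbitrary. *)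
Lemma prediction_const L r : (0 < k)%N ->
  partition_sum alpha (n + L) (fun q =>
    G (restrict_to n L q) * prediction k r (n + L) q) =
  partition_sum alpha n (fun p => G p * prediction k r n p).
Proof.
move=> k0; elim: L => [|L IH]; first by rewrite addn0.
rewrite addnS (prediction_step _ (U := fun p _ => G (restrict_to n L p)) (j := 0))//;
  last by move=> p _; exact: GL0.
rewrite IH -[RHS]addr0; congr (_ + _).
by rewrite /partition_sum big1// => p _; rewrite subrr !mul0r.
Qed.

(** Each insertion adds the mass of [bump_at r j], which does not depend on time by the martingale
    property. The offset [c] is the initial class size when increments are wanted, and 0 when sizes
    are. *)
Lemma prediction_linear L r j (c : seq {fset nat} -> R) : (j < k)%N ->
  partition_sum alpha (n + L) (fun q => G (restrict_to n L q) *
    ((class_size q j)%:R - c (restrict_to n L q)) * prediction k r (n + L) q) =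
  partition_sum alpha n (fun p => G p * ((class_size p j)%:R - c p) *
    prediction k r n p) +
  L%:R * partition_sum alpha n (fun p => G p * prediction k (bump_at r j) n p).
Proof.
move=> jk; have k0 : (0 < k)%N by exact: leq_ltn_trans jk.
elim: L => [|L IH]; first by rewrite addn0 mul0r addr0.
rewrite addnS (prediction_step _ (j := j)
  (U := fun p x => G (restrict_to n L p) * (x%:R - c (restrict_to n L p))))//;
  last by move=> p x pn pk; rewrite GL0 ?mul0r.
rewrite IH -natr1 mulrDl mul1r addrA; congr (_ + _).
rewrite -(prediction_const L)//; apply: eq_partition_sum => p _.
by congr (_ * _); rewrite -mulrBr -natr1; ring.
Qed.

Lemma prediction_increment L r j : (j < k)%N ->
  partition_sum alpha (n + L) (fun q => G (restrict_to n L q) *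
    increment L q j * prediction k r (n + L) q) =
  L%:R * partition_sum alpha n (fun p => G p * prediction k (bump_at r j) n p).
Proof.
move=> jk.
rewrite (prediction_linear L r (fun p => (class_size p j)%:R))// -[RHS]add0r.
congr (_ + _); rewrite /partition_sum big1// => p _.
by rewrite subrr mulr0 !mul0r.
Qed.

(** From (x+1)^2 - x^2 = 2x + 1, the step at time l adds 2 l a2 + a1, where a1 and a2 are the masses
    of one and of two prescribed joins; summation gives L(L-1) a2 + L a1. *)
Lemma prediction_increment2 L j : (j < k)%N ->
  partition_sum alpha (n + L) (fun q => G (restrict_to n L q) *
    increment L q j ^+ 2 * prediction k (fun=> 0%N) (n + L) q) =
  L%:R * (L%:R - 1) * partition_sum alpha n (fun p => G p *
    prediction k (bump_at (bump_at (fun=> 0%N) j) j) n p) +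
  L%:R * partition_sum alpha n (fun p => G p *
    prediction k (bump_at (fun=> 0%N) j) n p).
Proof.
move=> jk; have k0 : (0 < k)%N by exact: leq_ltn_trans jk.
elim: L => [|L IH].
  rewrite addn0 !mul0r addr0 /partition_sum big1// => p _.
  by rewrite /increment subrr expr0n /= mulr0 !mul0r.
rewrite addnS (prediction_step _ (j := j)
  (U := fun p x => G (restrict_to n L p) *
     (x%:R - (class_size (restrict_to n L p) j)%:R) ^+ 2))//;
  last by move=> p x pn pk; rewrite GL0 ?mul0r.
rewrite IH.
set a2 := partition_sum _ n _; set a1 := partition_sum _ n _.
rewrite (_ : partition_sum _ _ _ = 2 * (L%:R * a2) + a1).
  by rewrite -natr1; ring.
rewrite /a1 /a2 -(prediction_increment L)// -(prediction_const L)//.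
rewrite -partition_sumZ -partition_sumD; apply: eq_partition_sum => p _.
by rewrite /increment -natr1; ring.
Qed.

End moments.

Section increments.
Variables (n k : nat) (G : seq {fset nat} -> R) (j : nat).
Hypotheses (n0 : (0 < n)%N) (jk : (j < k)%N)
  (G0 : forall p, p \in partitions n -> (size p < k)%N -> G p = 0).

Let a1 := partition_sum alpha n (fun p => G p *
    prediction k (bump_at (fun=> 0%N) j) n p).
Let a2 := partition_sum alpha n (fun p => G p *
    prediction k (bump_at (bump_at (fun=> 0%N) j) j) n p).

(** After n, the indicators of joining class j behave as exchangeable variables with single mass a1
    and pair mass a2; this is the mean square distance between their averages over L and over L + M
    terms. *)
Lemma prediction_increment_diff L M : (0 < L)%N ->
  partition_sum alpha (n + (L + M)) (fun q => G (restrict_to n (L + M) q) *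
    (increment n (L + M) q j / (L + M)%:R -
     increment n L (restrict_to (n + L) M q) j / L%:R) ^+ 2 *
     V (n + (L + M)) (size q)) =
  (a1 - a2) * (L%:R^-1 - (L + M)%:R^-1).
Proof.
move=> L0; have k0 : (0 < k)%N by exact: leq_ltn_trans jk.
have nL0 : (0 < n + L)%N by rewrite addn_gt0 n0.
have GL0 p : p \in partitions (n + L) -> (size p < k)%N ->
    G (restrict_to n L p) = 0.
  move=> /restrict_to_partitions[]// h1 h2 pk; apply: G0 => //.
  exact: leq_ltn_trans pk.
pose D p := increment n L p j.
have sq : partition_sum alpha (n + L + M) (fun q =>
    G (restrict_to n L (restrict_to (n + L) M q)) *
    D (restrict_to (n + L) M q) ^+ 2 * prediction k (fun=> 0%N) (n + L + M) q) =
    L%:R * (L%:R - 1) * a2 + L%:R * a1.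
  rewrite -prediction_increment2//.
  apply: (prediction_const (n := n + L) (k := k)
    (G := fun p => G (restrict_to n L p) * D p ^+ 2)) => // p pn pk.
  by rewrite GL0// mul0r.
have cross : partition_sum alpha (n + L + M) (fun q =>
    G (restrict_to n L (restrict_to (n + L) M q)) * D (restrict_to (n + L) M q) *
    increment (n + L) M q j * prediction k (fun=> 0%N) (n + L + M) q) =
    M%:R * (L%:R * a2).
  rewrite (prediction_increment (n := n + L) (k := k)
    (G := fun p => G (restrict_to n L p) * D p))//; last first.
    by move=> p pn pk; rewrite GL0// mul0r.
  by congr (_ * _); rewrite (prediction_increment (n := n)).
have tot := prediction_increment2 n0 G0 (L + M) jk.
rewrite -/a1 -/a2 in tot.
have LM0 : (L + M)%:R != 0 :> R by rewrite pnatr_eq0 -lt0n addn_gt0 L0.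
have {}L0 : L%:R != 0 :> R by rewrite pnatr_eq0 -lt0n.
(* With T = D + I the total increment, the square is expanded in T^2, D^2 and D I, since T D = D^2 +
   D I; these are the three sums computed above. *)
transitivity ((L + M)%:R ^- 2 * ((L + M)%:R * ((L + M)%:R - 1) * a2 + (L + M)%:R * a1)
  + (L%:R ^- 2 - 2 * (L%:R^-1 * (L + M)%:R^-1)) * (L%:R * (L%:R - 1) * a2 + L%:R * a1)
  - 2 * (L%:R^-1 * (L + M)%:R^-1) * (M%:R * (L%:R * a2))).
  rewrite -tot -sq -cross -[X in _ = _ + X]mulNr -!addnA -!partition_sumZ.
  rewrite -!partition_sumD; apply: eq_partition_sum => q _.
  rewrite prediction0 -!restrict_toD.
  have -> : increment n (L + M) q j =
      D (restrict_to (n + L) M q) + increment (n + L) M q j.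
    by rewrite /D /increment restrict_toD; ring.
  by rewrite -!exprVn -/(D _); ring.
by move: LM0; rewrite natrD => LM0; field; rewrite L0 LM0.
Qed.

End increments.

End martingale.

(** * Limit frequencies and their joint moments *)

Section square_summable.
Context (R : realType).

(** Equal to 1/(l+1) - 1/(l+2), so the series telescopes; its square is 1/sample l. *)
Definition rate (l : nat) : R := (l.+1 * l.+2)%:R^-1.

Lemma rate_gt0 l : 0 < rate l. Proof. by rewrite invr_gt0 ltr0n. Qed.

Lemma sum_rate n : \sum_(0 <= l < n) rate l = 1 - n.+1%:R^-1.
Proof.
elim: n => [|n IH]; first by rewrite big_nil invr1 subrr.
rewrite big_nat_recr//= IH /rate natrM; field.
by rewrite -!(natrD _ 1) -!(natrD _ 2) !pnatr_eq0.
Qed.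

Lemma cvg_rate : cvgn (series rate).
Proof.
apply: nondecreasing_is_cvgn.
  by apply: nondecreasing_series => l _ _; exact/ltW/rate_gt0.
exists 1 => _ [n _ <-]; rewrite /series/= sum_rate.
by rewrite lerBlDr lerDl invr_ge0.
Qed.

(** Pointwise |f| <= rate + f^2 / rate, according to which of |f| and rate is larger. The integrals
    of f^2 / rate are at most C rate, hence summable, so the series of f^2 / rate is finite almost
    everywhere. *)
Lemma ae_cvg_series (d : measure_display) (T : measurableType d)
    (mu : {measure set T -> \bar R}) (f : nat -> T -> R) (C : R) :
  (forall l, measurable_fun setT (f l)) ->
  (forall l, (\int[mu]_x (f l x ^+ 2)%:E <= (C * rate l ^+ 2)%:E)%E) ->
  {ae mu, forall x, cvgn (series (fun l => f l x))}.
Proof.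
move=> mf hf.
pose g l x := (rate l)^-1 * f l x ^+ 2.
have g0 l x : 0 <= g l x by rewrite mulr_ge0 ?sqr_ge0// invr_ge0 ltW// rate_gt0.
have mf2 l : measurable_fun setT (fun x => f l x ^+ 2).
  by apply: measurable_funX; exact: mf.
have mg l : measurable_fun setT (EFin \o g l).
  by apply/measurable_EFinP; apply: measurable_funM.
have C0 : 0 <= C.
  have : (0 <= (C * rate 0 ^+ 2)%:E)%E.
    apply: le_trans (hf 0%N); apply: integral_ge0 => x _.
    by rewrite lee_fin sqr_ge0.
  by rewrite lee_fin pmulr_lge0// exprn_gt0// rate_gt0.
have intg l : (\int[mu]_x (g l x)%:E <= (C * rate l)%:E)%E.
  under eq_integral do rewrite EFinM.
  rewrite ge0_integralZl//; last 3 first.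
  - exact/measurable_EFinP.
  - by move=> x _; rewrite lee_fin sqr_ge0.
  - by rewrite lee_fin invr_ge0 ltW// rate_gt0.
  rewrite (le_trans (lee_wpmul2l _ (hf l)))//.
    by rewrite lee_fin invr_ge0 ltW// rate_gt0.
  rewrite -EFinM lee_fin expr2 mulrCA mulKf//.
  by rewrite gt_eqF// rate_gt0.
have : mu.-integrable setT (fun x => (\sum_(0 <= l <oo) (g l x)%:E)%E).
  apply/integrableP; split.
    have g0' l x : setT x -> true -> (0 <= (g l x)%:E)%E by rewrite lee_fin.
    exact: (ge0_emeasurable_sum (P := xpredT) g0' (fun l _ => mg l)).
  under eq_integral.
    move=> x _; rewrite gee0_abs; last first.
      by apply: nneseries_ge0 => l _ _; rewrite lee_fin.
    over.
  rewrite integral_nneseries//; last by move=> l x _; rewrite lee_fin.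
  apply: (@le_lt_trans _ _ C%:E); last exact: ltry.
  apply: lime_le.
    by apply: is_cvg_nneseries => l _ _; apply: integral_ge0 => x _; rewrite lee_fin.
  apply: nearW => n.
  apply: (@le_trans _ _ (\sum_(0 <= l < n) (C * rate l)%:E)%E).
    by apply: lee_sum => l _; exact: intg.
  rewrite sumEFin lee_fin -mulr_sumr ler_piMr// sum_rate.
  by rewrite lerBlDr lerDl invr_ge0.
move=> /integrable_ae; move/(_ measurableT); apply: filterS => x /(_ I) fin.
have hs : cvgn (series (g ^~ x)).
  apply: nondecreasing_is_cvgn; first exact: nondecreasing_series.
  exists (fine (\sum_(0 <= l <oo) (g l x)%:E)%E) => _ [n _ <-].
  rewrite -lee_fin fineK// /series/= -sumEFin.
  by apply: nneseries_lim_ge => l _ _; rewrite lee_fin.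
apply: normed_cvg.
apply: (@series_le_cvg _ (fun l => `|f l x|) (rate \+ g ^~ x)) => //.
- by move=> l; rewrite /= addr_ge0// ltW// rate_gt0.
- move=> l /=; have r0 := rate_gt0 l.
  have [h|h] := leP `|f l x| (rate l); first by rewrite (le_trans h)// lerDl.
  apply: (@le_trans _ _ (g l x)); last by rewrite lerDr ltW.
  rewrite /g ler_pdivlMl//.
  by rewrite -[leRHS]real_normK ?num_real// expr2 ler_wpM2r// ltW.
- exact: (is_cvg_seriesD cvg_rate hs).
Qed.

End square_summable.

Section interpolation.
Context (R : realType).

Lemma cvg_natS (c : nat) : (fun l : nat => (l + c)%:R^-1 : R) @ \oo --> (0 : R).
Proof.
rewrite (cvg_shiftn c (fun l : nat => l%:R^-1 : R)).
by rewrite -(cvg_shiftS (fun l : nat => l%:R^-1 : R)); exact: cvg_harmonic.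
Qed.

(** Two opposite demands: sparse enough for 1/sample l to be the square of a summable sequence,
    dense enough for the ratio of consecutive terms to tend to 1. *)
Definition sample (l : nat) : nat := ((l.+1 * l.+2) ^ 2)%N.

Lemma sample_gt0 l : (0 < sample l)%N.
Proof. by rewrite expn_gt0. Qed.

Lemma cvg_sample_ratio :
  (fun l => (sample l)%:R / (sample l.+1)%:R : R) @ \oo --> (1 : R).
Proof.
rewrite (_ : (fun _ => _) = fun l => (1 - 2 * (l + 3)%:R^-1) ^+ 2).
  have h : (fun l => 1 - 2 * (l + 3)%:R^-1 : R) @ \oo --> (1 : R).
    rewrite -[X in _ --> X]subr0 -(mulr0 2).
    by apply: cvgB; [exact: cvg_cst|apply: cvgM; [exact: cvg_cst|exact: cvg_natS]].
  rewrite -[X in _ --> X](mulr1 1).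
  by under eq_fun do rewrite expr2; apply: cvgM; exact: h.
apply/funext => l; rewrite /sample !natrX !natrM natrD; field.
by rewrite -(natrD _ l 3) -(natrD _ 2 l) !pnatr_eq0 addn_eq0 andbF.
Qed.

(** For sample l <= n < sample (l+1), monotonicity puts D n / n between D (sample l) / sample (l+1)
    and D (sample (l+1)) / sample l, which have the same limit. *)
Lemma cvg_interpolation (D : nat -> R) (x : R) :
  (forall n, 0 <= D n) -> {homo D : m n / (m <= n)%N >-> m <= n} ->
  (fun l => D (sample l) / (sample l)%:R) @ \oo --> x ->
  (fun n => D n / n%:R) @ \oo --> x.
Proof.
move=> D0 Dmono hD.
have hlow : (fun l => D (sample l) / (sample l.+1)%:R) @ \oo --> x.
  rewrite -[x]mulr1 (_ : (fun _ => _) = fun l =>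
    D (sample l) / (sample l)%:R * ((sample l)%:R / (sample l.+1)%:R)).
    exact: cvgM hD cvg_sample_ratio.
  by apply/funext => l; rewrite mulrA divfK// pnatr_eq0 -lt0n sample_gt0.
have hup : (fun l => D (sample l.+1) / (sample l)%:R) @ \oo --> x.
  have -> : x = x * 1^-1 by rewrite invr1 mulr1.
  rewrite (_ : (fun _ => _) = fun l =>
    D (sample l.+1) / (sample l.+1)%:R * ((sample l)%:R / (sample l.+1)%:R)^-1).
    apply: cvgM; first by move: hD; rewrite -(cvg_shiftS (fun l => D (sample l) / _)).
    by apply: cvgV; [exact: oner_neq0|exact: cvg_sample_ratio].
  by apply/funext => l; rewrite invf_div mulrA divfK// pnatr_eq0 -lt0n sample_gt0.
apply/cvgrPdist_lt => e e0.
have /cvgrPdist_lt/(_ e e0)[N1 _ hN1] := hlow.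
have /cvgrPdist_lt/(_ e e0)[N2 _ hN2] := hup.
exists (sample (maxn N1 N2)) => // n /= hn.
have sample_ge l : (l <= sample l)%N.
  by rewrite /sample -mulnn; nia.
have [l [lN /andP[l1 l2]]] : exists l, (maxn N1 N2 <= l)%N /\
    (sample l <= n < sample l.+1)%N.
  have ex : exists l, (n < sample l.+1)%N by exists n; exact: sample_ge.
  have := ex_minnP ex; case=> l hl hmin; exists l.
  have hs : {homo sample : a b / (a <= b)%N}.
    by move=> a b ab; rewrite leq_exp2r// leq_mul.
  have lN : (maxn N1 N2 <= l)%N.
    rewrite leqNgt; apply/negP => lt; move: hl; rewrite ltnNge.
    by rewrite (leq_trans _ hn)// hs.
  split => //; rewrite hl andbT leqNgt; apply/negP => nl.
  case: l hl hmin lN nl => [|l] hl hmin lN nl.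
    move: nl; rewrite ltnNge; move: lN; rewrite leqn0 => /eqP lN.
    by rewrite lN in hn; rewrite hn.
  by have := hmin l nl; rewrite ltnn.
have s0 m : 0 < (sample m)%:R :> R by rewrite ltr0n sample_gt0.
have n0 : 0 < n%:R :> R by rewrite ltr0n (leq_trans (sample_gt0 l)).
have low : D (sample l) / (sample l.+1)%:R <= D n / n%:R.
  apply: ler_pM => //; [exact: Dmono|].
  by rewrite lef_pV2 ?posrE// ler_nat ltnW.
have up : D n / n%:R <= D (sample l.+1) / (sample l)%:R.
  apply: ler_pM => //; [exact/Dmono/ltnW|].
  by rewrite lef_pV2 ?posrE// ler_nat.
have := hN1 l (leq_trans (leq_maxl _ _) lN).
have := hN2 l (leq_trans (leq_maxr _ _) lN).
rewrite /= !ltr_norml => /andP[h1 h2] /andP[h3 h4].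
by apply/andP; split; lra.
Qed.

End interpolation.

Section measurable_limit.
Context (R : realType) (d : measure_display) (T : measurableType d).

Lemma cvg_seq_cauchyP (u : nat -> R) : cvgn u <->
  forall e, exists N, forall m, `|u (N + m)%N - u N| < e.+1%:R^-1.
Proof.
split=> [/cvgrPdist_lt h e|h].
  have e0 : 0 < (e.+1%:R^-1 : R) / 2 by rewrite divr_gt0.
  have [N _ hN] := h _ e0; exists N => m.
  have h1 := hN N (leqnn N); have h2 := hN (N + m)%N (leq_addr m N).
  rewrite (_ : _ - _ = limn u - u N - (limn u - u (N + m)%N)); last by ring.
  by rewrite (le_lt_trans (ler_normB _ _))// (splitr (e.+1%:R^-1)) ltrD.
apply/cauchy_cvgP/cauchy_exP => e e0.
have [k hk] : exists k : nat, k.+1%:R^-1 < e.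
  exists (Num.truncn e^-1); rewrite -[ltRHS]invrK ltf_pV2 ?posrE ?invr_gt0//.
  by rewrite truncnS_gt.
have [N hN] := h k; exists (u N); exists N => // m /= Nm.
rewrite -ball_normE /= distrC (lt_trans _ hk)//.
by rewrite -(subnKC Nm) hN.
Qed.

(** Off the measurable set of convergence, [limn] is the constant [point]. Measurability thus holds
    on the whole space and not up to a null set, as [conditional_law] demands. *)
Lemma measurable_fun_limn (u : nat -> T -> R) :
  (forall m, measurable_fun setT (u m)) ->
  measurable_fun setT (fun x => limn (fun m => u m x)).
Proof.
move=> mu; pose C := [set x | cvgn (fun m => u m x)].
have CE : C = \bigcap_e \bigcup_N \bigcap_m
    [set x | `|u (N + m)%N x - u N x| < e.+1%:R^-1].
  apply/seteqP; split => x /=.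
    move=> /cvg_seq_cauchyP h e _; have [N hN] := h e.
    by exists N => // m _; exact: hN.
  move=> h; apply/cvg_seq_cauchyP => e; have [N _ hN] := h e I.
  by exists N => m; exact: hN.
have mC : measurable C.
  rewrite CE; apply: bigcapT_measurable => e; apply: bigcupT_measurable => N.
  apply: bigcapT_measurable => m.
  rewrite -[X in measurable X]setTI; apply: measurable_fun_ltr => //.
  by apply: measurableT_comp => //; apply: measurable_funB.
rewrite -(setUv C); apply/measurable_funU => //; first exact: measurableC.
split.
  apply: (measurable_fun_cvg (h := u)) => [m|x /=]; last by [].
  exact: measurable_funS (mu m).
apply: (eq_measurable_fun (fun=> point)); last exact: measurable_cst.
move=> x; rewrite inE /= => nC; apply/esym/dvgP => c; apply: nC; exact: c.
Qed.

End measurable_limit.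

Section limit_frequencies.
Context (R : realType) (d : measure_display) (T : measurableType d)
  (P : probability T R) (alpha : R) (V : nat -> nat -> R)
  (Pi : nat -> T -> seq {fset nat}).
Hypotheses (alpha1 : alpha < 1) (hV : gibbs_coefficients alpha V)
  (hPi : exchangeable_gibbs_partition P alpha V Pi).

Let rp := egp_random_partition hPi.

Lemma restrict_to_Pi n L omega : restrict_to n L (Pi (n + L)%N omega) = Pi n omega.
Proof.
elim: L => [|L IH]; first by rewrite addn0.
by rewrite addnS /= (rp_consistent rp).
Qed.

Lemma class_size_child n p q j : classes_below n p -> q \in children n p ->
  (class_size p j <= class_size q j)%N.
Proof.
move=> hp /child_cases[->|[l lp ->]]; last by rewrite class_size_join// leq_addr.
have [jp|jp] := ltnP j (size p); first by rewrite class_size_add.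
by rewrite /class_size nth_default// size_age_freq.
Qed.

Lemma class_size_mono n m j omega : (0 < n)%N -> (n <= m)%N ->
  (class_size (Pi n omega) j <= class_size (Pi m omega) j)%N.
Proof.
move=> n0 nm; rewrite -(subnKC nm); elim: (m - n)%N => [|L IH]; first by rewrite addn0.
rewrite (leq_trans IH)// addnS.
have nL0 : (0 < n + L)%N by rewrite addn_gt0 n0.
have pn := mem_partitions hPi omega nL0.
apply: (class_size_child (n := n + L)); first exact: classes_below_partitions.
rewrite -(rp_consistent rp (n + L)%N); apply: partition_of_child => //.
exact: (rp_partition rp).
Qed.

Lemma class_size_le n omega j : (0 < n)%N -> (class_size (Pi n omega) j <= n)%N.
Proof.
move=> n0; rewrite -{2}(sumn_age_freq (mem_partitions hPi omega n0)) /class_size.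
elim: (age_freq _) j => [|a s IH] [|j] //=; first exact: leq_addr.
by rewrite (leq_trans (IH j))// leq_addl.
Qed.

Lemma limit_freqE j omega : limit_freq R Pi j.+1 omega =
  limn (fun n => (class_size (Pi n omega) j)%:R / n%:R : R).
Proof.
by congr (limn _); apply/funext => n; rewrite /class_size nth_age_freq.
Qed.

Lemma measurable_class_freq j n :
  measurable_fun setT (fun omega => (class_size (Pi n omega) j)%:R / n%:R : R).
Proof.
case: n => [|n]; last first.
  exact: (measurable_fun_Pi hPi (fun p => (class_size p j)%:R / n.+1%:R)).
rewrite (_ : (fun _ => _) = cst 0)//.
by apply/funext => w; rewrite invr0 mulr0.
Qed.

Lemma measurable_limit_freq j : measurable_fun setT (limit_freq R Pi j.+1).
Proof.
rewrite (_ : limit_freq _ _ _ = fun omega => limn (fun n =>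
  (class_size (Pi n omega) j)%:R / n%:R : R)).
  by apply: measurable_fun_limn => n; exact: measurable_class_freq.
by apply/funext => w; rewrite limit_freqE.
Qed.

Lemma class_freq_01 j n omega :
  0 <= ((class_size (Pi n omega) j)%:R / n%:R : R) <= 1.
Proof.
rewrite divr_ge0//=; case: n => [|n]; first by rewrite invr0 mulr0.
by rewrite ler_pdivrMr ?mul1r ?ltr0n// ler_nat class_size_le.
Qed.

(** Where the frequency diverges, [limn] returns 0, so the bounds hold for every [omega]. *)
Lemma limit_freq_01 j omega : 0 <= limit_freq R Pi j.+1 omega <= 1.
Proof.
rewrite limit_freqE; set u := (fun n => _).
have [cu|cu] := pselect (cvgn u).
  apply/andP; split.
    by apply: limr_ge => //; apply: nearW => n; case/andP: (class_freq_01 j n omega).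
  by apply: limr_le => //; apply: nearW => n; case/andP: (class_freq_01 j n omega).
by rewrite dvgP// lexx ler01.
Qed.

Section convergence.
Variables (n k j : nat) (g : pred (seq {fset nat})).
Hypotheses (n0 : (0 < n)%N) (jk : (j < k)%N)
  (gk : forall p, p \in partitions n -> g p -> (k <= size p)%N).

Lemma ae_cvg_class_freq : {ae P, forall omega, g (Pi n omega) ->
  cvgn (fun m => (class_size (Pi m omega) j)%:R / m%:R : R)}.
Proof.
pose G p : R := (g p)%:R.
pose D L omega : R := (class_size (Pi (n + L)%N omega) j)%:R -
                  (class_size (Pi n omega) j)%:R.
pose f l omega := G (Pi n omega) *
  (D (sample l.+1) omega / (sample l.+1)%:R - D (sample l) omega / (sample l)%:R).
have G0 p : p \in partitions n -> (size p < k)%N -> G p = 0.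
  move=> pn pk; rewrite /G; case: (boolP (g p)) => // /(gk pn).
  by rewrite leqNgt pk.
have sampleS l : (sample l <= sample l.+1)%N.
  by rewrite /sample leq_exp2r// leq_mul.
pose h l q := G (restrict_to n (sample l.+1) q) *
  (increment R n (sample l.+1) q j / (sample l.+1)%:R -
   increment R n (sample l) (restrict_to (n + sample l) (sample l.+1 - sample l) q) j
     / (sample l)%:R).
have fE l omega : f l omega = h l (Pi (n + sample l.+1)%N omega).
  have rE : restrict_to (n + sample l) (sample l.+1 - sample l)
      (Pi (n + sample l.+1)%N omega) = Pi (n + sample l)%N omega.
    rewrite -{2}(subnKC (sampleS l)) addnA.
    exact: restrict_to_Pi.
  by rewrite /f /h /D /increment rE !restrict_to_Pi.
have nL0 l : (0 < n + l)%N by rewrite addn_gt0 n0.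
have mf l : measurable_fun setT (f l).
  rewrite (_ : f l = fun omega => h l (Pi (n + sample l.+1)%N omega)).
    exact: (measurable_fun_Pi hPi (h l)).
  exact/funext/fE.
pose c := `|partition_sum alpha n (fun p => G p *
    prediction alpha V k (bump_at (fun=> 0%N) j) n p) -
  partition_sum alpha n (fun p => G p *
    prediction alpha V k (bump_at (bump_at (fun=> 0%N) j) j) n p)|.
have := @ae_cvg_series R _ _ P f c mf; case.
  move=> l.
  rewrite [X in (integral _ _ X <= _)%E](_ : _ =
      fun x => (h l (Pi (n + sample l.+1)%N x) ^+ 2)%:E); last first.
    by apply/funext => x; rewrite fE.
  rewrite (expectation_partition alpha1 hV hPi (fun q => h l q ^+ 2))// lee_fin.
  have := prediction_increment_diff hV n0 jk G0
    (sample l.+1 - sample l) (sample_gt0 l).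
  rewrite subnKC// => hE.
  rewrite (_ : partition_sum _ _ _ = partition_sum alpha (n + sample l.+1) (fun q =>
      G (restrict_to n (sample l.+1) q) *
      (increment R n (sample l.+1) q j / (sample l.+1)%:R -
       increment R n (sample l) (restrict_to (n + sample l)
         (sample l.+1 - sample l) q) j / (sample l)%:R) ^+ 2 *
      V (n + sample l.+1)%N (size q))); last first.
    (* [G] is an indicator, hence equal to its square. *)
    apply: eq_partition_sum => q _; rewrite /h exprMn; congr (_ * _ * _).
    by rewrite /G; case: (g _); rewrite ?expr1n ?expr0n.
  rewrite hE (le_trans (ler_norm _))// normrM ler_wpM2l//.
  rewrite ger0_norm; last first.
    by rewrite subr_ge0 lef_pV2 ?posrE ?ltr0n ?sample_gt0// ler_nat.
  by rewrite lerBlDr /rate exprVn -natrX lerDl invr_ge0.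
move=> N [mN N0 hN]; exists N; split => // omega /= ho; apply: hN => /= hs.
apply: ho => go; have {hs} : cvgn (series (f ^~ omega)) by exact: hs.
(* On the event [g] the series telescopes, so its convergence is that of the averages along
   [sample]. *)
have -> : series (f ^~ omega) = fun l => D (sample l) omega / (sample l)%:R -
    D (sample 0) omega / (sample 0)%:R.
  rewrite -[RHS](telescopeK (fun l => D (sample l) omega / (sample l)%:R)).
  by congr series; apply/funext => l; rewrite /f /G go mul1r.
move=> cD; have {}cD : cvgn (fun l => D (sample l) omega / (sample l)%:R).
  rewrite (_ : (fun _ => _) = (fun l => D (sample l) omega / (sample l)%:R -
    D (sample 0) omega / (sample 0)%:R) \+ cst (D (sample 0) omega / (sample 0)%:R)).
    by apply: is_cvgD => //; exact: is_cvg_cst.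
  by apply/funext => l /=; rewrite subrK.
have : (fun m => D m omega / m%:R) @ \oo --> limn (fun l => D (sample l) omega / (sample l)%:R).
  apply: cvg_interpolation => //.
  - by move=> m; rewrite subr_ge0 ler_nat class_size_mono// leq_addr.
  - by move=> a b ab; rewrite lerB// ler_nat class_size_mono// leq_add2l.
set x := limn _ => hx.
(* The average D_m / m forgets the n first elements. With c the class size at n, the frequency at n
   + m is (1 - n/(n+m)) D_m / m + c/(n+m); a further shift to m + 1 avoids division by zero. *)
apply/cvg_ex; exists x; rewrite -(cvg_shiftn n) /=.
have -> : x = (1 - n%:R * 0) * x + (class_size (Pi n omega) j)%:R * 0.
  by rewrite !mulr0 subr0 mul1r addr0.
rewrite (cvg_shiftn n (fun m => (class_size (Pi m omega) j)%:R / m%:R : R)).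
rewrite -(cvg_shiftn n).
rewrite -(cvg_shiftS _).
rewrite (_ : (fun _ => _) = fun m => (1 - n%:R * (m.+1 + n)%:R^-1) * (D m.+1 omega / m.+1%:R) +
   (class_size (Pi n omega) j)%:R * (m.+1 + n)%:R^-1).
  have cS : (fun m : nat => (m.+1 + n)%:R^-1 : R) @ \oo --> (0 : R).
    rewrite (cvg_shiftS (fun m => (m + n)%:R^-1 : R)); exact: cvg_natS.
  apply: cvgD; last by apply: cvgM => //; exact: cvg_cst.
  apply: cvgM; last by rewrite (cvg_shiftS (fun m => D m omega / m%:R)).
  by apply: cvgB; [exact: cvg_cst|apply: cvgM => //; exact: cvg_cst].
apply/funext => m /=; rewrite /D [(n + m.+1)%N]addnC.
rewrite natrD; field.
by rewrite -!(natrD _ 1) -natrD !pnatr_eq0.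
Qed.

End convergence.

End limit_frequencies.

(** * Joint moments of the limit frequencies and of their sum *)

Section frequency_moments.
Context (R : realType) (d : measure_display) (T : measurableType d)
  (P : probability T R) (alpha : R) (V : nat -> nat -> R)
  (Pi : nat -> T -> seq {fset nat}).
Hypotheses (alpha1 : alpha < 1) (hV : gibbs_coefficients alpha V)
  (hPi : exchangeable_gibbs_partition P alpha V Pi).
Variable k : nat.

Local Notation Y j := (limit_freq R Pi (nat_of_ord j).+1).

Lemma measurable_freq_monomial (r : nat -> nat) :
  measurable_fun setT (fun omega => \prod_(j < k) Y j omega ^+ r j).
Proof.
by apply: measurable_prod => j _; apply: measurable_funX; exact: (measurable_limit_freq hPi).
Qed.

Lemma freq_monomial_01 (r : nat -> nat) omega :
  0 <= \prod_(j < k) Y j omega ^+ r j <= 1.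
Proof.
rewrite prodr_ge0 /=; last first.
  by move=> j _; rewrite exprn_ge0//; case/andP: (limit_freq_01 hPi j omega).
apply: prodr_ile1 => j _; have /andP[h0 h1] := limit_freq_01 hPi j omega.
by rewrite exprn_ge0// exprn_ile1.
Qed.

(** Induction on |r|: one factor X_j is replaced by the class frequency at n + L, the remaining
    moment is known at time n + L, [prediction_linear] brings it back to n, and L tends to infinity
    under dominated convergence. *)
Lemma expectation_freq_monomial (r : nat -> nat) n (G : seq {fset nat} -> R) :
  (0 < n)%N ->
  (forall p, p \in partitions n -> (size p < k)%N -> G p = 0) ->
  (\int[P]_omega (G (Pi n omega) * \prod_(j < k) Y j omega ^+ r j)%:E =
  (partition_sum alpha n (fun p => G p * prediction alpha V k r n p))%:E)%E.
Proof.
move sE : (\sum_(j < k) r j)%N => s.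
elim: s r sE n G => [|s IH] r sE n G n0 G0.
  have r0 (j : 'I_k) : r j = 0%N.
    by apply/eqP; move/eqP: sE; rewrite sum_nat_eq0 => /forallP/(_ j).
  transitivity (\int[P]_omega (G (Pi n omega))%:E)%E.
    by apply: eq_integral => w _; rewrite big1 ?mulr1// => j _; rewrite r0 expr0.
  rewrite (expectation_partition alpha1 hV hPi)//; congr EFin.
  apply: eq_partition_sum => p _; congr (_ * _).
  rewrite -(prediction0 alpha V k) /prediction.
  by congr (_ * V (_ + _)%N _); apply: eq_bigr => j _; rewrite r0.
have [j rj] : exists j : 'I_k, (0 < r j)%N.
  apply/existsP; apply: contraT; rewrite negb_exists => /forallP h.
  have : (\sum_(j < k) r j = 0)%N.
    by apply: big1 => j _; apply/eqP; rewrite -leqn0 leqNgt h.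
  by rewrite sE.
pose r' l := (r l - (l == j))%N.
have rE : r = bump_at r' j.
  apply/funext => l; rewrite /bump_at /r' subnK//.
  by case: eqP => // ->.
have r'E : (\sum_(l < k) r' l)%N = s.
  by apply: succn_inj; rewrite -(sum_bump_at r' (ltn_ord j)) -rE.
pose F L omega := (G (Pi n omega) * ((class_size (Pi (n + L)%N omega) j)%:R / (n + L)%:R) *
   \prod_(l < k) Y l omega ^+ r' l)%:E.
pose M := \sum_(p <- partitions n) `|G p|.
have GM omega : `|G (Pi n omega)| <= M.
  rewrite /M (bigD1_seq (Pi n omega)) ?(mem_partitions hPi) ?uniq_partitions//=.
  by rewrite lerDl sumr_ge0.
have mG : measurable_fun setT (fun omega => G (Pi n omega)).
  exact: (measurable_fun_Pi hPi G).
have mF L : measurable_fun setT (F L).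
  apply/measurable_EFinP; apply: measurable_funM; last exact: measurable_freq_monomial.
  by apply: measurable_funM => //; exact: (measurable_class_freq hPi).
have mf : measurable_fun setT (fun omega => (G (Pi n omega) *
    \prod_(l < k) Y l omega ^+ r l)%:E).
  apply/measurable_EFinP; apply: measurable_funM => //.
  exact: measurable_freq_monomial.
have monoE : forall omega, \prod_(l < k) Y l omega ^+ r l =
    Y j omega * \prod_(l < k) Y l omega ^+ r' l.
  move=> omega; rewrite (bigD1 j)//= [in RHS](bigD1 j)//= rE /bump_at eqxx addn1 exprS mulrA.
  congr (_ * _); apply: eq_bigr => l; rewrite -val_eqE /= => /negbTE ->.
  by rewrite addn0.
have gk p : p \in partitions n -> G p != 0 -> (k <= size p)%N.
  by move=> pn; apply: contraR; rewrite -ltnNge => /(G0 p pn) ->.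
have cvF : {ae P, forall omega, setT omega -> F ^~ omega @ \oo -->
    (G (Pi n omega) * \prod_(l < k) Y l omega ^+ r l)%:E}.
  have := ae_cvg_class_freq alpha1 hV hPi n0 (ltn_ord j) gk.
  apply: filterS => omega h _; rewrite /F monoE mulrA.
  apply: cvg_EFin; first by apply: nearW.
  rewrite (_ : fine \o _ = fun L => G (Pi n omega) *
    ((class_size (Pi (n + L)%N omega) j)%:R / (n + L)%:R) *
    \prod_(l < k) Y l omega ^+ r' l); last by apply/funext.
  have [Gp0|Gp] := eqVneq (G (Pi n omega)) 0.
    rewrite Gp0 !mul0r (_ : (fun _ => _) = cst 0); first exact: cvg_cst.
    by apply/funext => L; rewrite !mul0r.
  apply: cvgM; last exact: cvg_cst.
  apply: cvgM; first exact: cvg_cst.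
  rewrite limit_freqE.
  have : (fun m => (class_size (Pi m omega) j)%:R / m%:R : R) @ \oo -->
    limn (fun m => (class_size (Pi m omega) j)%:R / m%:R : R) by exact: h Gp.
  rewrite -(cvg_shiftn n).
  by under [X in _ -> X @ _ --> _]eq_fun do rewrite addnC.
have bF : {ae P, forall omega L, setT omega -> (`|F L omega| <= (cst M omega)%:E)%E}.
  apply: aeW => omega L _; rewrite /F abse_EFin lee_fin normrM normrM.
  have /andP[a0 a1] := freq_monomial_01 r' omega.
  have /andP[b0 b1] := class_freq_01 hPi j (n + L) omega.
  rewrite (ger0_norm a0) (ger0_norm b0) /cst.
  rewrite -[leRHS]mulr1 ler_pM ?mulr_ge0//.
  by rewrite -[leRHS]mulr1 ler_pM.
have [_ _ cvI] := dominated_convergence measurableT mF mf cvF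
  (finite_measure_integrable_cst P M measurableT) bF.
have intF L : (\int[P]_omega F L omega = ((n + L)%:R^-1 *
    (partition_sum alpha n (fun p => G p * ((class_size p j)%:R - 0) *
       prediction alpha V k r' n p) +
    L%:R * partition_sum alpha n (fun p => G p * prediction alpha V k r n p)))%:E)%E.
  have nL0 : (0 < n + L)%N by rewrite addn_gt0 n0.
  transitivity (\int[P]_omega ((fun q => G (restrict_to n L q) *
    ((class_size q j)%:R / (n + L)%:R)) (Pi (n + L)%N omega) *
     \prod_(l < k) Y l omega ^+ r' l)%:E)%E.
    by apply: eq_integral => omega _; rewrite /F /= (restrict_to_Pi hPi).
  rewrite (IH r' r'E _ (fun q => G (restrict_to n L q) *
    ((class_size q j)%:R / (n + L)%:R)))//; last first.
    move=> p pn pk; have [h1 h2] := restrict_to_partitions n0 pn.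
    by rewrite G0 ?mul0r//; exact: leq_ltn_trans pk.
  congr EFin.
  rewrite [in RHS]rE -(prediction_linear hV n0 G0 L r' (fun=> 0) (ltn_ord j)).
  rewrite -partition_sumZ; apply: eq_partition_sum => q _.
  by rewrite subr0; ring.
apply: (cvg_unique (@ereal_hausdorff R) cvI).
(* The approximating expectations are (A + L B)/(n + L), whose limit B is the claimed value. *)
set A := partition_sum _ n _ in intF; set B := partition_sum _ n _ in intF *.
rewrite (_ : [sequence _]_L = EFin \o (fun L => (n + L)%:R^-1 * (A + L%:R * B))); last first.
  by apply/funext => L /=; exact: intF.
apply: cvg_EFin; first exact: nearW.
rewrite (_ : fine \o _ = fun L => (L + n)%:R^-1 * A +
    (1 - n%:R * (L + n)%:R^-1) * B).
  suff : (fun L => (L + n)%:R^-1 * A + (1 - n%:R * (L + n)%:R^-1) * B : R) @ \oo -->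
      (0 * A + (1 - n%:R * 0) * B : R).
    by rewrite mul0r mulr0 subr0 mul1r add0r.
  apply: cvgD; first by apply: cvgM; [exact: cvg_natS|exact: cvg_cst].
  apply: cvgM; last exact: cvg_cst.
  apply: cvgB; first exact: cvg_cst.
  by apply: cvgM; [exact: cvg_cst|exact: cvg_natS].
apply/funext => L /=; rewrite addnC.
have : (L + n)%:R != 0 :> R by rewrite pnatr_eq0 addn_eq0 negb_and -!lt0n n0 orbT.
rewrite mulrDr mulrA natrD => Ln0; congr (_ + _ * _).
by field.
Qed.

Lemma sum_rising (a : 'I_k -> R) (r : nat -> nat) :
  \sum_(j < k) \prod_(l < k) rising (a l) (bump_at r j l) =
  (\prod_(l < k) rising (a l) (r l)) * \sum_(j < k) (a j + (r j)%:R).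
Proof.
rewrite mulr_sumr; apply: eq_bigr => j _.
rewrite (bigD1 j)//= [in RHS](bigD1 j)//= /bump_at eqxx addn1 risingS mulrAC.
congr (_ * _ * _); apply: eq_bigr => l; rewrite -val_eqE /= => /negbTE ->.
by rewrite addn0.
Qed.

(** Expanding one factor W as the sum of the X_j bumps each exponent in turn, and the new rising
    factors add up to n - alpha k + |r|. Here [G] imposes exactly [k] classes, so that their sizes
    add up to n. *)
Lemma expectation_freq_sum_power (r : nat -> nat) s n (G : seq {fset nat} -> R) :
  (0 < n)%N ->
  (forall p, p \in partitions n -> size p != k -> G p = 0) ->
  (\int[P]_omega (G (Pi n omega) * (\prod_(j < k) Y j omega ^+ r j) *
     limit_freq_sum R Pi k omega ^+ s)%:E =
  (partition_sum alpha n (fun p => G p *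
    ((\prod_(l < k) rising ((class_size p l)%:R - alpha) (r l)) *
     rising (n%:R - alpha * k%:R + (\sum_(l < k) r l)%:R) s *
     V (n + \sum_(l < k) r l + s)%N k)))%:E)%E.
Proof.
move=> n0 G0; have G0' p : p \in partitions n -> (size p < k)%N -> G p = 0.
  by move=> pn pk; rewrite G0// ltn_eqF.
elim: s r => [|s IH] r.
  under eq_integral do rewrite expr0 mulr1.
  rewrite expectation_freq_monomial//; congr EFin; apply: eq_partition_sum => p pn.
  rewrite rising0 mulr1 addn0 /prediction.
  by have [->//|pk] := eqVneq (size p) k; rewrite G0// !mul0r.
have mG : measurable_fun setT (fun omega => G (Pi n omega)).
  exact: (measurable_fun_Pi hPi G).
have sumE omega : limit_freq_sum R Pi k omega = \sum_(j < k) Y j omega.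
  by rewrite /limit_freq_sum big_add1 /= big_mkord.
have mS : measurable_fun setT (limit_freq_sum R Pi k).
  apply: (eq_measurable_fun (fun omega => \sum_(j < k) Y j omega)) => //.
  by apply: measurable_sum => j; exact: (measurable_limit_freq hPi).
have S_le omega : `|limit_freq_sum R Pi k omega| <= k%:R.
  rewrite sumE (le_trans (ler_norm_sum _ _ _))//.
  rewrite (_ : k%:R = \sum_(j < k) 1); last by rewrite sumr_const card_ord.
  apply: ler_sum => j _.
  by have /andP[h0 h1] := limit_freq_01 hPi j omega; rewrite ger0_norm.
pose M := \sum_(p <- partitions n) `|G p|.
have GM omega : `|G (Pi n omega)| <= M.
  rewrite /M (bigD1_seq (Pi n omega)) ?(mem_partitions hPi) ?uniq_partitions//=.
  by rewrite lerDl sumr_ge0.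
have int (r' : nat -> nat) s' : P.-integrable setT (fun omega => (G (Pi n omega) *
    (\prod_(j < k) Y j omega ^+ r' j) * limit_freq_sum R Pi k omega ^+ s')%:E).
  apply: (measurable_bounded_integrable (f := fun omega => G (Pi n omega) *
    (\prod_(j < k) Y j omega ^+ r' j) * limit_freq_sum R Pi k omega ^+ s')) => //.
  - by apply: (@le_lt_trans _ _ 1%E); [exact: probability_le1|exact: ltry].
  - exact: (measurable_funM (measurable_funM mG (measurable_freq_monomial r'))
      (measurable_funX s' mS)).
  - exists (M * k%:R ^+ s'); split; first exact: num_real.
    move=> x Mx omega _ /=; rewrite (le_trans _ (ltW Mx))// !normrM normrX.
    have /andP[a0 a1] := freq_monomial_01 r' omega.
    rewrite ler_pM ?mulr_ge0 ?exprn_ge0 ?lerXn2r ?nnegrE//.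
    by rewrite (ger0_norm a0) -[leRHS]mulr1 ler_pM.
transitivity (\sum_(j < k) \int[P]_omega (G (Pi n omega) *
    (\prod_(l < k) Y l omega ^+ bump_at r j l) * limit_freq_sum R Pi k omega ^+ s)%:E)%E.
  rewrite -integral_sum//; apply: eq_integral => omega _.
  rewrite sumEFin; congr EFin.
  rewrite exprS {1}sumE mulrA mulr_sumr mulr_suml; apply: eq_bigr => j _.
  congr (_ * _); rewrite -mulrA; congr (_ * _).
  rewrite (bigD1 j)//= [in RHS](bigD1 j)//= /bump_at eqxx addn1 exprSr mulrAC.
  congr (_ * _); apply: eq_bigr => l; rewrite -val_eqE /= => /negbTE ->.
  by rewrite addn0.
under eq_bigr do rewrite IH.
rewrite sumEFin; congr EFin; rewrite /partition_sum exchange_big /= big_seq [RHS]big_seq.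
apply: eq_bigr => p pn; rewrite -mulr_suml; congr (_ * _); rewrite -mulr_sumr.
have [pk|pk] := eqVneq (size p) k; last by rewrite G0// !mul0r.
congr (_ * _).
set t := (\sum_(l < k) r l)%N.
rewrite (eq_bigr (fun j : 'I_k =>
  (\prod_(l < k) rising ((class_size p l)%:R - alpha) (bump_at r j l)) *
  rising (n%:R - alpha * k%:R + t.+1%:R) s * V (n + t.+1 + s)%N k)); last first.
  by move=> j _; rewrite (sum_bump_at r (ltn_ord j)).
rewrite -!mulr_suml sum_rising big_split /= -natr_sum -/t.
have -> : \sum_(j < k) ((class_size p j)%:R - alpha) = n%:R - alpha * k%:R.
  rewrite sumrB sumr_const card_ord mulr_natr; congr (_ - _).
  rewrite -natr_sum; congr (_%:R); rewrite -(sumn_age_freq pn) sumnE.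
  by rewrite (big_nth 0%N) size_age_freq pk big_mkord.
by rewrite risingSl addnS addSnnS -natr1 !addrA !mulrA.
Qed.

End frequency_moments.

(** * Gamma, beta and Dirichlet integrals *)

Section gamma_beta.
Context (R : realType).
Local Notation mu := (@lebesgue_measure R).
Implicit Types (a b c s x : R).

(** Lebesgue measure is c times its image under the affine map, as one checks on half-open
    intervals. *)
Lemma integral_affine (f : R -> \bar R) c b : 0 < c ->
  measurable_fun setT f -> (forall x, (0 <= f x)%E) ->
  (\int[mu]_x f (c * x + b)%R = (c^-1)%:E * \int[mu]_x f x)%E.
Proof.
move=> c0 mf f0.
pose phi x : measurableTypeR R := c * x + b.
have mphi : measurable_fun (setT : set (measurableTypeR R)) phi.
  by apply: measurable_funD => //; exact: measurable_funM.
pose k : {nonneg R} := NngNum (ltW c0).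
have muE A : measurable A -> mu A = mscale k (pushforward mu phi) A.
  move=> mA; apply: lebesgue_measure_unique => // _ [[p q]] _ <-.
  change (mu `]p, q]%classic = c%:E * mu (phi @^-1` `]p, q]%classic))%E.
  have -> : phi @^-1` `]p, q]%classic = `](p - b) / c, (q - b) / c]%classic.
    apply/seteqP; split => x /=; rewrite !in_itv/= /phi ltr_pdivrMr// ler_pdivlMr//.
      by rewrite ltrBlDr lerBrDr [x * c]mulrC.
    by rewrite ltrBlDr lerBrDr [x * c]mulrC.
  rewrite !lebesgue_measure_itv /= !lte_fin ltr_pM2r ?invr_gt0// ltrD2r.
  case: ifP => _; last by rewrite mule0.
  rewrite -!EFinB -EFinM; congr EFin; rewrite -mulrBl [c * _]mulrC divfK ?gt_eqF//.
  by rewrite opprB addrA subrK.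
rewrite [in RHS](eq_measure_integral (mscale k (pushforward mu phi))) => [|A mA _]; last first.
  exact: muE.
rewrite ge0_integral_mscale// ge0_integral_pushforward// preimage_setT.
by rewrite muleA -EFinM mulVf ?gt_eqF// mul1e.
Qed.

Let powRD_gt0 x r s : 0 < x -> x `^ (r + s) = x `^ r * x `^ s.
Proof. by move=> x0; rewrite powRD// (gt_eqF x0) implybT. Qed.

(** With its support built in, beta and Dirichlet integrals run over the whole line, without domains
    to track. *)
Definition ppow a x : R := if 0 < x then x `^ (a - 1) else 0.

Lemma ppow_ge0 a x : 0 <= ppow a x.
Proof. by rewrite /ppow; case: ifP => // _; exact: powR_ge0. Qed.

Lemma measurable_ppow a : measurable_fun setT (ppow a).
Proof.
apply: measurable_fun_ifT => //.
by apply: measurable_fun_ltr => //.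
Qed.

Lemma ppowM a s x : 0 < s -> ppow a (s * x) = s `^ (a - 1) * ppow a x.
Proof.
move=> s0; rewrite /ppow pmulr_rgt0//; case: ifP => x0; last by rewrite mulr0.
by rewrite powRM// ltW.
Qed.

Lemma ppow1 x : ppow 1 x = if 0 < x then 1 else 0.
Proof. by rewrite /ppow subrr powRr0. Qed.

Lemma ppowMX a x n : ppow a x * x ^+ n = ppow (a + n%:R) x.
Proof.
rewrite /ppow; case: ifP => x0; last by rewrite mul0r.
by rewrite -powR_mulrn ?ltW// -powRD_gt0// addrAC.
Qed.

(** Extended-valued, so that Tonelli's theorem can be applied before finiteness is known; [GammaE]
    returns to [Gamma]. *)
Definition gammaI a : \bar R := (\int[mu]_x (ppow a x * expR (- x))%:E)%E.

Definition betaI a b : \bar R := (\int[mu]_x (ppow a x * ppow b (1 - x))%:E)%E.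

Lemma measurable_ppowB a s : measurable_fun setT (fun x => ppow a (s - x)).
Proof.
apply: (measurableT_comp (measurable_ppow a)).
exact: measurable_funB.
Qed.

Let measurable_gammaI a : measurable_fun setT (fun x => (ppow a x * expR (- x))%:E).
Proof.
apply/measurable_EFinP; apply: measurable_funM; first exact: measurable_ppow.
apply: (measurableT_comp (@measurable_expR R)).
exact: measurable_funN.
Qed.

Let measurable_betaI a b s :
  measurable_fun setT (fun x => (ppow a x * ppow b (s - x))%:E).
Proof.
apply/measurable_EFinP; apply: measurable_funM; first exact: measurable_ppow.
exact: measurable_ppowB.
Qed.

(** The substitution x = s y for s > 0; both sides vanish otherwise. *)
Lemma ppow_convolution a b s :
  (\int[mu]_x (ppow a x * ppow b (s - x))%:E = (ppow (a + b) s)%:E * betaI a b)%E.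
Proof.
have [s0|s0] := ltP 0 s; last first.
  rewrite [in RHS]/ppow ltNge s0 /= mul0e integral0_eq// => x _.
  rewrite /ppow; case: ltP => x0; last by rewrite mul0r.
  rewrite ltNge (_ : s - x <= 0) ?mulr0// subr_le0.
  exact: le_trans s0 (ltW x0).
have F0 r x : (0 <= (ppow a x * ppow b (r - x))%:E)%E.
  by rewrite lee_fin mulr_ge0// ppow_ge0.
have h := integral_affine 0 s0 (measurable_betaI a b s) (F0 s).
have -> : (\int[mu]_x (ppow a x * ppow b (s - x))%:E)%E =
   (s%:E * \int[mu]_x (ppow a (s * x + 0) * ppow b (s - (s * x + 0)))%:E)%E.
  by rewrite h muleA -EFinM mulfV ?gt_eqF// mul1e.
transitivity (s%:E * \int[mu]_x ((s `^ (a - 1) * s `^ (b - 1))%:E *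
    (ppow a x * ppow b (1 - x))%:E))%E.
  congr (_ * _)%E; apply: eq_integral => x _.
  rewrite addr0 -{2}[s]mulr1 -mulrBr !ppowM// -EFinM; congr EFin; ring.
rewrite ge0_integralZl_EFin; [|exact: measurableT|by move=> x _|
  exact: measurable_betaI|by rewrite mulr_ge0// powR_ge0].
rewrite muleA -EFinM; congr (_%:E * _)%E.
rewrite /ppow s0 -{1}(powRr1 (ltW s0)) -!powRD_gt0//.
by congr (_ `^ _); ring.
Qed.

Lemma gammaI_ge0 a : (0 <= gammaI a)%E.
Proof.
by apply: integral_ge0 => x _; rewrite lee_fin mulr_ge0 ?ppow_ge0// expR_ge0.
Qed.

Lemma betaI_ge0 a b : (0 <= betaI a b)%E.
Proof. by apply: integral_ge0 => x _; rewrite lee_fin mulr_ge0 ?ppow_ge0. Qed.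

(** Substitute z = x + y in the double integral and exchange the order: the inner integral over x is
    the convolution above. *)
Lemma gammaI_beta a b : (gammaI a * gammaI b = gammaI (a + b) * betaI a b)%E.
Proof.
pose F (p : R * R) : \bar R :=
  (ppow a p.1 * ppow b (p.2 - p.1) * expR (- p.2))%:E.
have mF : measurable_fun setT F.
  apply/measurable_EFinP; apply: measurable_funM; first apply: measurable_funM.
  - by apply: (measurableT_comp (measurable_ppow a)).
  - apply: (measurableT_comp (measurable_ppow b)).
    exact: measurable_funB.
  - apply: (measurableT_comp (@measurable_expR R)).
    exact: measurable_funN.
have F0 p : (0 <= F p)%E by rewrite lee_fin !mulr_ge0 ?ppow_ge0// expR_ge0.
have gI0 c x : (0 <= (ppow c x * expR (- x))%:E)%E.
  by rewrite lee_fin mulr_ge0 ?ppow_ge0// expR_ge0.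
transitivity (\int[mu]_x \int[mu]_z F (x, z))%E.
  rewrite {1}/gammaI muleC -ge0_integralZl; [|exact: measurableT|
    exact: measurable_gammaI|by move=> x _; exact: gI0|exact: gammaI_ge0].
  apply: eq_integral => x _.
  rewrite muleC /gammaI -ge0_integralZl_EFin; [|exact: measurableT|
    by move=> y _; exact: gI0|exact: measurable_gammaI|by rewrite -lee_fin; exact: gI0].
  have mFx : measurable_fun setT (fun z => F (x, z)).
    by apply: (measurableT_comp mF); exact: measurable_pair1.
  have := integral_affine x ltr01 mFx (fun z => F0 (x, z)).
  rewrite invr1 mul1e => <-; apply: eq_integral => y _.
  rewrite /F /= mul1r addrK -EFinM opprD expRD; congr EFin; ring.
transitivity (\int[mu]_z \int[mu]_x F (x, z))%E; first exact: fubini_tonelli.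
transitivity (\int[mu]_z ((ppow (a + b) z * expR (- z))%:E * betaI a b))%E.
  apply: eq_integral => z _; rewrite EFinM [((ppow _ z)%:E * _)%E]muleC -muleA.
  rewrite -ppow_convolution -ge0_integralZl_EFin; [|exact: measurableT|
    by move=> x _; rewrite lee_fin mulr_ge0 ?ppow_ge0|exact: measurable_betaI|
    exact: expR_ge0].
  by apply: eq_integral => x _; rewrite /F /= -EFinM mulrC.
under eq_integral do rewrite muleC.
rewrite ge0_integralZl; [by rewrite muleC|exact: measurableT|
  exact: measurable_gammaI|by move=> x _; exact: gI0|exact: betaI_ge0].
Qed.

(** The integrand may be unbounded at 0, so the fundamental theorem is applied on [1/(n+1), 1]
    before passing to the monotone limit. *)
Lemma betaI1 a : 0 < a -> betaI a 1 = (a^-1)%:E.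
Proof.
move=> a0.
have mpow (D : set R) : measurable_fun D (fun x => (x `^ (a - 1))%:E).
  by apply/measurable_EFinP; apply: measurable_funTS; exact: measurable_powR.
have -> : betaI a 1 = (\int[mu]_(x in `]0%R, 1%R]) (x `^ (a - 1))%:E)%E.
  rewrite -integral_itv_bndo_bndc// [RHS]integral_mkcond.
  apply: eq_integral => x _; rewrite patchE ppow1 /ppow subr_gt0.
  case: ifPn => [|x0].
    case: ifPn => [x1|x1] x0; first by rewrite mulr1 mem_set//= in_itv/= x0 x1.
    by rewrite mulr0 memNset//= in_itv/= (negbTE x1) andbF.
  by rewrite mul0r memNset//= in_itv/= (negbTE x0).
pose u n : R := n.+1%:R^-1.
have u0 n : 0 < u n by rewrite invr_gt0.
have UE : \bigcup_n `[u n, 1]%classic = `]0%R, 1%R]%classic.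
  apply/seteqP; split => [x [n _] /=|x /=].
    by rewrite !in_itv/= => /andP[h ->]; rewrite (lt_le_trans (u0 n) h).
  rewrite in_itv/= => /andP[x0 x1]; exists (Num.truncn x^-1) => //=.
  rewrite in_itv/= x1 andbT /u -[leRHS]invrK lef_pV2 ?posrE ?invr_gt0//.
  by rewrite ltW// truncnS_gt.
have nd : nondecreasing_seq (fun n => `[u n, 1]%classic).
  move=> m n mn; apply/subsetPset => x /=; rewrite !in_itv/= => /andP[h ->].
  by rewrite (le_trans _ h)// lef_pV2 ?posrE// ler_nat.
have cv : (\int[mu]_(x in `[u n, 1%R]) (x `^ (a - 1))%:E)%E @[n --> \oo] -->
    (\int[mu]_(x in `]0%R, 1%R]) (x `^ (a - 1))%:E)%E.
  rewrite -UE; apply: ge0_nondecreasing_set_cvg_integral => //.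
  - by move=> i; exact: mpow.
  - by move=> i x _; rewrite lee_fin powR_ge0.
have intE n : (\int[mu]_(x in `[u n, 1%R]) (x `^ (a - 1))%:E =
    (a^-1 - a^-1 * u n `^ a)%:E)%E.
  have [un1|] := ltP (u n) 1; last first.
    rewrite le_eqVlt => /orP[/eqP <-|].
      by rewrite set_itv1 integral_set1 powR1 mulr1 subrr.
    by rewrite ltNge invf_le1// ler1n.
  rewrite (continuous_FTC2 (F := fun x => a^-1 * x `^ a))//.
  - by rewrite powR1 mulr1.
  - apply: continuous_in_subspaceT => x; rewrite inE/= in_itv/= => /andP[h _].
    have x0 := lt_le_trans (u0 n) h.
    apply: differentiable_continuous; apply/derivable1_diffP.
    by apply: derivable_powR; rewrite in_itv/= x0.
  - have dF x : 0 < x -> derivable (fun x => a^-1 * x `^ a) x 1.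
      by move=> x0; apply: derivableM => //; apply: derivable_powR; rewrite in_itv/= x0.
    have cF x : 0 < x -> {for x, continuous (fun x => a^-1 * x `^ a)}.
      by move=> x0; apply: differentiable_continuous; exact/derivable1_diffP/dF.
    split.
    + move=> x; rewrite in_itv/= => /andP[h _]; apply: dF; exact: lt_trans h.
    + by apply: cvg_at_right_filter; exact: cF.
    + by apply: cvg_at_left_filter; exact: cF.
  - move=> x; rewrite in_itv/= => /andP[h _].
    have x0 := lt_trans (u0 n) h.
    have d := is_derive1_powR a x0.
    rewrite derive1E deriveMl; last by apply: derivable_powR; rewrite in_itv/= x0.
    by rewrite (@derive_val _ _ _ _ _ _ _ d) mulrA mulVf ?mul1r// gt_eqF.
rewrite -(cvg_lim (@ereal_hausdorff R) cv); apply: cvg_lim; first exact: ereal_hausdorff.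
rewrite (_ : (fun _ => _) = EFin \o (fun n => a^-1 - a^-1 * u n `^ a)); last first.
  by apply/funext => n; exact: intE.
apply: cvg_EFin; first exact: nearW.
rewrite -[X in _ --> X]subr0 -(mulr0 a^-1).
apply: cvgB; first exact: cvg_cst.
apply: cvgM; first exact: cvg_cst.
apply: (@cvg_comp _ _ _ u (fun x => x `^ a) _ (0 : R)^'+); last exact: powR_cvg0.
move=> A hA; have : \forall n \near \oo, 0 < u n -> A (u n) by exact: cvg_harmonic hA.
by apply: filterS => n; apply; exact: u0.
Qed.

Lemma gammaI1 : gammaI 1 = 1%E.
Proof.
rewrite -(@integral_exponential_pdf R 1 ltr01) [RHS]integral_mkcond.
transitivity (\int[mu]_(x in `]0%R, +oo[) (expR (- x))%:E)%E.
  rewrite [RHS]integral_mkcond; apply: eq_integral => x _.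
  rewrite patchE ppow1; case: ifPn => x0.
    by rewrite mul1r mem_set//= in_itv/= x0.
  by rewrite mul0r memNset//= in_itv/= (negbTE x0).
rewrite integral_itv_obnd_cbnd; last first.
  apply: measurable_funTS; apply/measurable_EFinP.
  by apply: (measurableT_comp (@measurable_expR R)); exact: measurable_funN.
rewrite [LHS]integral_mkcond patch_setT; apply: eq_integral => x _.
rewrite /exponential_pdf !patchE; case: ifPn => //.
by rewrite mul1r mulN1r.
Qed.

(** The case b = 1 of [gammaI_beta], in place of an integration by parts. *)
Lemma gammaI_succ a : 0 < a -> gammaI a = ((a^-1)%:E * gammaI (a + 1))%E.
Proof.
by move=> a0; rewrite muleC -(betaI1 a0) -gammaI_beta gammaI1 mule1.
Qed.

Lemma gammaI_nat_lty n : (gammaI n.+1%:R < +oo)%E.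
Proof.
elim: n => [|n IH]; first by rewrite gammaI1 ltry.
move: IH; rewrite gammaI_succ// natr1.
have := gammaI_ge0 n.+2%:R; case: (gammaI _) => [r _ _|_|]//.
  exact: ltry.
by rewrite gt0_muley// lte_fin invr_gt0.
Qed.

Let mge0 a b x : 0 <= ppow a x * ppow b (1 - x).
Proof. by rewrite mulr_ge0 ?ppow_ge0. Qed.

Let ge0 a x : 0 <= ppow a x * expR (- x).
Proof. by rewrite mulr_ge0 ?ppow_ge0 ?expR_ge0. Qed.

(** Below 1 the exponential is bounded by 1; beyond 1 the exponent is raised to an integer, where
    [gammaI_succ] gives finiteness by induction. *)
Lemma gammaI_lty a : 0 < a -> (gammaI a < +oo)%E.
Proof.
move=> a0; pose n := Num.truncn a.
have an : a < n.+1%:R by exact: truncnS_gt.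
apply: (@le_lt_trans _ _ (betaI a 1 + gammaI n.+1%:R)%E); last first.
  by rewrite betaI1// lte_add_pinfty ?ltry ?gammaI_nat_lty.
rewrite /betaI /gammaI -ge0_integralD; [|exact: measurableT|
  by move=> x _; rewrite lee_fin|exact: measurable_betaI|
  by move=> x _; rewrite lee_fin|exact: measurable_gammaI].
apply: ge0_le_integral => //.
- by move=> x _; rewrite lee_fin.
- exact: measurable_gammaI.
- by apply: emeasurable_funD; [exact: measurable_betaI|exact: measurable_gammaI].
move=> x _; rewrite -EFinD lee_fin ppow1 subr_gt0 /ppow.
case: ifPn => x0; last by rewrite !mul0r addr0.
have e1 : expR (- x) <= 1 by rewrite -expR0 ler_expR oppr_le0 ltW.
case: ifPn => x1.
  rewrite mulr1 -[leLHS]addr0 lerD//; first by rewrite ler_piMr// powR_ge0.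
  by rewrite mulr_ge0 ?powR_ge0 ?expR_ge0.
rewrite mulr0 add0r ler_pM2r ?expR_gt0//.
by apply: ler_powR; [rewrite leNgt|rewrite lerD2r ltW].
Qed.

Lemma gammaI_gt0 a : 0 < a -> (0 < gammaI a)%E.
Proof.
move=> a0; apply: (@lt_le_trans _ _ ((expR (-1))%:E * betaI a 1)%E).
  by rewrite betaI1// -EFinM lte_fin mulr_gt0 ?expR_gt0// invr_gt0.
rewrite /betaI -ge0_integralZl_EFin; [|exact: measurableT|
  by move=> x _; rewrite lee_fin|exact: measurable_betaI|exact: expR_ge0].
apply: ge0_le_integral => //.
- by move=> x _; rewrite lee_fin mulr_ge0// expR_ge0.
- apply: measurable_funeM; exact: measurable_betaI.
- exact: measurable_gammaI.
move=> x _; rewrite -EFinM lee_fin ppow1 subr_gt0; case: ifPn => x1.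
  rewrite mulr1 mulrC ler_wpM2l ?ppow_ge0// ler_expR lerNl opprK; exact: ltW.
by rewrite !mulr0.
Qed.

Lemma GammaE a : 0 < a -> gammaI a = (Gamma a)%:E.
Proof.
move=> a0; rewrite /Gamma /Rintegral; transitivity ((fine (gammaI a))%:E).
  by rewrite fineK// ge0_fin_numE ?gammaI_ge0// gammaI_lty.
congr (fine _)%:E; rewrite [RHS]integral_mkcond; apply: eq_integral => x _.
rewrite patchE /ppow; case: ifPn => x0; first by rewrite mem_set//= in_itv/= x0.
by rewrite mul0r memNset//= in_itv/= (negbTE x0).
Qed.

Lemma Gamma_gt0 a : 0 < a -> 0 < Gamma a.
Proof. by move=> a0; rewrite -lte_fin -GammaE// gammaI_gt0. Qed.

Lemma betaE a b : 0 < a -> 0 < b ->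
  betaI a b = (Gamma a * Gamma b / Gamma (a + b))%:E.
Proof.
move=> a0 b0; have ab0 : 0 < a + b by rewrite addr_gt0.
have := gammaI_beta a b; rewrite !GammaE//.
have := betaI_ge0 a b; case: (betaI a b) => [r|//|//] _.
  rewrite -!EFinM => -[->]; congr EFin.
  by rewrite mulrAC mulfV ?mul1r// gt_eqF// Gamma_gt0.
by rewrite gt0_muley// lte_fin Gamma_gt0.
Qed.

Lemma GammaS a : 0 < a -> Gamma (a + 1) = a * Gamma a.
Proof.
move=> a0; have a1 : 0 < a + 1 by rewrite addr_gt0.
have := gammaI_succ a0; rewrite !GammaE// -EFinM => -[->].
by rewrite mulrA mulfV ?mul1r// gt_eqF.
Qed.

Lemma Gamma_rising a n : 0 < a -> Gamma (a + n%:R) = Gamma a * rising a n.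
Proof.
move=> a0; elim: n => [|n IH]; first by rewrite addr0 rising0 mulr1.
rewrite -natr1 addrA GammaS ?ltr_pwDl// IH risingS; ring.
Qed.

Lemma pochhammer_rising a n : 0 < a -> pochhammer a n%:R = rising a n.
Proof.
by move=> a0; rewrite /pochhammer Gamma_rising// mulrC mulKf// gt_eqF// Gamma_gt0.
Qed.

End gamma_beta.

(** * Calculus of the iterated Lebesgue integral *)

Section tuple_integral.
Context (R : realType).
Local Notation mu := (@lebesgue_measure R).
Local Notation LI := lebesgue_integral_tuple.
Local Open Scope ereal_scope.

Lemma LI_ge0 n (f : n.-tuple R -> \bar R) : (forall t, 0 <= f t) -> 0 <= LI f.
Proof.
elim: n f => [|n IH] f f0 //=.
by apply: integral_ge0 => x _; apply: IH => t.
Qed.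

Lemma measurable_cons_tuple n (x : R) :
  measurable_fun setT (fun t : n.-tuple R => cons_tuple x t).
Proof. by apply: measurable_cons. Qed.

(** The parameter space is arbitrary so that the induction can move the first coordinate of the
    tuple into it. *)
Lemma measurable_LI (d : measure_display) (U : measurableType d) n
    (f : U * n.-tuple R -> \bar R) :
  measurable_fun setT f -> (forall z, 0 <= f z) ->
  measurable_fun setT (fun u => LI (fun t => f (u, t))).
Proof.
elim: n d U f => [|n IH] d U f mf f0 /=.
  apply: (measurableT_comp mf).
  by apply: measurable_fun_pair => //; exact: measurable_cst.
pose g (z : (U * R) * n.-tuple R) := f (z.1.1, cons_tuple z.1.2 z.2).
have mg : measurable_fun setT g.
  apply: (measurableT_comp mf); apply: measurable_fun_pair.
    exact: (measurableT_comp measurable_fst).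
  apply: measurable_cons; last exact: measurable_snd.
  exact: (measurableT_comp measurable_snd).
have := IH _ _ g mg (fun=> f0 _) => mG.
apply: (measurable_fun_fubini_tonelli_F (m2 := mu)
  (fun z : U * R => LI (fun t => g (z, t)))) => // z.
by apply: LI_ge0 => t; exact: f0.
Qed.

Lemma measurable_LI_cons n (f : n.+1.-tuple R -> \bar R) :
  measurable_fun setT f -> (forall t, 0 <= f t) ->
  measurable_fun setT (fun x => LI (fun t : n.-tuple R => f (cons_tuple x t))).
Proof.
move=> mf f0.
apply: (measurable_LI (f := fun z : R * n.-tuple R => f (cons_tuple z.1 z.2))) => //.
apply: (measurableT_comp mf); apply: measurable_cons; first exact: measurable_fst.
exact: measurable_snd.
Qed.

Lemma measurable_comp_cons n (f : n.+1.-tuple R -> \bar R) x :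
  measurable_fun setT f ->
  measurable_fun setT (fun t : n.-tuple R => f (cons_tuple x t)).
Proof. by move=> mf; apply: (measurableT_comp mf); exact: measurable_cons_tuple. Qed.

Lemma LIZl n (c : R) (f : n.-tuple R -> \bar R) : (0 <= c)%R ->
  measurable_fun setT f -> (forall t, 0 <= f t) ->
  LI (fun t => c%:E * f t) = c%:E * LI f.
Proof.
move=> c0; elim: n f => [|n IH] f mf f0 //=.
rewrite -ge0_integralZl_EFin//; last 2 first.
- by move=> x _; apply: LI_ge0 => t; exact: f0.
- exact: measurable_LI_cons.
by apply: eq_integral => x _; rewrite IH//; exact: measurable_comp_cons.
Qed.

Lemma LID n (f g : n.-tuple R -> \bar R) :
  measurable_fun setT f -> (forall t, 0 <= f t) ->
  measurable_fun setT g -> (forall t, 0 <= g t) ->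
  LI (fun t => f t + g t) = LI f + LI g.
Proof.
elim: n f g => [|n IH] f g mf f0 mg g0 //=.
rewrite -ge0_integralD//; last 4 first.
- by move=> x _; apply: LI_ge0 => t; exact: f0.
- exact: measurable_LI_cons.
- by move=> x _; apply: LI_ge0 => t; exact: g0.
- exact: measurable_LI_cons.
by apply: eq_integral => x _; rewrite IH//; exact: measurable_comp_cons.
Qed.

Lemma LI0 n : LI (fun _ : n.-tuple R => 0) = 0.
Proof. by elim: n => //= n IH; rewrite integral0_eq. Qed.

Lemma LI_sum n (I : Type) (s : seq I) (f : I -> n.-tuple R -> \bar R) :
  (forall i, measurable_fun setT (f i)) -> (forall i t, 0 <= f i t) ->
  LI (fun t => \sum_(i <- s) f i t) = \sum_(i <- s) LI (f i).
Proof.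
move=> mf f0; elim: s => [|i s IH].
  rewrite big_nil -[RHS](LI0 n); congr (LI _).
  by apply/funext => t; rewrite big_nil.
rewrite big_cons -IH -LID//; last 2 first.
- exact: emeasurable_sum.
- by move=> t; exact: sume_ge0.
by congr (LI _); apply/funext => t; rewrite big_cons.
Qed.

Lemma LI_le n (f g : n.-tuple R -> \bar R) :
  measurable_fun setT f -> (forall t, 0 <= f t) -> measurable_fun setT g ->
  (forall t, f t <= g t) -> LI f <= LI g.
Proof.
elim: n f g => [|n IH] f g mf f0 mg fg //=.
have g0 t : 0 <= g t by exact: le_trans (f0 t) (fg t).
apply: ge0_le_integral => //.
- by move=> x _; apply: LI_ge0 => t; exact: f0.
- exact: measurable_LI_cons.
- exact: measurable_LI_cons.
- by move=> x _; apply: IH => //; exact: measurable_comp_cons.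
Qed.

Lemma LI_monotone_convergence n (f : (n.-tuple R -> \bar R)^nat) :
  (forall m, measurable_fun setT (f m)) -> (forall m t, 0 <= f m t) ->
  (forall t, nondecreasing_seq (f ^~ t)) ->
  LI (fun t => limn (f ^~ t)) = limn (fun m => LI (f m)).
Proof.
elim: n f => [|n IH] f mf f0 ndf //=.
rewrite -monotone_convergence//; last 3 first.
- by move=> m; exact: measurable_LI_cons.
- by move=> m x _; apply: LI_ge0 => t; exact: f0.
- move=> x _ m1 m2 m12; apply: LI_le => //; try exact: measurable_comp_cons.
  by move=> t; exact: ndf.
apply: eq_integral => x _; rewrite -IH//.
by move=> m; exact: measurable_comp_cons.
Qed.

Lemma LI_scale n (c : R) (f : n.-tuple R -> \bar R) : (0 < c)%R ->
  measurable_fun setT f -> (forall t, 0 <= f t) ->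
  LI (fun t => f (map_tuple ( *%R c) t)) = (c ^- n)%:E * LI f.
Proof.
move=> c0; elim: n f => [|n IH] f mf f0 /=.
  by rewrite invr1 mul1e; congr f; exact: tuple0.
transitivity (\int[mu]_x ((c ^- n)%:E * LI (fun t => f (cons_tuple (c * x + 0)%R t)))).
  apply: eq_integral => x _; rewrite -IH//; last exact: measurable_comp_cons.
  congr (LI _); apply/funext => t; congr f; apply: val_inj => /=.
  by rewrite addr0.
rewrite ge0_integralZl_EFin//; last 3 first.
- by move=> x _; apply: LI_ge0 => t; exact: f0.
- apply: (measurableT_comp (measurable_LI_cons mf f0)).
  by apply: measurable_funD => //; exact: measurable_funM.
- by rewrite invr_ge0 exprn_ge0// ltW.
rewrite (integral_affine (f := fun x => LI (fun t => f (cons_tuple x t))) 0 c0)//.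
- by rewrite muleA -EFinM exprS invfM mulrC.
- exact: measurable_LI_cons.
- by move=> x; apply: LI_ge0.
Qed.

(** Discards the hyperplanes t_j = 0 and sum = c. Once a first coordinate outside {0, c} is fixed,
    the same statement remains with c - x, again nonzero; for the empty tuple, c != 0 makes the
    condition true. *)
Lemma eq_LI_ae n (c : R) (f g : n.-tuple R -> \bar R) : (c != 0)%R ->
  measurable_fun setT f -> (forall t, 0 <= f t) ->
  measurable_fun setT g -> (forall t, 0 <= g t) ->
  (forall t : n.-tuple R, all (fun x => x != 0)%R t -> (\sum_(x <- t) x != c)%R -> f t = g t) ->
  LI f = LI g.
Proof.
elim: n c f g => [|n IH] c f g c0 mf f0 mg g0 fg /=.
  by apply: fg => //; rewrite big_nil eq_sym.
apply: ge0_ae_eq_integral => //.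
- exact: measurable_LI_cons.
- exact: measurable_LI_cons.
- by move=> x _; apply: LI_ge0.
- by move=> x _; apply: LI_ge0.
exists ([set 0%R] `|` [set c]); split.
- exact: measurableU.
- by rewrite measureU0//; exact: lebesgue_measure_set1.
move=> x /= /not_implyP[_]; apply: contra_notP => /not_orP[/eqP x0 /eqP xc].
apply: (IH (c - x)%R) => //.
- by rewrite subr_eq0 eq_sym.
- exact: measurable_comp_cons.
- exact: measurable_comp_cons.
move=> t t0 tc; apply: fg; first by rewrite /= x0.
by rewrite big_cons; apply: contra tc => /eqP <-; rewrite addrC addKr.
Qed.

End tuple_integral.

Section tuple_measurability.
Context (R : realType).

Lemma measurable_tuple_nth n j : measurable_fun setT (fun t : n.-tuple R => t`_j).
Proof.
have [jn|nj] := ltnP j n; last first.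
  rewrite (_ : (fun _ => _) = cst 0); first exact: measurable_cst.
  by apply/funext => t; rewrite nth_default// size_tuple.
rewrite (_ : (fun _ => _) = fun t => tnth t (Ordinal jn)); first exact: measurable_tnth.
by apply/funext => t; rewrite (tnth_nth 0).
Qed.

Lemma measurable_tuple_sum n : measurable_fun setT (fun t : n.-tuple R => \sum_(x <- t) x).
Proof.
rewrite (_ : (fun _ => _) = fun t : n.-tuple R => \sum_(j < n) t`_j).
  by apply: measurable_sum => j; exact: measurable_tuple_nth.
apply/funext => t; rewrite big_tuple; apply: eq_bigr => j _.
by rewrite (tnth_nth 0).
Qed.

End tuple_measurability.

Section dirichlet.
Context (R : realType).
Local Notation LI := lebesgue_integral_tuple.

Definition dirichlet_kernel n (a : nat -> R) b s (t : n.-tuple R) : R :=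
  (\prod_(j < n) ppow (a j) t`_j) * ppow b (s - \sum_(x <- t) x).

Lemma dirichlet_kernel_ge0 n a b s (t : n.-tuple R) : 0 <= dirichlet_kernel a b s t.
Proof. by rewrite mulr_ge0 ?ppow_ge0// prodr_ge0// => j _; exact: ppow_ge0. Qed.

Lemma measurable_dirichlet_kernel n a b s :
  measurable_fun setT (fun t : n.-tuple R => dirichlet_kernel a b s t).
Proof.
apply: measurable_funM.
  apply: measurable_prod => j _; apply: (measurableT_comp (measurable_ppow (a j))).
  exact: measurable_tuple_nth.
apply: (measurableT_comp (measurable_ppow b)).
by apply: measurable_funB => //; exact: measurable_tuple_sum.
Qed.

(** For a fixed first coordinate x the rest is a kernel of total s - x; the integral over x is then
    a convolution of two powers. *)
Lemma dirichlet_integral n a b s : (forall j, 0 < a j) -> 0 < b ->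
  LI (fun t : n.-tuple R => (dirichlet_kernel a b s t)%:E) =
  (ppow (\sum_(j < n) a j + b) s *
   ((\prod_(j < n) Gamma (a j)) * Gamma b / Gamma (\sum_(j < n) a j + b)))%:E.
Proof.
elim: n a s => [|n IH] a s a0 b0 /=.
  rewrite /dirichlet_kernel !big_ord0 big_nil subr0 !mul1r add0r.
  by rewrite mulfV ?mulr1// gt_eqF// Gamma_gt0.
pose a' j := a j.+1; pose A := \sum_(j < n) a' j.
have A0 : 0 <= A by apply: sumr_ge0 => j _; exact/ltW/a0.
have Ab0 : 0 < A + b by rewrite ltr_wpDl.
pose C := (\prod_(j < n) Gamma (a' j)) * Gamma b / Gamma (A + b).
have C0 : 0 <= C.
  rewrite divr_ge0 ?mulr_ge0 ?ltW ?Gamma_gt0//.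
  by apply: prodr_gt0 => j _; rewrite Gamma_gt0// a0.
transitivity (\int[@lebesgue_measure R]_x
    (C%:E * (ppow (a 0%N) x * ppow (A + b) (s - x))%:E))%E.
  apply: eq_integral => x _.
  transitivity (LI (fun t : n.-tuple R => (ppow (a 0%N) x)%:E *
      (dirichlet_kernel a' b (s - x) t)%:E)%E).
    congr (LI _); apply/funext => t; rewrite -EFinM; congr EFin.
    rewrite /dirichlet_kernel big_ord_recl big_cons /= opprD addrA mulrA.
    by [].
  rewrite LIZl ?ppow_ge0//; last 2 first.
  - by apply/measurable_EFinP; exact: measurable_dirichlet_kernel.
  - by move=> t; rewrite lee_fin dirichlet_kernel_ge0.
  rewrite (IH a' _ (fun j => a0 j.+1) b0) -!EFinM; congr EFin.
  by rewrite -/A -/C; ring.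
rewrite ge0_integralZl_EFin; [|exact: measurableT| | |by []]; last 2 first.
- by move=> x _; rewrite lee_fin mulr_ge0 ?ppow_ge0.
- apply/measurable_EFinP; apply: measurable_funM; first exact: measurable_ppow.
  exact: measurable_ppowB.
rewrite ppow_convolution betaE// -!EFinM; congr EFin.
have -> : \sum_(j < n.+1) a j = a 0%N + A.
  by rewrite big_ord_recl; congr (_ + _); apply: eq_bigr => j _; rewrite lift0.
have -> : \prod_(j < n.+1) Gamma (a j) = Gamma (a 0%N) * \prod_(j < n) Gamma (a' j).
  by rewrite big_ord_recl; congr (_ * _); apply: eq_bigr => j _; rewrite lift0.
have g1 : Gamma (A + b) != 0 by rewrite gt_eqF// Gamma_gt0.
have g2 : Gamma (a 0%N + A + b) != 0 by rewrite gt_eqF// Gamma_gt0// -addrA addr_gt0.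
by rewrite /C addrA; field; rewrite g1 g2.
Qed.

End dirichlet.

(** * Measures from positive functionals, determination by moments *)

Section daniell.
Context (R : realType) (d : measure_display) (T : measurableType d).
Local Open Scope ereal_scope.

(** Covers iterated integrals as well as integrals of kernels; each becomes a measure to which
    moment uniqueness applies. *)
Record daniell_functional (L : (T -> \bar R) -> \bar R) : Prop := DaniellFunctional {
  df_ge0 : forall f, (forall x, 0 <= f x) -> 0 <= L f;
  df_add : forall f g, measurable_fun setT f -> (forall x, 0 <= f x) ->
    measurable_fun setT g -> (forall x, 0 <= g x) ->
    L (fun x => f x + g x) = L f + L g;
  df_scale : forall (c : R) f, (0 <= c)%R -> measurable_fun setT f ->
    (forall x, 0 <= f x) -> L (fun x => c%:E * f x) = c%:E * L f;
  df_le : forall f g, measurable_fun setT f -> (forall x, 0 <= f x) ->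
    measurable_fun setT g -> (forall x, f x <= g x) -> L f <= L g;
  df_monotone : forall f : (T -> \bar R)^nat,
    (forall n, measurable_fun setT (f n)) -> (forall n x, 0 <= f n x) ->
    (forall x, nondecreasing_seq (f ^~ x)) ->
    L (fun x => limn (f ^~ x)) = limn (fun n => L (f n))
}.

Variable L : (T -> \bar R) -> \bar R.
Hypothesis hL : daniell_functional L.

Lemma daniell0 : L (fun=> 0) = 0.
Proof.
have -> : (fun=> 0) = (fun _ : T => 0%R%:E * (0 : \bar R)).
  by apply/funext => x; rewrite mul0e.
by rewrite (df_scale hL)// mul0e.
Qed.

Lemma daniell_sum (I : Type) (s : seq I) (f : I -> T -> \bar R) :
  (forall i, measurable_fun setT (f i)) -> (forall i x, 0 <= f i x) ->
  L (fun x => \sum_(i <- s) f i x) = \sum_(i <- s) L (f i).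
Proof.
move=> mf f0; elim: s => [|i s IH].
  by rewrite big_nil -[RHS]daniell0; congr L; apply/funext => x; rewrite big_nil.
rewrite big_cons -IH -(df_add hL)//; last 2 first.
- exact: emeasurable_sum.
- by move=> x; exact: sume_ge0.
by congr L; apply/funext => x; rewrite big_cons.
Qed.

Definition daniell_content (A : set T) : \bar R := L (fun x => (\1_A x)%:E).

Let content0 : daniell_content set0 = 0.
Proof.
by rewrite -daniell0; congr L; apply/funext => x; rewrite indic0.
Qed.

Let content_ge0 A : 0 <= daniell_content A.
Proof. by apply: (df_ge0 hL) => x; rewrite lee_fin. Qed.

Let content_sigma_additive : semi_sigma_additive daniell_content.
Proof.
move=> F mF tF mUF.
have mI n : measurable_fun setT (fun x => (\1_(F n) x)%:E : \bar R).
  by apply/measurable_EFinP; exact: measurable_indic.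
have I0 n x : 0 <= (\1_(F n) x)%:E :> \bar R by rewrite lee_fin.
pose g n x : \bar R := \sum_(i < n) (\1_(F i) x)%:E.
have mg n : measurable_fun setT (g n) by exact: emeasurable_sum.
have g0 n x : 0 <= g n x by exact: sume_ge0.
have gS n x : g n.+1 x = g n x + (\1_(F n) x)%:E by rewrite /g big_ord_recr.
have ndg x : nondecreasing_seq (g ^~ x).
  by apply/nondecreasing_seqP => n; rewrite gS leeDl.
have LgE n : L (g n) = \sum_(0 <= i < n) daniell_content (F i).
  by rewrite big_mkord /g daniell_sum.
rewrite (_ : (fun _ => _) = L \o g); last by apply/funext => n; rewrite /= LgE.
have -> : daniell_content (\bigcup_n F n) = limn (L \o g).
  rewrite -(df_monotone hL)//; congr L; apply/funext => x; apply/esym.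
  have [[k _ Fk]|nF] := pselect ((\bigcup_n F n) x).
    apply: lim_near_cst => //; exists k.+1 => // n /= kn.
    rewrite indicE mem_set; last by exists k.
    rewrite /g (bigD1 (Ordinal kn))//= indicE mem_set// big1 ?adde0// => i.
    rewrite -val_eqE /= => ik; rewrite indicE memNset// => Fi.
    by move: ik; rewrite (tF i k)// ?eqxx//; exists x.
  apply: lim_near_cst => //; apply: nearW => n.
  rewrite indicE memNset// /g big1// => i _; rewrite indicE memNset// => Fi.
  by apply: nF; exists i.
apply: ereal_nondecreasing_is_cvgn; apply/nondecreasing_seqP => n /=.
by rewrite !LgE big_nat_recr//= leeDl.
Qed.

HB.instance Definition _ := isMeasure.Build _ _ _ daniell_content
  content0 content_ge0 content_sigma_additive.

Import HBNNSimple.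

Definition daniell_measure : {measure set T -> \bar R} := daniell_content.

Lemma integral_daniell (f : T -> \bar R) :
  measurable_fun setT f -> (forall x, 0 <= f x) ->
  \int[daniell_measure]_x f x = L f.
Proof.
move=> mf f0; pose g := nnsfun_approx measurableT mf.
have mg n : measurable_fun setT (fun x => (g n x)%:E).
  by apply/measurable_EFinP.
have g0 n x : 0 <= (g n x)%:E by rewrite lee_fin; exact: fun_ge0.
have ndg x : nondecreasing_seq (fun n => (g n x)%:E).
  by move=> m n mn; rewrite lee_fin; exact/lefP/nd_nnsfun_approx.
have fE : f = fun x => limn (fun n => (g n x)%:E).
  by apply/funext => x; apply/esym/cvg_lim => //; exact: cvg_nnsfun_approx.
rewrite [in RHS]fE (df_monotone hL)//.
transitivity (\int[daniell_measure]_x limn (fun n => (g n x)%:E)).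
  by rewrite -fE.
rewrite monotone_convergence//; congr (limn _); apply/funext => n.
rewrite integral_nnsfun// patch_setT sintegralE.
have fin := fimfunP (g n).
rewrite fsbig_finite//=.
transitivity (L (fun x => \sum_(y <- fset_set (range (g n)))
    (y * \1_(g n @^-1` [set y]) x)%:E)); last first.
  by congr L; apply/funext => x; rewrite sumEFin fimfunE fsbig_finite.
(* [daniell_sum] asks for nonnegative functions at every index, whereas only the values of [g n] are
   known to be nonnegative; the maximum with 0 changes none of them. *)
transitivity (\sum_(y <- fset_set (range (g n)))
    L (fun x => (Num.max y 0 * \1_(g n @^-1` [set y]) x)%:E)).
  rewrite big_seq [RHS]big_seq; apply: eq_bigr => y.
  rewrite in_fset_set// inE => -[x _ <-].
  rewrite (max_idPl _)//.
  under [in RHS]eq_fun do rewrite EFinM.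
  rewrite (df_scale hL)//.
  by apply/measurable_EFinP; exact: measurable_indic.
rewrite -daniell_sum.
- congr L; apply/funext => x; rewrite big_seq [RHS]big_seq; apply: eq_bigr => y.
  by rewrite in_fset_set// inE => -[z _ <-]; rewrite (max_idPl _).
- by move=> y; apply/measurable_EFinP; apply: measurable_funM.
- by move=> y x; rewrite lee_fin mulr_ge0// le_max lexx orbT.
Qed.

End daniell.

Section soft_threshold.
Context (R : realType).

(* Polynomials in u converging on [0, 1] to the indicator of [0, 1/2[. *)
Definition soft_threshold (n : nat) (u : R) : R :=
  (1 - u ^+ n) ^+ (n * 2 ^ n).

Lemma soft_threshold_01 n u : 0 <= u <= 1 -> 0 <= soft_threshold n u <= 1.
Proof.
move=> /andP[u0 u1]; have h : 0 <= 1 - u ^+ n <= 1.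
  by rewrite subr_ge0 exprn_ile1//= lerBlDr lerDl exprn_ge0.
by case/andP: h => h0 h1; rewrite exprn_ge0//= exprn_ile1.
Qed.

Lemma bernoulli (x : R) n : -1 <= x -> 1 + n%:R * x <= (1 + x) ^+ n.
Proof.
move=> x1; have y0 : 0 <= 1 + x by rewrite addrC -lerBlDr sub0r.
elim: n => [|n IH]; first by rewrite mul0r addr0.
rewrite exprS (le_trans _ (ler_wpM2l y0 IH))//.
have : 0 <= n%:R * x ^+ 2 by rewrite mulr_ge0 ?sqr_ge0.
by rewrite -natr1 expr2; lra.
Qed.

(** Write t = s^2: Bernoulli's inequality for 1/s bounds n s^n, and the other factor s^n tends to
    0. *)
Lemma cvg_natM_expr (t : R) : 0 <= t < 1 ->
  (fun n => n%:R * t ^+ n : R) @ \oo --> (0 : R).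
Proof.
move=> /andP[t0 t1]; have [->|tn0] := eqVneq t 0.
  apply: cvg_near_cst; exists 1%N => // n /= n1.
  by rewrite expr0n gtn_eqF// mulr0.
have tp : 0 < t by rewrite lt_neqAle eq_sym tn0.
pose s := Num.sqrt t.
have s0 : 0 < s by rewrite sqrtr_gt0.
have s1 : s < 1 by rewrite -sqrtr1 ltr_sqrt.
have e0 : 0 < s^-1 - 1 by rewrite subr_gt0 invf_gt1.
have bnd n : n%:R * s ^+ n <= (s^-1 - 1)^-1.
  have h : n%:R * (s^-1 - 1) <= s ^- n.
    have := @bernoulli (s^-1 - 1) n (le_trans (lerN10 _) (ltW e0)).
    by rewrite [1 + (s^-1 - 1)]addrC subrK exprVn; apply: le_trans; rewrite lerDr.
  rewrite -[leRHS]mul1r ler_pdivlMr// mulrAC.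
  by rewrite -ler_pdivlMr ?exprn_gt0// div1r.
apply: (@squeeze_cvgr _ _ _ _ (fun=> 0) (fun n => (s^-1 - 1)^-1 * s ^+ n)).
- apply: nearW => n; rewrite mulr_ge0 ?exprn_ge0//=.
  rewrite -(sqr_sqrtr t0) -/s exprAC expr2 mulrA ler_wpM2r//.
  by rewrite exprn_ge0// ltW.
- exact: cvg_cst.
- rewrite -[X in _ --> X](mulr0 (s^-1 - 1)^-1).
  apply: cvgM; first exact: cvg_cst.
  by apply: cvg_expr; rewrite ger0_norm// ltW.
Qed.

(** Put v = u^n and N = n 2^n. Below 1/2, Bernoulli gives (1 - v)^N >= 1 - n (2u)^n. From 1/2 on, N
    v >= n and (1 - v)(1 + v) <= 1, so (1 - v)^N <= 1/(1 + N v) <= 1/(n+1). *)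
Lemma cvg_soft_threshold u : 0 <= u <= 1 ->
  (fun n => soft_threshold n u) @ \oo --> ((u < 2^-1)%R%:R : R).
Proof.
move=> u01; have /andP[u0 u1] := u01; have [uh|hu] := ltP u 2^-1.
  apply: (@squeeze_cvgr _ _ _ _ (fun n => 1 - n%:R * (2 * u) ^+ n) (fun=> 1)).
  - apply: nearW => n; have /andP[_ ->] := soft_threshold_01 n u01.
    rewrite andbT; have un1 : -1 <= - u ^+ n by rewrite lerN2 exprn_ile1.
    have := bernoulli (n * 2 ^ n) un1.
    by rewrite natrM natrX mulrN exprMn mulrA.
  - rewrite -[X in _ --> X]subr0; apply: cvgB; first exact: cvg_cst.
    apply: cvg_natM_expr; rewrite mulr_ge0//= -ltr_pdivlMl// mulr1.
    by [].
  - exact: cvg_cst.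
apply: (@squeeze_cvgr _ _ _ _ (fun=> 0) (fun n => n.+1%:R^-1)).
- apply: nearW => n.
  have /andP[-> _] := soft_threshold_01 n u01; rewrite /=.
  set v := u ^+ n; have v0 : 0 <= v by rewrite exprn_ge0.
  have v1 : v <= 1 by rewrite exprn_ile1.
  have h1 : n.+1%:R <= (1 + v) ^+ (n * 2 ^ n).
    have := @bernoulli v (n * 2 ^ n) (le_trans _ v0); rewrite lerN10 => /(_ isT).
    apply: le_trans; rewrite -natr1 addrC lerD2l natrM natrX -mulrA ler_peMr//.
    rewrite /v -exprMn exprn_ege1// -ler_pdivrMl//.
    by rewrite mulr1.
  rewrite -[leRHS]mul1r ler_pdivlMr// (le_trans (ler_wpM2l _ h1))//.
    by rewrite exprn_ge0// subr_ge0.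
  rewrite -exprMn exprn_ile1//.
    by rewrite mulr_ge0 ?subr_ge0// addr_ge0.
  by rewrite (_ : (1 - v) * (1 + v) = 1 - v ^+ 2); [rewrite lerBlDr lerDl sqr_ge0|ring].
- exact: cvg_cst.
- exact: cvg_harmonic.
Qed.

End soft_threshold.

Section moment_uniqueness.
Context (R : realType) (k : nat).
Local Notation U := (k.-tuple R).

Definition orthant (c : 'I_k -> R) : set U := [set x | forall j, tnth x j < c j].

Definition cube (b : R) : set U := [set x | forall j, 0 <= tnth x j <= b].

Lemma measurable_cube b : measurable (cube b).
Proof.
have -> : cube b = \bigcap_(j in [set: 'I_k]) [set x : U | 0 <= tnth x j <= b].
  by apply/seteqP; split => x /= h j; [move=> _; exact: h|exact: h].
apply: fin_bigcap_measurable => // j _.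
rewrite (_ : [set _ | _] = setT `&` (@tnth k R ^~ j) @^-1` `[0, b]%classic); last first.
  by apply/seteqP; split => x /=; rewrite in_itv//= => -[].
exact: measurable_tnth.
Qed.

Lemma measurable_orthant c : measurable (orthant c).
Proof.
have -> : orthant c = \bigcap_(j in [set: 'I_k]) [set x : U | tnth x j < c j].
  by apply/seteqP; split => x /= h j; [move=> _; exact: h|exact: h].
apply: fin_bigcap_measurable => // j _.
rewrite (_ : [set _ | _] = setT `&` (@tnth k R ^~ j) @^-1` `]-oo, c j[%classic); last first.
  by apply/seteqP; split => x /=; rewrite in_itv//= => -[].
exact: measurable_tnth.
Qed.

Lemma measurable_orthantE : @measurable _ U = <<s range orthant >>.
Proof.
apply/seteqP; split; last first.
  apply: smallest_sub; first exact: sigma_algebra_measurable.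
  by move=> _ [c _ <-]; exact: measurable_orthant.
pose V := g_sigma_algebraType (range orthant).
(* Measurability of the identity from the generated sigma-algebra is checked on coordinates, where
   {x_i < x} is a countable union of orthants. *)
suff mid : measurable_fun setT (id : V -> U).
  by move=> A mA; have := mid measurableT A mA; rewrite setTI preimage_id.
apply/measurable_fun_tnthP => i.
apply: (measurability _ (RGenInftyO.measurableE R)) => // _ [_ [x ->] <-].
rewrite setTI.
have -> : ((@tnth k R ^~ i) \o id) @^-1` `]-oo, x[%classic =
    \bigcup_m orthant (fun j => if j == i then x else m%:R).
  apply/seteqP; split => t /=; rewrite in_itv/=.
    move=> tx; exists (\max_(j < k) (Num.truncn `|tnth t j|).+1) => // j.
    case: eqP => [->//|_].
    rewrite (le_lt_trans (ler_norm _))// (lt_le_trans (truncnS_gt _))// ler_nat.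
    exact: (leq_bigmax (F := fun j => (Num.truncn `|tnth t j|).+1)).
  by move=> [m _ /(_ i)]; rewrite eqxx.
apply: bigcupT_measurable => m; apply: sub_sigma_algebra.
by exists (fun j => if j == i then x else m%:R).
Qed.

Variables (b : R) (m1 m2 : {measure set U -> \bar R}).
Hypotheses (b0 : 0 < b) (fin1 : (m1 setT < +oo)%E) (fin2 : (m2 setT < +oo)%E)
  (cube1 : m1 (~` cube b) = 0%E) (cube2 : m2 (~` cube b) = 0%E)
  (moments : forall r : 'I_k -> nat,
    (\int[m1]_(x in cube b) (\prod_(j < k) tnth x j ^+ r j)%:E =
     \int[m2]_(x in cube b) (\prod_(j < k) tnth x j ^+ r j)%:E)%E).

Let integrable_bounded (m : {measure set U -> \bar R}) (f : U -> R) (M : R) :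
  (m setT < +oo)%E -> measurable_fun setT f ->
  (forall x, cube b x -> `|f x| <= M) -> m.-integrable (cube b) (fun x => (f x)%:E).
Proof.
move=> fin mf fM; apply: (measurable_bounded_integrable (f := f)).
- exact: measurable_cube.
- apply: le_lt_trans fin; apply: le_measure; rewrite ?inE//.
  exact: measurable_cube.
- exact: measurable_funTS.
- exists M; split; first exact: num_real.
  by move=> y My x cx; exact: le_trans (fM x cx) (ltW My).
Qed.

Let measurable_monomial (r : 'I_k -> nat) :
  measurable_fun setT (fun x : U => \prod_(j < k) tnth x j ^+ r j).
Proof.
by apply: measurable_prod => j _; apply: measurable_funX; exact: measurable_tnth.
Qed.

Lemma integral_poly (p : 'I_k -> {poly R}) :
  (\int[m1]_(x in cube b) (\prod_(j < k) (p j).[tnth x j])%:E =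
   \int[m2]_(x in cube b) (\prod_(j < k) (p j).[tnth x j])%:E)%E.
Proof.
pose S := \max_(j < k) size (p j).
have pE x : \prod_(j < k) (p j).[tnth x j] =
    \sum_(r : {ffun 'I_k -> 'I_S}) (\prod_(j < k) (p j)`_(r j)) *
      \prod_(j < k) tnth x j ^+ r j.
  under eq_bigr => j _.
    rewrite (horner_coef_wide _ (leq_bigmax (F := fun j => size (p j)) j)).
    over.
  rewrite bigA_distr_bigA; apply: eq_bigr => r _.
  by rewrite big_split.
have int (m : {measure set U -> \bar R}) (r : {ffun 'I_k -> 'I_S}) :
      (m setT < +oo)%E -> m.-integrable (cube b) (fun x => (\prod_(j < k) tnth x j ^+ r j)%:E).
  move=> fin; apply: (@integrable_bounded m
    (fun x => \prod_(j < k) tnth x j ^+ (r j : nat)) (\prod_(j < k) b ^+ r j)) => //.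
  move=> x cx; rewrite normr_prod ler_prod// => j _.
  rewrite normr_ge0 normrX lerXn2r ?nnegrE// ?(ltW b0)//.
  by have /andP[h0 h1] := cx j; rewrite ger0_norm.
have lin (m : {measure set U -> \bar R}) : (m setT < +oo)%E ->
   (\int[m]_(x in cube b) (\prod_(j < k) (p j).[tnth x j])%:E =
   \sum_(r : {ffun 'I_k -> 'I_S}) (\prod_(j < k) (p j)`_(r j))%:E *
      \int[m]_(x in cube b) (\prod_(j < k) tnth x j ^+ r j)%:E)%E.
  move=> fin; rewrite (eq_integral (fun x : U => \sum_(r : {ffun 'I_k -> 'I_S})
    ((\prod_(j < k) (p j)`_(r j))%:E * (\prod_(j < k) tnth x j ^+ r j)%:E))%E).
    rewrite integral_sum//; last 2 first.
    - exact: measurable_cube.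
    - by move=> r; apply: integrableZl; [exact: measurable_cube|exact: int].
    apply: eq_bigr => r _; rewrite integralZl//; first exact: measurable_cube.
    exact: int.
  move=> x _; rewrite pE -sumEFin; apply: eq_bigr => r _.
  by rewrite EFinM.
by rewrite !lin//; apply: eq_bigr => r _; rewrite moments.
Qed.

(** Sends c to 1/2 and the points within M of c into [0, 1], where [soft_threshold] is
    controlled. *)
Let shift (M c : R) (x : R) : R := 2^-1 + (x - c) / (2 * M).

(** On the cube, the indicator of an orthant is the limit of products of one-variable polynomials
    with values in [0, 1]; their integrals agree by [integral_poly]. *)
Lemma measure_orthant_eq (c : 'I_k -> R) : m1 (orthant c) = m2 (orthant c).
Proof.
(* One M for all coordinates: |x_j - c_j| <= M on the cube. *)
pose M := b + \sum_(j < k) `|c j|.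
have M0 : 0 < M by rewrite ltr_pwDl// sumr_ge0.
have cM j : `|c j| <= M - b.
  by rewrite /M addrC addKr (bigD1 j)//= lerDl sumr_ge0.
pose F n (x : U) := \prod_(j < k) soft_threshold n (shift M (c j) (tnth x j)).
have sh01 x j : cube b x -> 0 <= shift M (c j) (tnth x j) <= 1.
  move=> /(_ j) /andP[x0 xb]; have := cM j; rewrite ler_norml => /andP[h1 h2].
  have M20 : 0 < 2 * M by rewrite mulr_gt0.
  apply/andP; split; rewrite /shift.
    rewrite -lerBlDl sub0r ler_pdivlMr// mulNr mulrA mulVf// mul1r; lra.
  rewrite -lerBrDl ler_pdivrMr//; lra.
have F01 n x : cube b x -> 0 <= F n x <= 1.
  move=> cx; rewrite prodr_ge0 /=; last first.
    by move=> j _; case/andP: (soft_threshold_01 n (sh01 x j cx)).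
  by apply: prodr_ile1 => j _; exact: soft_threshold_01 (sh01 x j cx).
pose p n j : {poly R} :=
  (1 - ((2^-1)%:P + ('X - (c j)%:P) * ((2 * M)^-1)%:P) ^+ n) ^+ (n * 2 ^ n).
have FE n x : F n x = \prod_(j < k) (p n j).[tnth x j].
  by apply: eq_bigr => j _; rewrite /p !hornerE.
have mF n : measurable_fun setT (F n).
  apply: measurable_prod => j _; rewrite /soft_threshold /shift.
  apply: measurable_funX; apply: measurable_funB => //; apply: measurable_funX.
  apply: measurable_funD => //; apply: measurable_funM => //.
  by apply: measurable_funB => //; exact: measurable_tnth.
have cvF x : cube b x -> (EFin \o F ^~ x) @ \oo --> (\1_(orthant c) x)%:E.
  move=> cx; apply: cvg_EFin; first exact: nearW.
  have -> : \1_(orthant c) x = \prod_(j < k) (shift M (c j) (tnth x j) < 2^-1)%R%:R :> R.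
    have lt j : (shift M (c j) (tnth x j) < 2^-1) = (tnth x j < c j).
      by rewrite /shift gtrDl pmulr_llt0 ?invr_gt0 ?mulr_gt0// subr_lt0.
    rewrite indicE; case: (boolP (x \in _)) => [|].
      by rewrite inE => h; rewrite big1// => j _; rewrite lt h.
    rewrite notin_setE => /existsNP[j /negP nj].
    by rewrite (bigD1 j)//= lt (negbTE nj) mul0r.
  have : forall (s : seq 'I_k), (fun n => \prod_(j <- s) soft_threshold n (shift M (c j) (tnth x j)))
      @ \oo --> \prod_(j <- s) ((shift M (c j) (tnth x j) < 2^-1)%R%:R : R).
    elim=> [|j s IH].
      rewrite big_nil; under eq_fun do rewrite big_nil; exact: cvg_cst.
    rewrite big_cons; under eq_fun do rewrite big_cons.
    by apply: cvgM => //; apply: cvg_soft_threshold; exact: sh01.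
  exact.
have lim (m : {measure set U -> \bar R}) : (m setT < +oo)%E -> m (~` cube b) = 0%E ->
    (\int[m]_(x in cube b) (F n x)%:E)%E @[n --> \oo] --> m (orthant c).
  move=> fin mcube.
  have -> : m (orthant c) = (\int[m]_(x in cube b) (\1_(orthant c) x)%:E)%E.
    rewrite integral_indic//; [|exact: measurable_cube|exact: measurable_orthant].
    rewrite -[X in m X = _]setIT -(setUv (cube b)) setIUr measureU.
    - rewrite [X in (_ + X)%E](_ : _ = 0%E) ?adde0//.
      apply: (subset_measure0 _ _ _ mcube) => //.
      + apply: measurableI; first exact: measurable_orthant.
        by apply: measurableC; exact: measurable_cube.
      + by apply: measurableC; exact: measurable_cube.
    - by apply: measurableI; [exact: measurable_orthant|exact: measurable_cube].
    - apply: measurableI; first exact: measurable_orthant.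
      by apply: measurableC; exact: measurable_cube.
    - by rewrite setIACA setICr setI0.
  have mFn n : measurable_fun (cube b) (fun x => (F n x)%:E).
    by apply: measurable_funTS; apply/measurable_EFinP; exact: mF.
  have mI : measurable_fun (cube b) (fun x => (\1_(orthant c) x)%:E : \bar R).
    apply: measurable_funTS; apply/measurable_EFinP; apply: measurable_indic.
    exact: measurable_orthant.
  have cvF' : {ae m, forall x, cube b x -> (EFin \o F ^~ x) @ \oo -->
      (\1_(orthant c) x)%:E} by apply: aeW => x; exact: cvF.
  have int1 : m.-integrable (cube b) (EFin \o cst 1).
    apply: (@integrable_bounded _ (cst 1) 1) => //.
    by move=> x _; rewrite /cst normr1.
  have bF : {ae m, forall x n, cube b x -> (`|(F n x)%:E| <= (EFin \o cst 1%R) x)%E}.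
    apply: aeW => x n cx; have /andP[h0 h1] := F01 n x cx.
    by rewrite abse_EFin lee_fin ger0_norm.
  by have [_ _] := dominated_convergence (measurable_cube b) mFn mI cvF' int1 bF.
apply: (cvg_unique (@ereal_hausdorff R) (lim m1 fin1 cube1)).
rewrite (_ : (fun _ => _) = fun n => (\int[m2]_(x in cube b) (F n x)%:E)%E).
  exact: lim.
apply/funext => n; under eq_integral do rewrite FE.
by rewrite integral_poly; under eq_integral do rewrite -FE.
Qed.

Lemma measure_moment_unique A : measurable A -> m1 A = m2 A.
Proof.
apply: (measure_unique (range orthant) (fun n => orthant (fun=> n%:R))).
- exact: measurable_orthantE.
- move=> _ _ [c1 _ <-] [c2 _ <-]; exists (fun j => Num.min (c1 j) (c2 j)) => //.
  apply/seteqP; split => x /=.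
    by move=> h; split => j; have := h j; rewrite lt_min => /andP[].
  by move=> [h1 h2] j; rewrite lt_min h1 h2.
- by move=> n; exists (fun=> n%:R).
- apply/seteqP; split => // x _.
  exists (\max_(j < k) (Num.truncn `|tnth x j|).+1) => // j.
  rewrite (le_lt_trans (ler_norm _))// (lt_le_trans (truncnS_gt _))// ler_nat.
  exact: (leq_bigmax (F := fun j => (Num.truncn `|tnth x j|).+1)).
- by move=> _ [c _ <-]; exact: measure_orthant_eq.
- move=> n; apply: le_lt_trans fin1; apply: le_measure; rewrite ?inE//.
  exact: measurable_orthant.
Qed.

End moment_uniqueness.

(** * The record index *)

Section record_event.
Context (R : realType) (d : measure_display) (T : measurableType d)
  (P : probability T R) (alpha : R) (V : nat -> nat -> R)
  (Pi : nat -> T -> seq {fset nat}).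
Hypotheses (alpha1 : alpha < 1) (hV : gibbs_coefficients alpha V)
  (hPi : exchangeable_gibbs_partition P alpha V Pi).

Let rp := egp_random_partition hPi.

Lemma ereal_inf_nat_min (A : set nat) x0 : A x0 -> (forall x, A x -> (x0 <= x)%N) ->
  ereal_inf [set (x%:R : R)%:E | x in A] = (x0%:R)%:E.
Proof.
move=> Ax0 hmin; apply/eqP; rewrite eq_le; apply/andP; split.
  by apply: ereal_inf_lbound; exists x0.
apply: le_ereal_inf_tmp => _ [x Ax <-].
by rewrite lee_fin ler_nat hmin.
Qed.

Lemma Pi_child n omega : (0 < n)%N ->
  Pi n.+1 omega \in children n (Pi n omega).
Proof.
move=> n0; rewrite -(rp_consistent rp n); apply: partition_of_child => //.
exact: (rp_partition rp).
Qed.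

Lemma nth_child n p q j x : classes_below n p -> q \in children n p ->
  x \in nth fset0 q j -> (x \in nth fset0 p j) \/ x = n.+1.
Proof.
move=> hp /child_cases[->|[l lp ->]].
  rewrite /add_class nth_rcons; case: ltnP => jp; first by left.
  by case: eqP => _; rewrite inE// => /eqP; right.
rewrite /join_class nth_set_nth /= /class_at /=.
case: eqP => [->|_]; last by left.
by rewrite !inE => /orP[/eqP|]; [right|left].
Qed.

(** An insertion adds only its own new element to a class, so an element at most n sits in its class
    from time n on. *)
Lemma nth_Pi_le n m j x omega : (0 < n)%N -> (x <= n <= m)%N ->
  x \in nth fset0 (Pi m omega) j -> x \in nth fset0 (Pi n omega) j.
Proof.
move=> n0 /andP[xn nm]; rewrite -(subnKC nm).
elim: (m - n)%N => [|L IH]; first by rewrite addn0.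
rewrite addnS => xm; apply: IH.
have nL0 : (0 < n + L)%N by rewrite addn_gt0 n0.
have hp := classes_below_partitions (mem_partitions hPi omega nL0).
case: (nth_child hp (Pi_child omega nL0) xm) => // xE.
by move: xn; rewrite xE leqNgt ltnS leq_addr.
Qed.

Lemma nth_Pi_bound m j x omega : x \in nth fset0 (Pi m omega) j ->
  (1 <= x <= m)%N /\ (j < size (Pi m omega))%N.
Proof.
move=> xm; have jm : (j < size (Pi m omega))%N.
  by rewrite ltnNge; apply/negP => h; rewrite nth_default in xm.
split => //; apply/(class_cover (rp_partition rp m omega)).
by exists (nth fset0 (Pi m omega) j) => //; exact: mem_nth.
Qed.

Definition starts_class n k q : bool :=
  (size (restriction n q) == k) && (size q == k.+1).

(** The infimum of a nonempty set of naturals is attained, and that of the empty set is infinite. If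
    n+1 is least in the class of position k (from 0), this class is absent at n and present at
    n+1. *)
Lemma record_indexP n k omega : (0 < n)%N ->
  record_index R Pi k.+1 omega = (n.+1%:R)%:E <-> starts_class n k (Pi n.+1 omega).
Proof.
move=> n0; rewrite /starts_class (rp_consistent rp).
have pn := mem_partitions hPi omega n0.
have hp := classes_below_partitions pn.
have qp := Pi_child omega n0.
rewrite /record_index; set A := \bigcup_m _; split.
  have [->|/set0P[x Ax]] := eqVneq A set0; last first.
    have ex : exists x, `[< A x >] by exists x; apply/asboolP.
    have [x0 /asboolP Ax0 hmin] := ex_minnP ex.
    rewrite (ereal_inf_nat_min Ax0) => [[/eqP]|y Ay]; last first.
      by apply: hmin; apply/asboolP.
    rewrite eqr_nat => /eqP x0E; rewrite x0E in Ax0 hmin.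
    case: Ax0 => m _ /= xm.
    have nm : (n.+1 <= m)%N by have [/andP[]] := nth_Pi_bound xm.
    have : n.+1 \in nth fset0 (Pi n.+1 omega) k.
      by apply: (nth_Pi_le _ _ xm) => //; rewrite leqnn.
    move=> /nth_Pi_bound[_ kq].
    have pk : (size (Pi n omega) <= k)%N.
      rewrite leqNgt; apply/negP => kp.
      have [A0 hA] := classes_belowP hp kp.
      have /fset0Pn[y yA] := A0.
      have yn : (y <= n)%N by have [/andP[]] := nth_Pi_bound yA.
      have /hmin : `[< A y >] by apply/asboolP; exists n.
      by rewrite ltnNge yn.
    have := size_child qp; case => sq; last first.
      by move: kq; rewrite sq ltnNge pk.
    by rewrite sq eqSS andbb eqn_leq pk -ltnS -sq.
  by rewrite image_set0 ereal_inf0.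
move=> /andP[/eqP pk /eqP qk].
have qE : Pi n.+1 omega = add_class n (Pi n omega).
  have [//|[j jp qE]] := child_cases qp.
  by move: qk; rewrite qE /join_class size_set_nth /= (maxn_idPr _)// pk => /n_Sn.
have Ak : A n.+1.
  exists n.+1 => //=; rewrite /class_at /= qE /add_class nth_rcons pk ltnn eqxx.
  by rewrite inE.
apply: (ereal_inf_nat_min Ak) => x [m _ /= xm].
rewrite ltnNge; apply/negP => xn.
have := nth_Pi_bound xm; rewrite /class_at /= in xm * => -[/andP[x1 xlem] km].
(* If n <= m, the element x would already be in that class at n. If m < n, the class present at m
   would persist, since the number of classes never decreases. Both contradict size k at n. *)
have [nm|mn] := leqP n m.
  have := @nth_Pi_le n m k x omega n0; rewrite xn nm => /(_ isT xm).
  by move=> /nth_Pi_bound[_]; rewrite pk ltnn.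
have := xm; have m0 : (0 < m)%N by exact: leq_trans x1 xlem.
suff mono : forall L, (size (Pi m omega) <= size (Pi (m + L)%N omega))%N.
  have := mono (n - m)%N; rewrite (subnKC (ltnW mn)) pk => h.
  by move: km; rewrite ltnNge h.
elim=> [|L IH]; first by rewrite addn0.
rewrite addnS (leq_trans IH)//.
have mL0 : (0 < m + L)%N by rewrite addn_gt0 m0.
by case: (size_child (Pi_child omega mL0)) => ->.
Qed.

(** Joins keep the number of classes, so only the child with a new singleton contributes, and its
    weight is that of its parent. *)
Lemma partition_sum_starts n k (F : seq nat -> R) : (0 < n)%N ->
  partition_sum alpha n.+1 (fun q => (starts_class n k q)%:R * F (age_freq q)) =
  partition_sum alpha n (fun p => (size p == k)%:R * F (rcons (age_freq p) 1%N)).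
Proof.
move=> n0; rewrite partition_sumS//; apply: eq_partition_sum => p pn.
have hp := classes_below_partitions pn.
rewrite /starts_class (restriction_child hp); last by rewrite mem_head.
rewrite size_rcons eqSS andbb age_freq_add big1 ?addr0// => j _.
rewrite (restriction_child hp); last first.
  by rewrite inE; apply/orP; right; apply/mapP; exists (j : nat) => //; rewrite mem_iota/=.
have -> : size (join_class n p j.+1) = size p.
  by rewrite /join_class size_set_nth /= (maxn_idPr _).
have -> : (size p == k) && (size p == k.+1) = false.
  by apply/negP => /andP[/eqP -> /eqP /n_Sn].
by rewrite !mul0r.
Qed.

Lemma prob_starts n k : (0 < n)%N ->
  P [set omega | starts_class n k (Pi n.+1 omega)] =
  (V n.+1 k.+1 * partition_sum alpha n (fun p => (size p == k)%:R))%:E.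
Proof.
move=> n0; set E := [set _ | _].
have indE : (fun omega => (starts_class n k (Pi n.+1 omega))%:R) = \1_E :> (T -> R).
  apply/funext => omega; rewrite indicE; congr (nat_of_bool _)%:R; apply/idP/idP.
    by move=> h; rewrite mem_set.
  by rewrite inE.
have mE : measurable E.
  rewrite (_ : E = (\1_E : T -> R) @^-1` [set 1]).
    rewrite -[X in measurable X]setTI -indE.
    exact: (measurable_fun_Pi hPi (fun q => (starts_class n k q)%:R)).
  apply/seteqP; split => x /=; rewrite indicE.
    by move=> h; rewrite mem_set.
  by case: (boolP (x \in E)) => [|_ /eqP]; rewrite ?inE// eq_sym oner_eq0.
rewrite -[E]setIT -integral_indic//.
transitivity (\int[P]_omega ((starts_class n k (Pi n.+1 omega))%:R)%:E)%E.
  by apply: eq_integral => x _; rewrite -indE.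
rewrite (expectation_partition alpha1 hV hPi (fun q => (starts_class n k q)%:R))//.
congr EFin; transitivity (partition_sum alpha n.+1 (fun q =>
  (starts_class n k q)%:R * (fun s => V n.+1 (size s)) (age_freq q))).
  by apply: eq_partition_sum => q _; rewrite size_age_freq.
rewrite (partition_sum_starts k (fun s => V n.+1 (size s)) n0) -partition_sumZ.
apply: eq_partition_sum => p pn.
rewrite size_rcons size_age_freq mulrC.
by case: eqP => [->//|]; rewrite !mulr0.
Qed.

Lemma measurable_starts n k : (0 < n)%N ->
  measurable [set omega | starts_class n k (Pi n.+1 omega)].
Proof.
move=> n0; rewrite (_ : [set _ | _] = (fun omega =>
    (starts_class n k (Pi n.+1 omega))%:R : R) @^-1` [set 1]).
  rewrite -[X in measurable X]setTI.
  exact: (measurable_fun_Pi hPi (fun q => (starts_class n k q)%:R)).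
apply/seteqP; split => x /=; first by move=> ->.
by case: (starts_class _ _ _) => // /eqP; rewrite eq_sym oner_eq0.
Qed.

Lemma sampling_formulaE (m : seq nat) : all (leq 1) m ->
  sampling_formula alpha V m =
  (count_formula m)%:R * V (sumn m) (size m) * weight alpha m.
Proof.
move=> m0; rewrite /sampling_formula count_formulaE//.
by congr (_ * _); apply: eq_bigr => b _; rewrite pochhammer_rising// subr_gt0.
Qed.

Lemma prob_age_freq n (m : seq nat) : (0 < n)%N -> all (leq 1) m -> sumn m = n ->
  P [set omega | age_freq (Pi n omega) = m] = (sampling_formula alpha V m)%:E.
Proof.
move=> n0 m0 mn; set E := [set _ | _].
have indE : (fun omega => (age_freq (Pi n omega) == m)%:R) = \1_E :> (T -> R).
  apply/funext => omega; rewrite indicE; congr (nat_of_bool _)%:R; apply/idP/idP.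
    by move=> /eqP h; rewrite mem_set.
  by rewrite inE => /eqP.
have mE : measurable E.
  rewrite (_ : E = (\1_E : T -> R) @^-1` [set 1]).
    rewrite -[X in measurable X]setTI -indE.
    exact: (measurable_fun_Pi hPi (fun q => (age_freq q == m)%:R)).
  apply/seteqP; split => x /=; rewrite indicE.
    by move=> h; rewrite mem_set.
  by case: (boolP (x \in E)) => [|_ /eqP]; rewrite ?inE// eq_sym oner_eq0.
rewrite -[E]setIT -integral_indic//.
transitivity (\int[P]_omega ((age_freq (Pi n omega) == m)%:R)%:E)%E.
  by apply: eq_integral => x _; rewrite -indE.
rewrite (expectation_partition alpha1 hV hPi (fun q => (age_freq q == m)%:R))//.
congr EFin; transitivity (partition_sum alpha n (fun q =>
  (age_freq q == m)%:R * (fun s => V n (size s)) (age_freq q))).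
  by apply: eq_partition_sum => q _; rewrite size_age_freq.
by rewrite (partition_sum_age_freq _ (fun s => V n (size s)))// sampling_formulaE// mn.
Qed.

End record_event.

(** * Generalized Stirling numbers and the explicit law of the record index *)

Section generalized_stirling.
Context (R : realType).
Implicit Types a : R.

(** For a = 0 the weights are products of (n_j - 1)!, and these are the unsigned Stirling numbers of
    the first kind. *)
Definition stirling a n k : R := partition_sum a n (fun p => (size p == k)%:R).

Lemma stirlingS a n k : (0 < n)%N ->
  stirling a n.+1 k.+1 = stirling a n k + (n%:R - a * k.+1%:R) * stirling a n k.+1.
Proof.
move=> n0; rewrite /stirling partition_sumS// -partition_sumZ -partition_sumD.
apply: eq_partition_sum => p pn; rewrite size_rcons eqSS; congr (_ + _).
rewrite (eq_bigr (fun j : 'I_(size p) => (size p == k.+1)%:R *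
    ((class_size p j)%:R - a))); last first.
  by move=> j _; rewrite /join_class size_set_nth /= (maxn_idPr _).
rewrite -mulr_sumr mulrC; case: eqP => [pk|_]; last by rewrite !mulr0.
rewrite !mulr1 sumrB sumr_const card_ord pk mulr_natr; congr (_ - _).
rewrite -natr_sum; congr (_%:R); rewrite -(sumn_age_freq pn) sumnE.
by rewrite (big_nth 0%N) size_age_freq pk big_mkord.
Qed.

Lemma stirling_n0 a n : (0 < n)%N -> stirling a n 0 = 0.
Proof.
move=> n0; rewrite /stirling /partition_sum big_seq big1// => p pn.
by rewrite gtn_eqF ?mul0r// (size_partitions_gt0 n0 pn).
Qed.

Lemma stirling1 a k : stirling a 1 k = (k == 1%N)%:R.
Proof.
by rewrite /stirling /partition_sum /= big_seq1 eq_sym /weight big_seq1 /= cardfs1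
  rising0 mulr1.
Qed.

Definition alternating_sum a n k : R :=
  \sum_(j < k.+1) (-1) ^+ (j + n) / (j`!%:R * (k - j)`!%:R) * falling (a * j%:R) n.

Lemma fallingS a n : falling a n.+1 = falling a n * (a - n%:R).
Proof. by rewrite /falling big_nat_recr. Qed.

(** The new factor of the falling factorial, with its sign, is n - a j = (n - a (k+1)) + a (k+1-j);
    in the second part k+1-j cancels against (k+1-j)! and removes the term j = k+1. *)
Lemma alternating_sumS a n k :
  alternating_sum a n.+1 k.+1 =
  (n%:R - a * k.+1%:R) * alternating_sum a n k.+1 + a * alternating_sum a n k.
Proof.
pose G j : R := a * (k.+1 - j)%:R * ((-1) ^+ (j + n) / (j`!%:R * (k.+1 - j)`!%:R) *
    falling (a * j%:R) n).
have -> : a * alternating_sum a n k = \sum_(j < k.+2) G j.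
  rewrite [RHS]big_ord_recr /= {2}/G subnn mulr0 mul0r addr0 mulr_sumr.
  apply: eq_bigr => j _; have jk : (j <= k)%N by rewrite -ltnS.
  rewrite /G subSn// factS natrM; field.
  by rewrite -(natrD _ 1) !pnatr_eq0 -!lt0n !fact_gt0.
rewrite /alternating_sum mulr_sumr -big_split /=; apply: eq_bigr => j _.
have jk : (j <= k.+1)%N by rewrite -ltnS.
by rewrite /G fallingS addnS exprS natrB//; ring.
Qed.

(** Up to 1/k!, this is the binomial expansion of (1 - 1)^k. *)
Lemma alternating_sum0 a k : alternating_sum a 0 k = (k == 0%N)%:R.
Proof.
rewrite /alternating_sum.
have -> : \sum_(j < k.+1) (-1) ^+ (j + 0) / (j`!%:R * (k - j)`!%:R) * falling (a * j%:R) 0 =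
    k`!%:R^-1 * (1 - 1 : R) ^+ k.
  rewrite exprBn mulr_sumr; apply: eq_bigr => j _.
  have jk : (j <= k)%N by rewrite -ltnS.
  rewrite addn0 /falling big_geq// mulr1 !expr1n !mulr1.
  have := congr1 (fun x => x%:R : R) (bin_fact jk); rewrite !natrM => <-.
  rewrite -[_ *+ 'C(k, j)]mulr_natr; field.
  by rewrite !pnatr_eq0 -!lt0n !fact_gt0 bin_gt0.
rewrite subrr expr0n; case: k => [|k]; last by rewrite mulr0.
by rewrite fact0 invr1 mulr1.
Qed.

Lemma alternating_sum_n0 a n : (0 < n)%N -> alternating_sum a n 0 = 0.
Proof.
case: n => // n _; rewrite /alternating_sum big_ord_recr big_ord0 /= add0r mulr0.
by rewrite /falling big_nat_recl// subrr mul0r mulr0.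
Qed.

Lemma stirlingE a n k : a != 0 -> (0 < n)%N ->
  stirling a n k = a ^- k * alternating_sum a n k.
Proof.
move=> a0; case: n => // n _.
elim: n k => [|n IH] [|k].
- by rewrite stirling_n0// alternating_sum_n0// mulr0.
- rewrite stirling1 alternating_sumS !alternating_sum0 mulr0 add0r eqSS.
  case: eqP => [->|_]; last by rewrite !mulr0.
  by rewrite expr1 mulr1 mulVf.
- by rewrite stirling_n0// alternating_sum_n0// mulr0.
rewrite stirlingS// !IH (alternating_sumS a n.+1) mulrDr exprS; field.
by rewrite a0 expf_neq0.
Qed.

Lemma record_factorE a k i : a != 0 -> (0 < k + i)%N ->
  record_factor k.+1 i a = stirling a (k + i) k.
Proof.
move=> a0 ki; rewrite stirlingE// /record_factor /alternating_sum /= big_mkord.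
congr (_ * _); apply: eq_bigr => j _.
by rewrite !addnS !addSn /= subSS addnA.
Qed.

Lemma continuous_stirling n k : continuous (fun a : R => stirling a n k).
Proof.
move=> x; suff : stirling a n k @[a --> x] --> stirling x n k by [].
have cR b : rising (1 - a) b @[a --> x] --> rising (1 - x) b.
  elim: b => [|b IH].
    by rewrite rising0; under eq_fun do rewrite rising0; exact: cvg_cst.
  rewrite risingS; under eq_fun do rewrite risingS.
  apply: cvgM => //; apply: cvgD; last exact: cvg_cst.
  by apply: cvgB; [exact: cvg_cst|exact: cvg_id].
have cW s : weight a s @[a --> x] --> weight x s.
  rewrite /weight; elim: s => [|b s IH].
    by rewrite big_nil; under eq_fun do rewrite big_nil; exact: cvg_cst.
  by rewrite big_cons; under eq_fun do rewrite big_cons; exact: cvgM.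
rewrite /stirling /partition_sum; elim: (partitions n) => [|p s IH].
  by rewrite big_nil; under eq_fun do rewrite big_nil; exact: cvg_cst.
rewrite big_cons; under eq_fun do rewrite big_cons.
by apply: cvgD => //; apply: cvgM; [exact: cvg_cst|exact: cW].
Qed.

(** The factor a^-k is singular at 0, but for a != 0 the expression equals a partition sum, which is
    polynomial in [a]. *)
Lemma record_factor_cvg0 k i : (0 < k + i)%N ->
  record_factor k.+1 i a @[a --> (0 : R)^'] --> stirling 0 (k + i) k.
Proof.
move=> ki.
have h : stirling a (k + i) k @[a --> (0 : R)^'] --> stirling 0 (k + i) k.
  by apply: cvg_within_filter; exact: continuous_stirling.
apply: cvg_trans h; apply: near_eq_cvg; near=> a; rewrite record_factorE//.
by near: a; exact: nbhs_dnbhs_neq.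
Unshelve. all: by end_near. Qed.

End generalized_stirling.

(** * Mixtures of Dirichlet distributions *)

Section mixture.
Context (R : realType) (alpha : R) (K i : nat).
Hypothesis alpha1 : alpha < 1.
Local Notation LI := lebesgue_integral_tuple.
Local Notation I := (K.-tuple 'I_(K.+1 + i)).

Definition freqs (m : I) : seq nat := [seq val b | b <- m].

Definition admissible (m : I) : bool :=
  all (fun b : 'I_(K.+1 + i) => (0 < b)%N) m && (sumn (freqs m) == (K + i)%N).

(** The sampling formula without its factor V, which is the same for all admissible [m]. *)
Definition mixture_weight (m : I) : R :=
  (count_formula (freqs m))%:R * weight alpha (freqs m).

Definition mixture_mass : R := \sum_(m | admissible m) mixture_weight m.

(* The K-th parameter, beyond the end of freqs m, is 1 - alpha. *)
Definition param (m : I) (j : nat) : R := (nth 1%N (freqs m) j)%:R - alpha.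

(** The sum of the Dirichlet parameters, the same for every admissible [m]. It is also n - alpha k
    for n = K+i+1 and k = K+1, the base of the rising factors in [expectation_freq_sum_power]; the
    cancellation of moments rests on this coincidence. *)
Definition total_param : R := (K + i).+1%:R - alpha * K.+1%:R.

Lemma size_freqs m : size (freqs m) = K. Proof. by rewrite size_map size_tuple. Qed.

Lemma freqs_gt0 m : admissible m -> all (leq 1) (freqs m).
Proof. by move=> /andP[m0 _]; rewrite all_map; apply: sub_all m0. Qed.

Lemma sumn_freqs m : admissible m -> sumn (freqs m) = (K + i)%N.
Proof. by move=> /andP[_ /eqP]. Qed.

Lemma mixture_weight_ge0 m : 0 <= mixture_weight m.
Proof. by rewrite mulr_ge0// ltW// weight_gt0. Qed.

Lemma param_gt0 m j : admissible m -> 0 < param m j.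
Proof.
move=> /freqs_gt0 m0; rewrite subr_gt0 (lt_le_trans alpha1)// ler1n.
have [jm|jm] := ltnP j (size (freqs m)); last by rewrite nth_default.
exact: (allP m0) _ (mem_nth _ jm).
Qed.

Lemma paramK m : param m K = 1 - alpha.
Proof. by rewrite /param nth_default ?size_freqs. Qed.

Lemma total_paramE m : admissible m ->
  \sum_(j < K) param m j + (1 - alpha) = total_param.
Proof.
move=> hm; rewrite /param sumrB sumr_const card_ord -natr_sum.
have -> : (\sum_(j < K) nth 1 (freqs m) j)%N = (K + i)%N.
  by rewrite -(sumn_freqs hm) sumnE (big_nth 1%N) size_freqs big_mkord.
by rewrite /total_param -!natr1 -mulr_natr; ring.
Qed.

Lemma total_param_gt0 : 0 < total_param.
Proof. by apply: gibbs_denom_gt0 => //=; rewrite ltnS leq_addr. Qed.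

Definition dirichlet_const (m : I) : R :=
  Gamma total_param / ((\prod_(j < K) Gamma (param m j)) * Gamma (1 - alpha)).

Lemma dirichlet_const_ge0 m : admissible m -> 0 <= dirichlet_const m.
Proof.
move=> hm; rewrite divr_ge0// ?ltW ?Gamma_gt0 ?total_param_gt0//.
rewrite mulr_gt0 ?Gamma_gt0 ?subr_gt0//.
by apply: prodr_gt0 => j _; rewrite Gamma_gt0// param_gt0.
Qed.

Definition mixture_density (u : K.-tuple R) : R := mixture_mass^-1 *
  \sum_(m | admissible m) mixture_weight m *
    (dirichlet_const m * dirichlet_kernel (param m) (1 - alpha) 1 u).

Lemma mixture_mass_ge0 : 0 <= mixture_mass.
Proof. by apply: sumr_ge0 => m _; exact: mixture_weight_ge0. Qed.

Lemma mixture_density_ge0 u : 0 <= mixture_density u.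
Proof.
apply: mulr_ge0; first by rewrite invr_ge0 mixture_mass_ge0.
apply: sumr_ge0 => m hm; apply: mulr_ge0; first exact: mixture_weight_ge0.
by apply: mulr_ge0; [exact: dirichlet_const_ge0|exact: dirichlet_kernel_ge0].
Qed.

Lemma measurable_mixture_density : measurable_fun setT mixture_density.
Proof.
apply: measurable_funM => //.
rewrite (_ : (fun _ => _) = fun u : K.-tuple R => \sum_(m : I) if admissible m then
    mixture_weight m * (dirichlet_const m * dirichlet_kernel (param m) (1 - alpha) 1 u)
    else 0); last by apply/funext => u; rewrite big_mkcond.
apply: measurable_sum => m; case: (admissible m) => //.
apply: measurable_funM => //; apply: measurable_funM => //.
exact: measurable_dirichlet_kernel.
Qed.

Definition simplex_point (u : K.-tuple R) : K.+1.-tuple R :=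
  [tuple (rcons u (1 - \sum_(b <- u) b))`_j | j < K.+1].

Definition scale_tuple (w : R) (x : K.+1.-tuple R) : K.+1.-tuple R :=
  [tuple w * tnth x j | j < K.+1].

Lemma tnth_simplex_point u (j : 'I_K.+1) : tnth (simplex_point u) j =
  if (j < K)%N then u`_j else 1 - \sum_(b <- u) b.
Proof.
rewrite tnth_mktuple nth_rcons size_tuple; case: ltnP => // Kj.
by rewrite eqn_leq Kj -ltnS ltn_ord.
Qed.

Lemma sum_simplex_point u : \sum_(j < K.+1) tnth (simplex_point u) j = 1.
Proof.
rewrite big_ord_recr /= tnth_simplex_point /= ltnn (eq_bigr (fun j : 'I_K => tnth u j)).
  by rewrite big_tuple addrC subrK.
by move=> j _; rewrite tnth_simplex_point /= ltn_ord (tnth_nth 0).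
Qed.

Lemma measurable_simplex_point : measurable_fun setT simplex_point.
Proof.
apply/measurable_fun_tnthP => j.
rewrite (_ : _ \o _ = fun u : K.-tuple R => if (j < K)%N then u`_j else 1 - \sum_(b <- u) b).
  case: (j < K)%N; first exact: measurable_tuple_nth.
  by apply: measurable_funB => //; exact: measurable_tuple_sum.
by apply/funext => u; rewrite /= tnth_simplex_point.
Qed.

Lemma measurable_scale_tuple :
  measurable_fun setT (fun z : R * K.+1.-tuple R => scale_tuple z.1 z.2).
Proof.
apply/measurable_fun_tnthP => j.
rewrite (_ : _ \o _ = fun z : R * K.+1.-tuple R => z.1 * tnth z.2 j).
  apply: measurable_funM; first exact: measurable_fst.
  by apply: (measurableT_comp (measurable_tnth j)); exact: measurable_snd.
by apply/funext => z; rewrite /= tnth_mktuple.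
Qed.

Lemma mixture_density_support u : mixture_density u != 0 ->
  forall j, 0 <= tnth (simplex_point u) j <= 1.
Proof.
move=> gu; have [m hm km] : exists2 m, admissible m &
    dirichlet_kernel (param m) (1 - alpha) 1 u != 0.
  apply/exists_inP; apply: contraNT gu; rewrite negb_exists_in => /forall_inP h.
  rewrite /mixture_density big1 ?mulr0// => m /h; rewrite negbK => /eqP ->.
  by rewrite !mulr0.
have u0 (j : 'I_K) : 0 < u`_j.
  apply: contraNT km => uj; rewrite /dirichlet_kernel (bigD1 j)//= {1}/ppow.
  by rewrite (negbTE uj) !mul0r.
have s0 : 0 < 1 - \sum_(b <- u) b.
  apply: contraNT km => uj; rewrite /dirichlet_kernel [X in _ * X]/ppow.
  by rewrite (negbTE uj) mulr0.
have sumE : \sum_(b <- u) b = \sum_(j < K) u`_j.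
  by rewrite big_tuple; apply: eq_bigr => j _; rewrite (tnth_nth 0).
have su : 0 <= \sum_(b <- u) b by rewrite sumE sumr_ge0// => j _; exact/ltW.
move=> j; rewrite tnth_simplex_point; case: ltnP => jK.
  rewrite (ltW (u0 (Ordinal jK))) /=.
  have : u`_j <= \sum_(b <- u) b.
    rewrite sumE (bigD1 (Ordinal jK))//= lerDl sumr_ge0// => l _; exact/ltW.
  by lra.
by rewrite (ltW s0) /= lerBlDr lerDl.
Qed.

Definition mixture_moment (r : nat -> nat) : R := mixture_mass^-1 *
  \sum_(m | admissible m) mixture_weight m *
    (\prod_(j < K.+1) rising (param m j) (r j)).

Lemma dirichlet_kernelMX (a : nat -> R) b (r : nat -> nat) u :
  dirichlet_kernel a b 1 u * \prod_(j < K.+1) tnth (simplex_point u) j ^+ r j =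
  dirichlet_kernel (fun j => a j + (r j)%:R) (b + (r K)%:R) 1 u.
Proof.
rewrite /dirichlet_kernel big_ord_recr /= tnth_simplex_point /= ltnn.
rewrite mulrACA ppowMX -big_split /=; congr (_ * _); apply: eq_bigr => j _.
by rewrite tnth_simplex_point /= ltn_ord ppowMX.
Qed.

(** Multiplying by a monomial raises the parameters, so each moment is a quotient of Gamma
    functions, that is of rising factorials; the common denominator comes out of the mixture. *)
Lemma LI_mixture_moment (r : nat -> nat) :
  LI (fun u : K.-tuple R => (mixture_density u *
    \prod_(j < K.+1) tnth (simplex_point u) j ^+ r j)%:E) =
  (mixture_moment r / rising total_param (\sum_(j < K.+1) r j))%:E.
Proof.
pose a m j := param m j + (r j)%:R.
pose b : R := 1 - alpha + (r K)%:R.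
have b0 : 0 < b by rewrite ltr_wpDr// subr_gt0.
transitivity (LI (fun u : K.-tuple R => \sum_(m | admissible m)
   ((mixture_mass^-1 * mixture_weight m * dirichlet_const m)%:E *
    (dirichlet_kernel (a m) b 1 u)%:E))%E).
  congr (LI _); apply/funext => u.
  rewrite -(eq_bigr _ (fun m _ => EFinM _ _)) sumEFin; congr EFin.
  rewrite /mixture_density -mulrA mulr_suml mulr_sumr; apply: eq_bigr => m _.
  by rewrite -dirichlet_kernelMX; ring.
have term m : admissible m ->
    LI (fun u : K.-tuple R => (mixture_mass^-1 * mixture_weight m * dirichlet_const m)%:E *
      (dirichlet_kernel (a m) b 1 u)%:E)%E =
    (mixture_mass^-1 * (mixture_weight m * \prod_(j < K.+1) rising (param m j) (r j)) /
      rising total_param (\sum_(j < K.+1) r j))%:E.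
  move=> hm; rewrite LIZl; last 3 first.
  - apply: mulr_ge0; last exact: dirichlet_const_ge0.
    by apply: mulr_ge0; [rewrite invr_ge0 mixture_mass_ge0|exact: mixture_weight_ge0].
  - by apply/measurable_EFinP; exact: measurable_dirichlet_kernel.
  - by move=> u; rewrite lee_fin dirichlet_kernel_ge0.
  have ap j : 0 < a m j by rewrite ltr_wpDr// param_gt0.
  rewrite dirichlet_integral// -EFinM; congr EFin.
  have -> : \sum_(j < K) a m j + b = total_param + (\sum_(j < K.+1) r j)%:R.
    rewrite /a big_split /= -natr_sum /b addrACA total_paramE//; congr (_ + _).
    by rewrite big_ord_recr /= natrD.
  have -> : \prod_(j < K) Gamma (a m j) = (\prod_(j < K) Gamma (param m j)) *
      \prod_(j < K) rising (param m j) (r j).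
    rewrite -big_split /=; apply: eq_bigr => j _.
    by rewrite /a Gamma_rising// param_gt0.
  have a1 : 0 < 1 - alpha by rewrite subr_gt0.
  rewrite /b (Gamma_rising _ a1) (Gamma_rising _ total_param_gt0).
  rewrite /ppow ltr01 powR1 mul1r.
  rewrite [\prod_(j < K.+1) _]big_ord_recr /= paramK /dirichlet_const.
  have h1 : Gamma total_param != 0 by rewrite gt_eqF// Gamma_gt0// total_param_gt0.
  have h2 : Gamma (1 - alpha) != 0 by rewrite gt_eqF// Gamma_gt0// subr_gt0.
  have h3 : \prod_(j < K) Gamma (param m j) != 0.
    by rewrite gt_eqF// prodr_gt0// => j _; rewrite Gamma_gt0// param_gt0.
  have h4 : rising total_param (\sum_(j < K.+1) r j) != 0.
    by rewrite gt_eqF// rising_gt0// total_param_gt0.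
  move: h4 h3 h2 h1.
  set G1 := Gamma _; set G2 := Gamma (1 - alpha); set G3 := \prod_(j < K) Gamma _.
  set G4 := rising total_param _; move: (mixture_mass^-1) => c h4 h3 h2 h1.
  by field; rewrite h1 h2 h3 h4.
transitivity (\sum_(m | admissible m)
    LI (fun u : K.-tuple R => (mixture_mass^-1 * mixture_weight m * dirichlet_const m)%:E *
      (dirichlet_kernel (a m) b 1 u)%:E)%E)%E; last first.
  rewrite (eq_bigr _ term) sumEFin -mulr_suml -mulr_sumr.
  by rewrite /mixture_moment.
(* Constants are known to be nonnegative for admissible [m] only; the others are set to 0, as
   [LI_sum] demands nonnegativity at every index. *)
pose g m (u : K.-tuple R) : \bar R := if admissible m then
  ((mixture_mass^-1 * mixture_weight m * dirichlet_const m)%:E *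
      (dirichlet_kernel (a m) b 1 u)%:E)%E else 0%E.
transitivity (LI (fun u => \sum_m g m u)%E).
  by congr (LI _); apply/funext => u; rewrite big_mkcond.
rewrite (@LI_sum _ _ _ _ g).
- rewrite [RHS]big_mkcond; apply: eq_bigr => m _; rewrite /g; case: (admissible m) => //.
  exact: LI0.
- move=> m; rewrite /g; case: (admissible m) => //; apply: measurable_funeM.
  by apply/measurable_EFinP; exact: measurable_dirichlet_kernel.
- move=> m u; rewrite /g; case: ifP => // hm; rewrite -EFinM lee_fin.
  apply: mulr_ge0; last exact: dirichlet_kernel_ge0.
  apply: mulr_ge0; last exact: dirichlet_const_ge0.
  by apply: mulr_ge0; [rewrite invr_ge0 mixture_mass_ge0|exact: mixture_weight_ge0].
Qed.

End mixture.

Section mixture_law.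
Context (R : realType) (alpha : R) (K i : nat).
Hypothesis alpha1 : alpha < 1.
Local Notation LI := lebesgue_integral_tuple.
Local Notation U := (K.+1.-tuple R).

(** A functional of [f] rather than of a set, in the form required of a Daniell functional. *)
Definition mixture_law (w : R) (f : U -> \bar R) : \bar R :=
  LI (fun u : K.-tuple R =>
    (mixture_density alpha i u)%:E * f (scale_tuple w (simplex_point u)))%E.

Let measurable_point :
  measurable_fun setT (fun z : R * K.-tuple R => scale_tuple z.1 (simplex_point z.2)).
Proof.
apply: (measurableT_comp (f := fun z : R * U => scale_tuple z.1 z.2)
  (g := fun z : R * K.-tuple R => (z.1, simplex_point z.2))).
  exact: measurable_scale_tuple.
apply: measurable_fun_pair; first exact: measurable_fst.
by apply: (measurableT_comp (@measurable_simplex_point R K)); exact: measurable_snd.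
Qed.

Let measurable_integrand (f : U -> \bar R) : measurable_fun setT f ->
  measurable_fun setT (fun z : R * K.-tuple R =>
    (mixture_density alpha i z.2)%:E * f (scale_tuple z.1 (simplex_point z.2)))%E.
Proof.
move=> mf; apply: emeasurable_funM.
  apply/measurable_EFinP.
  by apply: (measurableT_comp (@measurable_mixture_density R alpha K i)).
by apply: (measurableT_comp mf); exact: measurable_point.
Qed.

Let measurable_integrandr w (f : U -> \bar R) : measurable_fun setT f ->
  measurable_fun setT (fun u : K.-tuple R =>
    (mixture_density alpha i u)%:E * f (scale_tuple w (simplex_point u)))%E.
Proof.
move=> mf.
apply: (measurableT_comp (measurable_integrand mf) (pair1_measurable w)).
Qed.

Let integrand_ge0 w (f : U -> \bar R) (u : K.-tuple R) : (forall x, 0 <= f x)%E ->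
  (0 <= (mixture_density alpha i u)%:E * f (scale_tuple w (simplex_point u)))%E.
Proof. by move=> f0; rewrite mule_ge0// lee_fin mixture_density_ge0. Qed.

Lemma daniell_mixture_law w : daniell_functional (mixture_law w).
Proof.
split.
- by move=> f f0; apply: LI_ge0 => u; exact: integrand_ge0.
- move=> f g mf f0 mg g0; rewrite /mixture_law -LID.
  + by congr (LI _); apply/funext => u; rewrite ge0_muleDr.
  + exact: measurable_integrandr.
  + by move=> u; exact: integrand_ge0.
  + exact: measurable_integrandr.
  + by move=> u; exact: integrand_ge0.
- move=> c f c0 mf f0; rewrite /mixture_law -LIZl//.
  + by congr (LI _); apply/funext => u; rewrite muleCA.
  + exact: measurable_integrandr.
  + by move=> u; exact: integrand_ge0.
- move=> f g mf f0 mg fg; apply: LI_le.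
  + exact: measurable_integrandr.
  + by move=> u; exact: integrand_ge0.
  + exact: measurable_integrandr.
  + by move=> u; apply: lee_wpmul2l; rewrite ?lee_fin ?mixture_density_ge0.
- move=> f mf f0 ndf; rewrite /mixture_law -LI_monotone_convergence.
  + congr (LI _); apply/funext => u.
    rewrite -limeMl//; first by apply: ereal_nondecreasing_is_cvgn; exact: ndf.
    
  + by move=> n; exact: measurable_integrandr.
  + by move=> n u; exact: integrand_ge0.
  + move=> u m n mn; apply: lee_wpmul2l; first by rewrite lee_fin mixture_density_ge0.
    exact: ndf.
Qed.

Lemma measurable_mixture_law (f : U -> \bar R) : measurable_fun setT f ->
  (forall x, 0 <= f x)%E -> measurable_fun setT (fun w => mixture_law w f).
Proof.
move=> mf f0.
apply: (measurable_LI (f := fun z : R * K.-tuple R =>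
    (mixture_density alpha i z.2)%:E * f (scale_tuple z.1 (simplex_point z.2)))%E).
  exact: measurable_integrand.
by move=> z; exact: integrand_ge0.
Qed.

Definition monomial (r : nat -> nat) (x : U) : R := \prod_(j < K.+1) tnth x j ^+ r j.

Lemma measurable_monomial r : measurable_fun setT (monomial r).
Proof.
by apply: measurable_prod => j _; apply: measurable_funX; exact: measurable_tnth.
Qed.

Lemma monomial_scale r w x :
  monomial r (scale_tuple w x) = w ^+ (\sum_(j < K.+1) r j) * monomial r x.
Proof.
rewrite /monomial -prodrXr -big_split; apply: eq_bigr => j _.
by rewrite tnth_mktuple exprMn.
Qed.

Let scaled_in_cube w b (u : K.-tuple R) : 0 <= w <= b -> mixture_density alpha i u != 0 ->
  cube b (scale_tuple w (simplex_point u)).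
Proof.
move=> /andP[w0 wb] /mixture_density_support h j; have /andP[h0 h1] := h j.
by rewrite tnth_mktuple mulr_ge0//= (le_trans _ wb)// ler_piMr.
Qed.

(** Where the density is nonzero, the scaled point lies in the cube, so the indicator has no effect;
    homogeneity then takes out the power of w. *)
Lemma mixture_law_moment r w b : 0 <= w <= b ->
  mixture_law w (fun x => (monomial r x * \1_(cube b) x)%:E) =
  (w ^+ (\sum_(j < K.+1) r j) * (mixture_moment alpha K i r /
     rising (total_param alpha K i) (\sum_(j < K.+1) r j)))%:E.
Proof.
move=> wb; have w0 : 0 <= w by case/andP: wb.
rewrite EFinM -LI_mixture_moment// -LIZl; last 3 first.
- exact: exprn_ge0.
- apply/measurable_EFinP; apply: measurable_funM; first exact: measurable_mixture_density.
  by apply: (measurableT_comp (measurable_monomial r) (@measurable_simplex_point R K)).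
- move=> u; rewrite lee_fin; have [->|gu] := eqVneq (mixture_density alpha i u) 0.
    by rewrite mul0r.
  rewrite mulr_ge0 ?mixture_density_ge0// prodr_ge0// => j _; apply: exprn_ge0.
  by case/andP: (mixture_density_support gu j).
congr (LI _); apply/funext => u; rewrite -!EFinM; congr EFin.
have [->|gu] := eqVneq (mixture_density alpha i u) 0; first by rewrite !mul0r mulr0.
rewrite monomial_scale indicE mem_set; last exact: scaled_in_cube.
by rewrite mulr1 /monomial; ring.
Qed.

Lemma mixture_law_cubeC w b : 0 <= w <= b ->
  mixture_law w (fun x => (\1_(~` cube b) x)%:E) = 0%E.
Proof.
move=> wb; rewrite -[RHS](LI0 R K); congr (LI _); apply/funext => u.
have [->|gu] := eqVneq (mixture_density alpha i u) 0; first by rewrite mul0e.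
rewrite indicE memNset ?mule0//; apply; exact: scaled_in_cube.
Qed.

Lemma mixture_law1 w : 0 <= w -> mixture_mass alpha K i != 0 ->
  mixture_law w (fun=> 1%E) = 1%E.
Proof.
move=> w0 c0; have ww : 0 <= w <= w by rewrite w0 lexx.
transitivity (mixture_law w (fun x => (monomial (fun=> 0%N) x * \1_(cube w) x)%:E)).
  congr (LI _); apply/funext => u.
  have [->|gu] := eqVneq (mixture_density alpha i u) 0; first by rewrite !mul0e.
  rewrite indicE mem_set; last exact: scaled_in_cube.
  by rewrite /monomial big1 ?mulr1// => j _; rewrite expr0.
rewrite mixture_law_moment// big1// expr0 mul1r rising0 divr1 /mixture_moment.
rewrite (eq_bigr (@mixture_weight R alpha K i)) => [|m _]; last first.
  by rewrite big1 ?mulr1// => j _; rewrite rising0.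
by rewrite mulVf.
Qed.

End mixture_law.

Section cond_measure_law.
Context (R : realType) (alpha : R) (V : nat -> nat -> R) (K i : nat).
Hypotheses (alpha1 : alpha < 1) (hV : gibbs_coefficients alpha V) (K0 : (0 < K)%N).
Hypothesis pr0 : V (K + i).+1 K.+1 * mixture_mass alpha K i != 0.
Local Notation LI := lebesgue_integral_tuple.
Local Notation U := (K.+1.-tuple R).
Local Notation pr := (V (K + i).+1 K.+1 * mixture_mass alpha K i).
Local Notation I := (K.-tuple 'I_(K.+1 + i)).

Let params (m : I) := rcons [seq (val b)%:R - alpha | b <- m] (1 - alpha).

Let size_params m : size (params m) = K.+1.
Proof. by rewrite size_rcons size_map size_tuple. Qed.

Let nth_params m (j : 'I_K.+1) : (params m)`_j = param alpha m j.
Proof.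
rewrite nth_rcons size_map size_tuple; case: ltnP => jK.
  rewrite (nth_map (Ordinal (ltn0Sn (K + i)))) ?size_tuple// /param.
  by rewrite (nth_map (Ordinal (ltn0Sn (K + i)))) ?size_tuple.
have -> : nat_of_ord j = K by apply/eqP; rewrite eqn_leq jK -ltnS ltn_ord.
by rewrite eqxx paramK.
Qed.

Lemma dirichlet_pdfE m (y : seq R) : admissible m ->
  dirichlet_pdf (params m) y =
  dirichlet_const alpha m * \prod_(j < K.+1) y`_j `^ (param alpha m j - 1).
Proof.
move=> hm; rewrite /dirichlet_pdf; congr (_ * _); last first.
  by rewrite size_params; apply: eq_bigr => j _; rewrite nth_params.
rewrite /dirichlet_const; congr (Gamma _ / _).
  rewrite (big_nth 0) size_params big_mkord (eq_bigr (fun j : 'I_K.+1 => param alpha m j)) //.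
  by rewrite big_ord_recr /= paramK total_paramE.
rewrite (big_nth 0) size_params big_mkord.
rewrite (eq_bigr (fun j : 'I_K.+1 => Gamma (param alpha m j))).
  by rewrite big_ord_recr /= paramK.
by move=> j _; rewrite nth_params.
Qed.

(** [pr] is the value of P E. All V cancel: those of the sampling formula against V_(k+i-1,k-1),
    those of [pr] against V_(k+i,k). *)
Lemma cond_densityE w (x : U) :
  cond_density alpha V K.+1 i pr w x = w ^- K * ((mixture_mass alpha K i)^-1 *
  \sum_(m : I | admissible m) mixture_weight alpha m * (dirichlet_const alpha m *
    \prod_(j < K.+1) (tnth x j / w) `^ (param alpha m j - 1))).
Proof.
have := pr0; rewrite mulf_eq0 negb_or => /andP[V1 C0].
(* Otherwise the next coefficient, hence [pr], would vanish. *)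
have V0 : V (K + i)%N K != 0.
  apply: contraNneq V1 => V0; have Kn : (1 <= K <= K + i)%N by rewrite K0 leq_addr.
  by have [_ ->] := gibbs_succ_eq0 alpha1 hV Kn V0.
rewrite /cond_density /=.
transitivity (pr^-1 * (V (K.+1 + i) K.+1 / V (K + i) K) / w ^+ K *
  (V (K + i)%N K * \sum_(m : I | admissible m) mixture_weight alpha m * (dirichlet_const alpha m *
    \prod_(j < K.+1) (tnth x j / w) `^ (param alpha m j - 1)))).
  congr (_ * _); rewrite mulr_sumr; apply: eq_bigr => m hm.
  rewrite sampling_formulaE//; last exact: freqs_gt0.
  rewrite -/(freqs m) sumn_freqs// size_freqs -/(params m) dirichlet_pdfE//.
  rewrite (eq_bigr (fun j : 'I_K.+1 => (tnth x j / w) `^ (param alpha m j - 1))).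
    by rewrite /mixture_weight; set p := \prod_(_ < _) _; ring.
  by move=> j _; rewrite (nth_map 0) ?size_tuple// -tnth_nth.
set S := \sum_(_ | _) _; rewrite (_ : (K.+1 + i)%N = (K + i).+1)//.
by move: (w ^- K) => c; field; rewrite V0 V1 C0.
Qed.

Let affine_point (w : R) (t : K.-tuple R) : U :=
  [tuple (rcons t (w - \sum_(b <- t) b))`_j | j < K.+1].

Let tnth_affine_point w t (j : 'I_K.+1) : tnth (affine_point w t) j =
  if (j < K)%N then t`_j else w - \sum_(b <- t) b.
Proof.
rewrite tnth_mktuple nth_rcons size_tuple; case: ltnP => // Kj.
by rewrite eqn_leq Kj -ltnS ltn_ord.
Qed.

Let measurable_affine_point w : measurable_fun setT (affine_point w).
Proof.
apply/measurable_fun_tnthP => j.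
rewrite (_ : _ \o _ = fun t : K.-tuple R => if (j < K)%N then t`_j else w - \sum_(b <- t) b).
  case: (j < K)%N; first exact: measurable_tuple_nth.
  by apply: measurable_funB => //; exact: measurable_tuple_sum.
by apply/funext => t; rewrite /= tnth_affine_point.
Qed.

Let orthant0 : set U := [set x | forall j, 0 <= tnth x j].

Let measurable_orthant0 : measurable orthant0.
Proof.
rewrite (_ : orthant0 = \bigcap_(j in [set: 'I_K.+1]) [set x : U | 0 <= tnth x j]).
  apply: fin_bigcap_measurable => // j _.
  rewrite (_ : [set _ | _] = setT `&` (@tnth K.+1 R ^~ j) @^-1` `[0, +oo[%classic).
    exact: measurable_tnth.
  by apply/seteqP; split => x /=; rewrite in_itv/= ?andbT// => -[].
by apply/seteqP; split => x /= h j; [move=> _; exact: h|exact: h].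
Qed.

Let measurable_cond_density w :
  measurable_fun setT (fun x : U => cond_density alpha V K.+1 i pr w x).
Proof.
rewrite (_ : (fun _ => _) = fun x : U => w ^- K * ((mixture_mass alpha K i)^-1 *
  \sum_(m : I) if admissible m then mixture_weight alpha m * (dirichlet_const alpha m *
    \prod_(j < K.+1) (tnth x j / w) `^ (param alpha m j - 1)) else 0)); last first.
  by apply/funext => x; rewrite cond_densityE big_mkcond.
apply: measurable_funM => //; apply: measurable_funM => //.
apply: measurable_sum => m; case: (admissible m) => //.
apply: measurable_funM => //; apply: measurable_funM => //.
apply: measurable_prod => j _.
apply: (measurableT_comp (measurable_powR _)).
by apply: measurable_funM => //; exact: measurable_tnth.
Qed.

Let cond_density_ge0 w (x : U) : 0 <= w -> 0 <= cond_density alpha V K.+1 i pr w x.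
Proof.
move=> w0; rewrite cond_densityE; apply: mulr_ge0; first by rewrite invr_ge0 exprn_ge0.
apply: mulr_ge0; first by rewrite invr_ge0 mixture_mass_ge0.
apply: sumr_ge0 => m hm; apply: mulr_ge0; first exact: mixture_weight_ge0.
apply: mulr_ge0; first exact: dirichlet_const_ge0.
by apply: prodr_ge0 => j _; exact: powR_ge0.
Qed.

Let scale_simplex_point w (t : K.-tuple R) : w != 0 ->
  scale_tuple w (simplex_point (map_tuple ( *%R w^-1) t)) = affine_point w t.
Proof.
move=> w0; apply: eq_from_tnth => j; rewrite tnth_mktuple tnth_simplex_point tnth_affine_point.
case: ltnP => jK; first by rewrite (nth_map 0) ?size_tuple// mulVKf.
by rewrite big_map -mulr_sumr mulrBr mulr1 mulVKf.
Qed.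

(** The change of variables t = w u absorbs w^-(k-1) and moves the simplex of total w to the unit
    one. *)
Lemma cond_measureE w A : 0 < w -> measurable A ->
  cond_measure alpha V K.+1 i pr w A =
  mixture_law alpha i w (fun x : U => (\1_A x)%:E).
Proof.
move=> w0 mA; have wn0 : w != 0 by rewrite gt_eqF.
pose g (u : K.-tuple R) : \bar R := ((mixture_density alpha i u)%:E *
  (\1_A (scale_tuple w (simplex_point u)))%:E)%E.
have mg : measurable_fun setT g.
  apply/measurable_EFinP; apply: measurable_funM; first exact: measurable_mixture_density.
  apply: (measurableT_comp (f := (\1_A : U -> R))
    (g := fun u : K.-tuple R => scale_tuple w (simplex_point u))).
    exact: measurable_indic.
  apply: (measurableT_comp (f := fun z : R * U => scale_tuple z.1 z.2)
    (g := fun u : K.-tuple R => (w, simplex_point u))).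
    exact: measurable_scale_tuple.
  by apply: measurable_fun_pair => //; exact: measurable_simplex_point.
have measurable_scaling :
    measurable_fun setT (map_tuple ( *%R w^-1) : K.-tuple R -> K.-tuple R).
  apply/measurable_fun_tnthP => j.
  rewrite (_ : _ \o _ = fun t : K.-tuple R => w^-1 * tnth t j).
    by apply: measurable_funM => //; exact: measurable_tnth.
  by apply/funext => t; rewrite /= tnth_map.
have g0 u : (0 <= g u)%E.
  by rewrite mule_ge0// lee_fin// mixture_density_ge0.
have -> : mixture_law alpha i w (fun x : U => (\1_A x)%:E) =
    LI (fun t => (w ^- K)%:E * g (map_tuple ( *%R w^-1) t))%E.
  rewrite LIZl; last 3 first.
  - by rewrite invr_ge0 exprn_ge0// ltW.
  - exact: (measurableT_comp mg measurable_scaling).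
  - by move=> t; exact: g0.
  rewrite LI_scale ?invr_gt0// muleA -EFinM exprVn invrK mulVf ?expf_neq0// mul1e//.
transitivity (LI (fun t : K.-tuple R => (cond_density alpha V K.+1 i pr w (affine_point w t) *
   \1_(orthant0 `&` A) (affine_point w t))%:E)).
  congr (LI _); apply/funext => t /=.
  have -> : all (fun b => 0 <= b) (affine_point w t) = (affine_point w t \in orthant0).
    apply/idP/idP => [h|].
      rewrite inE => j; apply: (allP h); exact: mem_tnth.
    rewrite inE => h; apply/allP => x /tnthP[j ->]; exact: h.
  by rewrite indicE in_setI; case: ifP => _; rewrite ?mulr1 ?mulr0.
(* The integrands may differ on the boundary: a zero coordinate with exponent 0 contributes 1 to
   [dirichlet_pdf], where [ppow] gives 0. *)
apply: (eq_LI_ae wn0).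
- apply/measurable_EFinP; apply: measurable_funM.
    exact: (measurableT_comp (measurable_cond_density w) (measurable_affine_point w)).
  apply: (measurableT_comp (f := (\1_(orthant0 `&` A) : U -> R)) (g := affine_point w)).
    by apply: measurable_indic; exact: measurableI.
  exact: measurable_affine_point.
- by move=> t; rewrite lee_fin mulr_ge0// cond_density_ge0// ltW.
- by apply: measurable_funeM; exact: (measurableT_comp mg measurable_scaling).
- by move=> t; rewrite mule_ge0// lee_fin invr_ge0 exprn_ge0// ltW.
move=> t t0 tw; rewrite /g -!EFinM; congr EFin; rewrite scale_simplex_point//.
set x := affine_point w t; set u := map_tuple _ t.
(* Outside the orthant the left side is cut off by its indicator, the right side by the support of
   the density. *)
have [xO|nxO] := boolP (x \in orthant0); last first.
  rewrite indicE in_setI (negbTE nxO) mulr0.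
  have [->|gu] := eqVneq (mixture_density alpha i u) 0; first by rewrite mul0r mulr0.
  case/negP: nxO; rewrite inE => j; rewrite /x -(scale_simplex_point t wn0) tnth_mktuple.
  by rewrite mulr_ge0 ?(ltW w0)//; case/andP: (mixture_density_support gu j).
have x0 j : 0 < tnth x j.
  move: xO; rewrite inE => /(_ j); rewrite le_eqVlt => /orP[/eqP|//].
  rewrite tnth_affine_point; case: ltnP => jK => [tj|/esym/eqP].
    by move/allP: t0 => /(_ t`_j); rewrite mem_nth ?size_tuple// -tj eqxx => /(_ isT).
  by rewrite subr_eq0 eq_sym (negbTE tw).
rewrite cond_densityE indicE in_setI xO /= -!mulrA; congr (_ * _).
rewrite /mixture_density -?mulrA; congr (_ * (_ * _)).
apply: eq_bigr => m _; congr (_ * (_ * _)).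
rewrite /dirichlet_kernel big_ord_recr /= paramK.
have xw j : tnth x j / w = tnth (simplex_point u) j.
  by rewrite /x -(scale_simplex_point t wn0) tnth_mktuple mulrAC mulfV// mul1r.
have u0 j : 0 < tnth (simplex_point u) j by rewrite -xw divr_gt0.
congr (_ * _).
  apply: eq_bigr => j _; have := u0 (widen_ord (leqnSn K) j).
  by rewrite xw tnth_simplex_point /= ltn_ord /ppow => ->.
have := u0 ord_max; rewrite xw tnth_simplex_point /= ltnn /ppow => ->.
by [].
Qed.

End cond_measure_law.

(** * Disintegration *)

Section daniell_families.
Context (R : realType) (d d' : measure_display) (T : measurableType d)
  (U : measurableType d').
Local Open Scope ereal_scope.

Lemma daniell_eval (x : U) : daniell_functional (fun f : U -> \bar R => f x).
Proof. by split. Qed.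

(** Serves two families indexed by [omega]: evaluation at X, and the mixture law at W. *)
Lemma daniell_integral (mu : {measure set T -> \bar R}) (E : set T)
    (L : T -> (U -> \bar R) -> \bar R) : measurable E ->
  (forall omega, daniell_functional (L omega)) ->
  (forall f, measurable_fun setT f -> (forall x, 0 <= f x) ->
    measurable_fun setT (fun omega => L omega f)) ->
  daniell_functional (fun f => \int[mu]_(omega in E) L omega f).
Proof.
move=> mE dL mL.
have mLE f : measurable_fun setT f -> (forall x, 0 <= f x) ->
    measurable_fun E (fun omega => L omega f).
  by move=> mf f0; apply: measurable_funTS; exact: mL.
split.
- by move=> f f0; apply: integral_ge0 => omega _; exact: df_ge0 (dL omega) _ f0.
- move=> f g mf f0 mg g0; rewrite -ge0_integralD//.
  + by apply: eq_integral => omega _; exact: df_add.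
  + by move=> omega _; exact: df_ge0 (dL omega) _ f0.
  + exact: mLE.
  + by move=> omega _; exact: df_ge0 (dL omega) _ g0.
  + exact: mLE.
- move=> c f c0 mf f0; rewrite -ge0_integralZl_EFin//.
  + by apply: eq_integral => omega _; exact: df_scale.
  + by move=> omega _; exact: df_ge0 (dL omega) _ f0.
  + exact: mLE.
- move=> f g mf f0 mg fg; have g0 x : 0 <= g x := le_trans (f0 x) (fg x).
  apply: ge0_le_integral => //.
  + by move=> omega _; exact: df_ge0 (dL omega) _ f0.
  + exact: mLE.
  + exact: mLE.
  + by move=> omega _; exact: (df_le (dL omega)).
- move=> f mf f0 ndf.
  transitivity (\int[mu]_(omega in E) limn (fun n => L omega (f n))).
    by apply: eq_integral => omega _; exact: df_monotone.
  rewrite monotone_convergence//.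
  + by move=> n; exact: mLE.
  + by move=> n omega _; exact: df_ge0 (dL omega) _ (f0 n).
  + by move=> omega _ m n mn; apply: (df_le (dL omega)) => // x; exact: ndf.
Qed.

End daniell_families.

Section disintegration.
Context (R : realType) (d : measure_display) (T : measurableType d)
  (P : probability T R) (alpha : R) (V : nat -> nat -> R)
  (Pi : nat -> T -> seq {fset nat}) (K i : nat).
Hypotheses (alpha1 : alpha < 1) (hV : gibbs_coefficients alpha V)
  (hPi : exchangeable_gibbs_partition P alpha V Pi) (K0 : (0 < K)%N).
Local Notation U := (K.+1.-tuple R).
Local Notation n := (K + i)%N.
Local Notation C := (mixture_mass alpha K i).
Local Notation X := (limit_freq_vector R Pi K.+1).
Local Notation W := (limit_freq_sum R Pi K.+1).

Let E := [set omega | starts_class n K (Pi n.+1 omega)].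

Let n0 : (0 < n)%N. Proof. by rewrite addn_gt0 K0. Qed.

Let measurable_E : measurable E.
Proof. exact: (measurable_starts hPi K n0). Qed.

(** The entry 1 added at the end is the class just opened; it gives the last Dirichlet parameter 1 -
    alpha. *)
Lemma partition_sum_mixture (F : seq nat -> R) :
  partition_sum alpha n.+1 (fun q => (starts_class n K q)%:R * F (age_freq q)) =
  \sum_(m : K.-tuple 'I_(K.+1 + i) | admissible m)
    mixture_weight alpha m * F (rcons (freqs m) 1%N).
Proof.
rewrite partition_sum_starts//.
rewrite (partition_sum_tuple alpha K (fun s => F (rcons s 1%N)) n0 (N := (K.+1 + i)%N))//.
by apply: eq_bigr => m _; rewrite /mixture_weight mulrAC.
Qed.

Lemma mixture_massE : C = stirling alpha n K.
Proof.
rewrite /stirling.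
transitivity (partition_sum alpha n (fun p => (size p == K)%:R * (fun=> 1) (age_freq p))).
  rewrite (partition_sum_tuple alpha K (fun=> 1) n0 (N := (K.+1 + i)%N))//.
  by apply: eq_bigr => m _; rewrite mulr1.
by apply: eq_partition_sum => p _; rewrite mulr1.
Qed.

Let starts_eq0 q : size q != K.+1 -> (starts_class n K q)%:R = 0 :> R.
Proof. by rewrite /starts_class => /negbTE ->; rewrite andbF. Qed.

Lemma sum_limit_freq_vector omega : \sum_(j < K.+1) tnth (X omega) j = W omega.
Proof.
rewrite /limit_freq_sum big_add1 big_mkord; apply: eq_bigr => j _.
by rewrite tnth_mktuple.
Qed.

Lemma measurable_limit_freq_vector : measurable_fun setT X.
Proof.
apply/measurable_fun_tnthP => j.
rewrite (_ : _ \o _ = limit_freq R Pi j.+1); first exact: (measurable_limit_freq hPi).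
by apply/funext => omega; rewrite /= tnth_mktuple.
Qed.

Lemma measurable_limit_freq_sum : measurable_fun setT W.
Proof.
rewrite (_ : W = fun omega => \sum_(j < K.+1) limit_freq R Pi j.+1 omega).
  by apply: measurable_sum => j; exact: (measurable_limit_freq hPi).
by apply/funext => omega; rewrite /limit_freq_sum big_add1 big_mkord.
Qed.

Lemma limit_freq_sum_bounds omega : 0 <= W omega <= K.+1%:R.
Proof.
rewrite -sum_limit_freq_vector; apply/andP; split.
  by apply: sumr_ge0 => j _; rewrite tnth_mktuple; case/andP: (limit_freq_01 hPi j omega).
rewrite -[X in _ <= X%:R]card_ord -sumr_const ler_sum// => j _.
by rewrite tnth_mktuple; case/andP: (limit_freq_01 hPi j omega).
Qed.

Lemma limit_freq_vector_cube omega : cube K.+1%:R (X omega).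
Proof.
move=> j; have /andP[h0 h1] := limit_freq_01 hPi j omega.
by rewrite tnth_mktuple h0 (le_trans h1)// ler1n.
Qed.

Let integral_E (f : T -> R) :
  (\int[P]_(omega in E) (f omega)%:E =
   \int[P]_omega ((starts_class n K (Pi n.+1 omega))%:R * f omega)%:E)%E.
Proof.
rewrite integral_mkcond; apply: eq_integral => omega _.
rewrite /patch; case: ifPn => [|].
  by rewrite inE => /= ->; rewrite mul1r.
by rewrite notin_setE /= => /negP/negbTE ->; rewrite mul0r.
Qed.

Hypothesis C0 : C != 0.

Lemma moment_limit_freq (r : nat -> nat) s :
  (\int[P]_(omega in E) (monomial r (X omega) * W omega ^+ s)%:E =
  (C * mixture_moment alpha K i r * rising (total_param alpha K i + (\sum_(j < K.+1) r j)%:R) s *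
     V (n.+1 + \sum_(j < K.+1) r j + s) K.+1)%:E)%E.
Proof.
rewrite integral_E.
transitivity (\int[P]_omega ((starts_class n K (Pi n.+1 omega))%:R *
   (\prod_(j < K.+1) limit_freq R Pi j.+1 omega ^+ r j) * W omega ^+ s)%:E)%E.
  apply: eq_integral => omega _; congr EFin; rewrite -mulrA; congr (_ * (_ * _)).
  by apply: eq_bigr => j _; rewrite tnth_mktuple.
rewrite (@expectation_freq_sum_power _ _ _ _ _ _ _ alpha1 hV hPi K.+1 r s n.+1
   (fun q => (starts_class n K q)%:R))//; last by move=> p _; exact: starts_eq0.
congr EFin.
set v := V _ _; set c := rising (_ - _ + _) s.
pose F a := \prod_(l < K.+1) rising ((nth 0%N a l)%:R - alpha) (r l) * c * v.
rewrite (_ : partition_sum _ _ _ = partition_sum alpha n.+1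
  (fun q => (starts_class n K q)%:R * F (age_freq q)))// partition_sum_mixture.
have term (m : K.-tuple 'I_(K.+1 + i)) : admissible m -> mixture_weight alpha m * F (rcons (freqs m) 1%N) =
    mixture_weight alpha m * \prod_(j < K.+1) rising (param alpha m j) (r j) * c * v.
  move=> hm; rewrite /F !mulrA; congr (_ * _ * _); congr (_ * _).
  apply: eq_bigr => j _; congr (rising (_%:R - _) _).
  rewrite nth_rcons size_freqs; case: ltnP => jK.
    by apply: set_nth_default; rewrite size_freqs.
  have jE : nat_of_ord j = K by apply/eqP; rewrite eqn_leq jK andbT -ltnS ltn_ord.
  rewrite jE.
  by rewrite eqxx nth_default// size_freqs.
by rewrite (eq_bigr _ term) -!mulr_suml /mixture_moment mulVKf.
Qed.

(** The moment of X^r and that of W^N with N = |r| carry the same coefficient V; their quotient is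
    the Dirichlet moment c_r, and the mixture law at W has moment c_r W^N. *)
Lemma moment_given_starts (r : nat -> nat) :
  (\int[P]_(omega in E) (monomial r (X omega) * \1_(cube K.+1%:R) (X omega))%:E =
   \int[P]_(omega in E) mixture_law alpha i (W omega)
      (fun x : U => (monomial r x * \1_(cube K.+1%:R) x)%:E))%E.
Proof.
pose N := (\sum_(j < K.+1) r j)%N.
transitivity (\int[P]_(omega in E) (monomial r (X omega) * W omega ^+ 0)%:E)%E.
  by apply: eq_integral => omega _; rewrite indicE mem_set ?expr0//; exact: limit_freq_vector_cube.
rewrite moment_limit_freq rising0 mulr1 addn0.
set q := rising (total_param alpha K i) N.
have q0 : q != 0 by rewrite gt_eqF// rising_gt0// total_param_gt0.
transitivity ((mixture_moment alpha K i r / q)%:E *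
   \int[P]_(omega in E) (monomial (fun=> 0%N) (X omega) * W omega ^+ N)%:E)%E.
  rewrite moment_limit_freq -EFinM; congr EFin.
  have -> : (\sum_(j < K.+1) 0)%N = 0%N by rewrite big1.
  have -> : mixture_moment alpha K i (fun=> 0%N) = 1.
    rewrite /mixture_moment (eq_bigr (@mixture_weight R alpha K i)) => [|m _].
      by rewrite mulVf.
    by rewrite big1 ?mulr1// => j _; rewrite rising0.
  rewrite addr0 addn0 -/N -/q mulr1.
  rewrite [RHS]mulrA [C * q]mulrC [in RHS]mulrA divfK//.
  by rewrite [mixture_moment _ _ _ _ * C]mulrC.
have mom0 : 0 <= mixture_moment alpha K i r.
  rewrite mulr_ge0 ?invr_ge0 ?mixture_mass_ge0// sumr_ge0// => m hm.
  apply: mulr_ge0; first exact: mixture_weight_ge0.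
  by apply: prodr_ge0 => j _; rewrite ltW// rising_gt0// param_gt0.
rewrite -ge0_integralZl_EFin//.
- apply: eq_integral => omega _.
  rewrite (@mixture_law_moment _ _ K i alpha1 r _ _ (limit_freq_sum_bounds omega)) -EFinM.
  by rewrite /monomial big1 => [|j _]; rewrite ?expr0// mul1r mulrC.
- move=> omega _; rewrite lee_fin /monomial big1 => [|j _]; last by rewrite expr0.
  by rewrite mul1r exprn_ge0//; case/andP: (limit_freq_sum_bounds omega).
- apply: measurable_funTS; apply/measurable_EFinP; apply: measurable_funM.
    exact: (measurableT_comp (measurable_monomial _) measurable_limit_freq_vector).
  by apply: measurable_funX; exact: measurable_limit_freq_sum.
- by rewrite divr_ge0// ltW// rising_gt0// total_param_gt0.
Qed.

Lemma law_given_starts A : measurable A ->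
  (\int[P]_(omega in E) (\1_A (X omega))%:E =
   \int[P]_(omega in E) mixture_law alpha i (W omega) (fun x : U => (\1_A x)%:E))%E.
Proof.
have mW (f : U -> \bar R) : measurable_fun setT f -> (forall x, 0 <= f x)%E ->
    measurable_fun setT (fun omega => mixture_law alpha i (W omega) f).
  move=> mf f0; apply: (measurableT_comp (measurable_mixture_law i alpha1 mf f0)).
  exact: measurable_limit_freq_sum.
have d1 := daniell_integral P measurable_E (fun omega => daniell_eval R (X omega))
  (fun f mf f0 => measurableT_comp mf measurable_limit_freq_vector).
have d2 := daniell_integral P measurable_E
  (fun omega => daniell_mixture_law K i alpha1 (W omega)) mW.
have W0 omega : 0 <= W omega by case/andP: (limit_freq_sum_bounds omega).
have PE : (\int[P]_(omega in E) cst 1 omega < +oo)%E.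
  by rewrite integral_cst// mul1e -ge0_fin_numE// fin_num_measure.
move=> mA.
(* The side K+1 is a crude bound for W, a sum of K+1 terms in [0, 1], valid for every [omega]. *)
apply: (@measure_moment_unique R K.+1 K.+1%:R (daniell_measure d1) (daniell_measure d2)) => //.
- rewrite (_ : daniell_measure d1 setT = (\int[P]_(omega in E) cst 1 omega)%E)//.
  by apply: eq_integral => omega _; rewrite indicT.
- rewrite (_ : daniell_measure d2 setT = (\int[P]_(omega in E) cst 1 omega)%E)//.
  apply: eq_integral => omega _; rewrite -(mixture_law1 alpha1 (W0 omega) C0).
  by congr mixture_law; apply/funext => x; rewrite indicT.
- apply: integral0_eq => omega _; rewrite indicE memNset//; apply; exact: limit_freq_vector_cube.
- apply: integral0_eq => omega _; exact: mixture_law_cubeC (limit_freq_sum_bounds omega).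
move=> r; pose r' l := if insub l is Some j then r j else 0%N.
have momE (m : {measure set U -> \bar R}) :
   (\int[m]_(x in cube K.+1%:R) (\prod_(j < K.+1) tnth x j ^+ r j)%:E =
    \int[m]_x (monomial r' x * \1_(cube K.+1%:R) x)%:E)%E.
  rewrite integral_mkcond; apply: eq_integral => x _.
  rewrite /patch indicE; case: ifP => _; last by rewrite mulr0.
  rewrite mulr1; congr EFin; apply: eq_bigr => j _; congr (_ ^+ _).
  by rewrite /r' valK.
have mM : measurable_fun setT (fun x : U => (monomial r' x * \1_(cube K.+1%:R) x)%:E).
  apply/measurable_EFinP; apply: measurable_funM; first exact: measurable_monomial.
  by apply: measurable_indic; exact: measurable_cube.
have M0 x : (0 <= (monomial r' x * \1_(cube K.+1%:R) x)%:E :> \bar R)%E.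
  rewrite lee_fin indicE; case: (boolP (x \in _)) => [|_]; last by rewrite mulr0.
  rewrite inE mulr1 => hx; apply: prodr_ge0 => j _; apply: exprn_ge0.
  by case/andP: (hx j).
rewrite !momE !integral_daniell//; exact: moment_given_starts.
Qed.

Lemma prob_startsE : P E = (V n.+1 K.+1 * C)%:E.
Proof. by rewrite mixture_massE (prob_starts alpha1 hV hPi K n0). Qed.

End disintegration.

(** The Dirac measure is only the fallback of [mnormalize] for degenerate mass. *)
Lemma measure_probability (R : realType) d (U : measurableType d)
    (m : {measure set U -> \bar R}) (x : U) :
  m setT = 1%E -> exists Q : probability U R, forall A, m A = Q A.
Proof.
move=> m1; exists (mnormalize m (\d_x)) => A /=.
by rewrite /mnormalize m1 onee_eq0 /= invr1 mule1.
Qed.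

Section conditional_distribution.
Context (R : realType) (d : measure_display) (T : measurableType d)
  (P : probability T R) (alpha : R) (V : nat -> nat -> R)
  (Pi : nat -> T -> seq {fset nat}) (K i : nat).
Hypotheses (alpha1 : alpha < 1) (hV : gibbs_coefficients alpha V)
  (hPi : exchangeable_gibbs_partition P alpha V Pi) (K0 : (0 < K)%N).
Local Notation U := (K.+1.-tuple R).
Local Notation n := (K + i)%N.
Local Notation X := (limit_freq_vector R Pi K.+1).
Local Notation W := (limit_freq_sum R Pi K.+1).
Let E := [set omega | starts_class n K (Pi n.+1 omega)].

(** Every scaled point has coordinate sum w, so a condition on the sum becomes one on w. Equality of
    the laws of X is thereby turned into a disintegration along W. *)
Lemma mixture_law_sum w (A : set U) (B : set R) :
  mixture_law alpha i w
    (fun x : U => (\1_(A `&` [set x : U | B (\sum_(j < K.+1) tnth x j)]) x)%:E) =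
  ((\1_B w)%:E * mixture_law alpha i w (fun x : U => (\1_A x)%:E))%E.
Proof.
have S (u : K.-tuple R) : \sum_(j < K.+1) tnth (scale_tuple w (simplex_point u)) j = w.
  under eq_bigr do rewrite tnth_mktuple.
  by rewrite -mulr_sumr sum_simplex_point mulr1.
have [Bw|Bw] := boolP (w \in B).
  rewrite [\1_B w]indicE Bw mul1e; congr (lebesgue_integral_tuple _); apply/funext => u.
  rewrite !indicE in_setI andb_idr// => _.
  by rewrite inE /= S; rewrite inE in Bw.
rewrite [\1_B w]indicE (negbTE Bw) mul0e -(LI0 R K); congr (lebesgue_integral_tuple _).
apply/funext => u; rewrite indicE in_setI [X in _ && X](_ : _ = false) ?andbF ?mule0//.
by apply/negbTE; rewrite notin_setE /= S -notin_setE.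
Qed.

Lemma conditional_law_starts : (0 < P E)%E ->
  conditional_law P E W X [set w : R | 0 < w]
    (cond_measure alpha V K.+1 i (fine (P E))).
Proof.
have PE : P E = _ := prob_startsE i alpha1 hV hPi K0.
rewrite PE lte_fin /= => /lt0r_neq0 pr0.
have C0 : mixture_mass alpha K i != 0 by apply: contraNneq pr0 => ->; rewrite mulr0.
have n0 : (0 < n)%N by rewrite addn_gt0 K0.
have mE : measurable E := measurable_starts hPi K n0.
have mX : measurable_fun setT X := @measurable_limit_freq_vector _ _ _ _ _ _ _ K hPi.
have mW : measurable_fun setT W := @measurable_limit_freq_sum _ _ _ _ _ _ _ K hPi.
have mindic (A : set U) : measurable A -> measurable_fun setT (fun x => (\1_A x)%:E : \bar R).
  by move=> mA; apply/measurable_EFinP; exact: measurable_indic.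
split => //.
- move=> w w0; pose Q := daniell_measure (daniell_mixture_law K i alpha1 w).
  have Q1 : Q setT = 1%E.
    rewrite -(mixture_law1 alpha1 (ltW w0) C0); congr mixture_law.
    by apply/funext => x; rewrite indicT.
  have [Q' QE] := measure_probability (simplex_point [tuple 0 | j < K]) Q1.
  by exists Q' => A mA; rewrite -QE; exact: cond_measureE.
- move=> A mA; apply: (eq_measurable_fun (fun w => mixture_law alpha i w (fun x : U => (\1_A x)%:E))).
    by move=> w; rewrite inE => w0; rewrite cond_measureE.
  apply: measurable_funTS; apply: measurable_mixture_law => //; exact: mindic.
move=> A B mA mB BD.
(* The event W in B is X in S, as W is the sum of the coordinates of X. *)
pose S : set U := [set x | B (\sum_(j < K.+1) tnth x j)].
have mS : measurable S.
  rewrite -[S]setTI; apply: (@measurable_sum _ U R setT 'I_K.+1 (index_enum _) (fun j x => tnth x j)) => // j.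
  exact: measurable_tnth.
have mAS : measurable (A `&` S) by exact: measurableI.
transitivity (\int[P]_(omega in E) (\1_(A `&` S) (X omega))%:E)%E.
  rewrite (_ : (fun omega => _) = fun omega => (\1_(X @^-1` (A `&` S)) omega)%:E).
    rewrite integral_indic//; last first.
      by rewrite -[X in measurable X]setTI; exact: mX.
    rewrite preimage_setI (_ : X @^-1` S = W @^-1` B).
      by congr (P _); rewrite setIC setIA setIAC.
    by apply/funext => omega; apply: (congr1 B); exact: sum_limit_freq_vector.
  by apply/funext => omega; rewrite !indicE; congr (nat_of_bool _)%:R%:E; apply/idP/idP; rewrite !inE.
rewrite (law_given_starts alpha1 hV hPi K0 C0 mAS).
transitivity (\int[P]_(omega in E) ((\1_(W @^-1` B) omega)%:E *
    mixture_law alpha i (W omega) (fun x : U => (\1_A x)%:E)))%E.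
  by apply: eq_integral => omega _; rewrite /S mixture_law_sum.
rewrite [RHS]integral_mkcondr; apply: eq_integral => omega _; rewrite /patch indicE.
case: (boolP (omega \in _)) => [|_]; last by rewrite mul0e.
by rewrite inE => /= /BD w0; rewrite mul1e cond_measureE.
Qed.

End conditional_distribution.

Theorem proposition7 (R : realType) (d : measure_display)
    (T : measurableType d) (P : probability T R)
    (alpha : R) (V : nat -> nat -> R) (Pi : nat -> T -> seq {fset nat})
    (k i : nat)
    (alpha_lt1 : alpha < 1)
    (hV : gibbs_coefficients alpha V)
    (hPi : exchangeable_gibbs_partition P alpha V Pi)
    (k_ge2 : (2 <= k)%N) :
  let E := [set omega : T |
             record_index R Pi k omega = ((k + i)%N%:R)%:E] in
  [/\ (* (i), conditional law of (X_1, ..., X_k) *)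
      (0 < P E)%E ->
      conditional_law P E (limit_freq_sum R Pi k) (limit_freq_vector R Pi k)
        [set w : R | 0 < w]
        (cond_measure alpha V k i (fine (P E))),
      (* (i), age-ordered sampling formula *)
      forall m : seq nat,
        size m = k.-1 -> all (fun b => (0 < b)%N) m -> sumn m = (k + i).-1 ->
        P [set omega | age_freq (Pi (k + i).-1 omega) = m] =
        (sampling_formula alpha V m)%:E,
      (* (ii) *)
      alpha != 0 -> P E = (V (k + i)%N k * record_factor k i alpha)%:E
    & (* (ii), alpha = 0 *)
      alpha = 0 ->
      exists2 c : R, record_factor k i a @[a --> (0 : R)^'] --> c &
                     P E = (V (k + i)%N k * c)%:E].
Proof.
case: k k_ge2 => // K K0 /=; rewrite ltnS in K0.
have n0 : (0 < K + i)%N by rewrite addn_gt0 K0.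
have -> : [set omega | record_index R Pi K.+1 omega = ((K.+1 + i)%N%:R)%:E] =
    [set omega | starts_class (K + i) K (Pi (K + i).+1 omega)].
  by apply/funext => omega; apply/propext; exact: (record_indexP hPi K omega n0).
have PE := prob_starts alpha_lt1 hV hPi K n0.
split.
- exact: conditional_law_starts.
- by move=> m _ m0 mn; exact: (prob_age_freq alpha_lt1 hV hPi n0).
- by move=> a0; rewrite PE record_factorE.
- move=> a0; exists (stirling 0 (K + i) K); first exact: record_factor_cvg0.
  by rewrite PE a0.
Qed.
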